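(* Let the random measure $\xi$ on $\mathbb R^d$ ($d\ge1$) have a density field $Z=(Z_s)_{s\in\mathbb R^d}$ which is strictly positive everywhere, and such that $Z$ is locally integrable along all lines in $\mathbb R^d$ and has infinite integral along all half-lines in $\mathbb R^d$. Let $X$ and $Z$ be defined on $(\Omega,\mathcal F,\mathbf P^\circ)$. Then $((X,Z),\xi)$ is mass-stationary (under $\mathbf P^\circ$) if and only if $((X,Z),\xi)$ is distributionally invariant under preserving shifts (under $\mathbf P^\circ$).
   Context: Setting. $(\Omega,\mathcal F,\mathbf P^\circ)$ is a measure space (not necessarily a probability space; extended if further randomization is needed). $\lambda$ is Lebesgue measure on $\mathbb R^d$. For a measure $\mu$ and a set $A$ with $0<\mu(A)<\infty$, $\mu(\cdot\mid A):=\mu(\cdot\cap A)/\mu(A)$. The symbol $\overset{D}{=}$ denotes equality of distributions. A random element $W$ in a measurable space $(G,\mathcal G)$ on which the additive group $\mathbb R^d$ acts by maps $\theta_t$ is called shift-measurable if $(t,w)\mapsto\theta_tw$ is measurable from $\mathbb R^d\times G$ to $G$. $X$ is a shift-measurable random element in a space $(E,\mathcal E)$. For a random field $Z=(Z_s)_{s\in\mathbb R^d}$, regarded as a random element of a shift-invariant path space with the $\sigma$-algebra generated by the evaluations, $\theta_tZ:=(Z_{t+s})_{s\in\mathbb R^d}$. For a measure, $\theta_t\xi(B):=\xi(B+t)$ for Borel $B\subseteq\mathbb R^d$. Shifts act componentwise: $\theta_t((X,Z),\xi)=((\theta_tX,\theta_tZ),\theta_t\xi)$. Random measures are locally finite.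 The distribution of $((X,Z),\xi)$ under $\mathbf P^\circ$, and also under the measure $Z_0^{-1}d\mathbf P^\circ$, is understood to be $\sigma$-finite. Density field: $\xi$ has density field $Z$ if $Z$ is a shift-measurable random field with values in $[0,\infty)$ and $\xi(ds)=Z_s\,ds$. Mass-stationarity: for a shift-measurable random element $W$ and a random measure $\xi$ having $0$ in its support $\mathbf P^\circ$-a.e., $(W,\xi)$ is mass-stationary under $\mathbf P^\circ$ if for all bounded Borel $C\subset\mathbb R^d$ with $\lambda(C)>0$ and $\lambda(\partial C)=0$, $$(\theta_{V_C}(W,\xi),V_C+U_C)\overset{D}{=}((W,\xi),U_C)\quad\text{under }\mathbf P^\circ,$$ where under $\mathbf P^\circ$ the conditional distribution of $U_C$ given $(W,\xi)$ is uniform on $C$ and the conditional distribution of $V_C$ given $((W,\xi),U_C)$ is $\xi(\cdot\mid C-U_C)$, with $C-x:=\{y-x:y\in C\}$. Here $W=(X,Z)$. Preserving shifts: let $\pi$ be a measurable map taking $Z$ to a location $\pi(Z)\in\mathbb R^d$. The induced allocation rule is $\tau(s):=s+\pi(\theta_sZ)$, $s\in\mathbb R^d$. $\pi$ is a preserving shift if for each fixed value of $\xi$ (i.e. each realization) $\tau$ preserves $\xi$, that is, $\xi(\{s\in\mathbb R^d:\tau(s)\in B\})=\xi(B)$ for all Borel $B\subseteq\mathbb R^d$. $((X,Z),\xi)$ is distributionally invariant under preserving shifts (under $\mathbf P^\circ$) if for all preserving shifts $\pi$ $$\theta_{\pi(Z)}((X,Z),\xi)\overset{D}{=}((X,Z),\xi)\quad\text{under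 }\mathbf P^\circ.$$ *)

(* Defs.v *)
From HB Require Import structures.
From mathcomp Require Import all_boot all_order all_algebra.
From mathcomp Require Import all_classical all_reals all_analysis.
From mathcomp Require Import measurable_realfun lra.

Set Implicit Arguments.
Unset Strict Implicit.
Unset Printing Implicit Defensive.

Import Order.TTheory GRing.Theory Num.Theory.
Import numFieldNormedType.Exports.

Local Open Scope classical_set_scope.
Local Open Scope ring_scope.

Definition mx_display : measure_display. Proof. by constructor. Qed.

Section borel_mx.
Context (R : realType) (m n : nat).

HB.instance Definition _ := @isMeasurable.Build mx_display 'M[R]_(m, n)
  <<s (@open 'M[R]_(m, n)) >> (@sigma_algebra0 _ setT _)
  (fun A mA => @sigma_algebraC _ _ A mA)
  (fun F mF => @sigma_algebra_bigcup _ setT _ F mF).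

Lemma open_measurable_mx (A : set 'M[R]_(m, n)) : open A -> measurable A.
Proof. exact: sub_sigma_algebra. Qed.

End borel_mx.

Section borel_mx_theory.
Context (R : realType).

Lemma continuous_measurable_mx m n p q (f : 'M[R]_(m, n) -> 'M[R]_(p, q)) :
  continuous f -> measurable_fun setT f.
Proof.
move=> /continuousP cf; apply: (@measurability _ _ _ _ setT f open erefl).
by move=> _ [A oA <-]; rewrite setTI; apply: open_measurable_mx; exact: cf.
Qed.

Lemma measurable_mx_coord m n i j :
  measurable_fun setT (fun M : 'M[R]_(m, n) => M i j).
Proof.
apply: (measurability _ (RGenOInfty.measurableE R)).
move=> _ [_ [a ->] <-]; rewrite setTI; apply: open_measurable_mx.
have /continuousP := @coord_continuous R m n i j.
by apply; rewrite set_itvoy; exact: open_gt.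
Qed.

Lemma measurable_fun_mx d (T : measurableType d) m n (f : T -> 'M[R]_(m, n)) :
  (forall i j, measurable_fun setT (fun x => f x i j)) -> measurable_fun setT f.
Proof.
move=> mf; apply: (@measurability _ _ _ _ setT f open erefl).
move=> _ [A oA <-]; rewrite setTI.
pose box (p : 'M[rat]_(m, n) * rat) : set 'M[R]_(m, n) :=
  [set M | forall i j, M i j \in `]ratr (p.1 i j) - ratr p.2,
                                   ratr (p.1 i j) + ratr p.2[].
have -> : f @^-1` A =
    \bigcup_p (if `[< box p `<=` A >] then f @^-1` box p else set0).
  apply/seteqP; split=> [x Afx|x [p _]]; last first.
    by case: asboolP => // pA; exact: pA.
  have /nbhs_ballP[e /= e0 eA] : nbhs (f x) A by exact: open_nbhs_nbhs.
  have [r] : exists r : rat, (ratr r : R) \in `]0, e / 2[.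
    by apply: rat_in_itvoo; rewrite divr_gt0.
  rewrite in_itv/= => /andP[r0 re].
  have q_ i j : {q : rat | ratr q \in `]f x i j - ratr r, f x i j + ratr r[}.
    by apply: cid; apply: rat_in_itvoo; rewrite ltrBlDr -addrA ltrDl addr_gt0.
  exists (\matrix_(i, j) sval (q_ i j), r) => //.
  have fxq i j : ratr (sval (q_ i j)) - ratr r < f x i j
      < ratr (sval (q_ i j)) + ratr r.
    case: (q_ i j) => q /=; rewrite in_itv/= => /andP[h1 h2].
    by rewrite ltrBlDr h2/= -ltrBlDr h1.
  rewrite asboolT => [i j|M bM]; first by rewrite /= mxE in_itv/= fxq.
  apply: eA; split=> // i j.
  have := bM i j; rewrite /= mxE in_itv/= => /andP[M1 M2].
  have /andP[f1 f2] := fxq i j.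
  rewrite /ball/= ltr_norml; move: re; rewrite ltr_pdivlMr// mulr2n mulrDr mulr1.
  by move=> re; apply/andP; split; lra.
apply: countable_bigcupT_measurable; first exact: countableP.
move=> p; case: asboolP => // _.
rewrite [X in measurable X](_ : _ = \bigcap_(i in setT) \bigcap_(j in setT)
  ((fun x => f x i j) @^-1` `]ratr (p.1 i j) - ratr p.2,
                                   ratr (p.1 i j) + ratr p.2[)).
  apply: fin_bigcap_measurable => // i _; apply: fin_bigcap_measurable => // j _.
  by rewrite -[X in measurable X]setTI; apply: mf.
apply/seteqP; split=> x /= h; first by move=> i _ j _; exact: h.
by move=> i j; exact: h.
Qed.

Lemma measurable_mxD n (t : 'rV[R]_n) :
  measurable_fun setT (fun s : 'rV[R]_n => s + t).
Proof.
apply: measurable_fun_mx => i j; under eq_fun do rewrite mxE.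
by apply: measurable_funD => //; exact: measurable_mx_coord.
Qed.

Lemma measurable_row_mx n : measurable_fun setT
  (fun p : measurableTypeR R * 'rV[R]_n => row_mx (p.1%:M : 'M[R]_1) p.2).
Proof.
apply: measurable_fun_mx => i j; rewrite (ord1 i).
case: (split_ordP j) => k -> {j}.
  under eq_fun do rewrite row_mxEl (ord1 k) mxE eqxx mulr1n.
  exact: measurable_fst.
under eq_fun do rewrite row_mxEr.
exact: measurableT_comp (@measurable_mx_coord _ _ _ _) measurable_snd.
Qed.

End borel_mx_theory.

(* Lebesgue measure on R^n: the product of n copies of the Lebesgue measure of
   the line, transported along R * R^n ~ R^(n+1). *)

Section lebesgue_rV.
Context (R : realType).

Section cons.
Context (n : nat) (mu : {sigma_finite_measure set 'rV[R]_n -> \bar R}).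
Local Open Scope ereal_scope.

Let cons_rV (p : measurableTypeR R * 'rV[R]_n) : 'rV[R]_n.+1 :=
  row_mx (p.1%:M : 'M[R]_1) p.2.

Definition lebesgue_cons : set 'rV[R]_n.+1 -> \bar R :=
  pushforward ((@lebesgue_measure R) \x mu) cons_rV.

Let mcons_rV : measurable_fun setT cons_rV.
Proof. exact: measurable_row_mx. Qed.

Let mpre A : measurable A -> measurable (cons_rV @^-1` A).
Proof. by move=> mA; rewrite -[X in measurable X]setTI; exact: mcons_rV. Qed.

Let lebesgue_cons0 : lebesgue_cons set0 = 0.
Proof. by rewrite /lebesgue_cons /pushforward preimage_set0 measure0. Qed.

Let lebesgue_cons_ge0 A : 0 <= lebesgue_cons A.
Proof. exact: measure_ge0. Qed.

Let lebesgue_cons_sigma_additive : semi_sigma_additive lebesgue_cons.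
Proof.
move=> F mF tF mUF; rewrite /lebesgue_cons /pushforward preimage_bigcup.
apply: measure_semi_sigma_additive.
- by move=> i; exact: mpre.
- apply/trivIsetP => /= i j _ _ ij; rewrite -preimage_setI.
  by move/trivIsetP : tF => /(_ _ _ _ _ ij) ->//; rewrite preimage_set0.
- by rewrite -preimage_bigcup; exact: mpre.
Qed.

HB.instance Definition _ := isMeasure.Build _ _ _ lebesgue_cons
  lebesgue_cons0 lebesgue_cons_ge0 lebesgue_cons_sigma_additive.

Let lebesgue_cons_sigma_finite : sigma_finite setT lebesgue_cons.
Proof.
have [F FT Foo] : sigma_finite setT ((@lebesgue_measure R) \x mu).
  have /sigma_finiteP[F [TF ndF Foo]] :=
    @sigma_finiteT _ _ _ (@lebesgue_measure R).
  have /sigma_finiteP[G [TG ndG Goo]] := sigma_finiteT mu.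
  exists (fun k => F k `*` G k).
    rewrite -setXTT TF TG predeqE => -[x y]; split.
      move=> [/= [k _ Fkx] [l _ Gly]]; exists (maxn k l) => //; split.
      - by move: x Fkx; exact/subsetPset/ndF/leq_maxl.
      - by move: y Gly; exact/subsetPset/ndG/leq_maxr.
    by move=> [k _ []/= ? ?]; split; exists k.
  move=> k; have [? ?] := Foo k; have [? ?] := Goo k.
  split; first exact: measurableX.
  by rewrite product_measure1E// lte_mul_pinfty// ge0_fin_numE.
pose uncons (v : 'rV[R]_(1 + n)) : measurableTypeR R * 'rV[R]_n :=
  (v ord0 ord0, rsubmx v).
have unconsK v : cons_rV (uncons v) = v.
  rewrite /cons_rV/uncons/=; set x := _%:M.
  have -> : x = lsubmx v; last by rewrite hsubmxK.
  apply/matrixP => i j; rewrite !ord1 !mxE/= mulr1n.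
  by congr (v _ _); exact/val_inj.
have consK p : uncons (cons_rV p) = p.
  case: p => x v; rewrite /cons_rV/uncons/= row_mxKr; congr (_, _).
  have -> : (ord0 : 'I_(1 + n)) = lshift n ord0 by exact/val_inj.
  by rewrite row_mxEl mxE.
have muncons : measurable_fun setT uncons.
  apply/measurable_fun_pairP; split => /=; first exact: measurable_mx_coord.
  apply: measurable_fun_mx => i j; under eq_fun do rewrite mxE.
  exact: measurable_mx_coord.
exists (fun k => uncons @^-1` F k) => [|k].
  by apply/seteqP; split=> // v _; rewrite -preimage_bigcup -FT.
have [mF Fk] := Foo k; split.
  by rewrite -[X in measurable X]setTI; exact: muncons.
rewrite /lebesgue_cons /pushforward (_ : _ @^-1` _ = F k)//.
by apply/seteqP; split=> p /=; rewrite consK.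
Qed.

HB.instance Definition _ := Measure_isSigmaFinite.Build _ _ _ lebesgue_cons
  lebesgue_cons_sigma_finite.

End cons.

Fixpoint lebesgue_rV (n : nat) : {sigma_finite_measure set 'rV[R]_n -> \bar R} :=
  if n is m.+1 then lebesgue_cons (lebesgue_rV m) else dirac (0 : 'rV[R]_0).

Lemma lebesgue_rV_box n (A : 'I_n -> set R) : (forall i, measurable (A i)) ->
  lebesgue_rV n [set v | forall i, A i (v ord0 i)] =
  (\prod_(i < n) (@lebesgue_measure R) (A i))%E.
Proof.
elim: n A => [|n IHn] A mA.
  rewrite big_ord0 /= diracE (_ : _ \in _) ?mem_set//.
  by move=> [].
rewrite big_ord_recl -(IHn (A \o lift ord0))/=; last by move=> i; exact: mA.
rewrite /lebesgue_cons /pushforward -product_measure1E; last 2 first.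
- exact: mA.
- rewrite [X in measurable X](_ : _ = \bigcap_(i in setT)
    ((fun v : 'rV[R]_n => v ord0 i) @^-1` A (lift ord0 i))).
    apply: fin_bigcap_measurable => // i _; rewrite -[X in measurable X]setTI.
    by apply: measurable_mx_coord => //; exact: mA.
  by apply/seteqP; split=> v /= h i; [move=> _|]; exact: h.
have rowl (x : R) (v : 'rV[R]_n) :
    (row_mx (x%:M : 'M[R]_1) v : 'rV[R]_(n.+1)) ord0 ord0 = x.
  have -> : (ord0 : 'I_n.+1) = lshift n (ord0 : 'I_1) by exact/val_inj.
  by transitivity ((x%:M : 'M[R]_1) ord0 ord0); [exact: row_mxEl|rewrite mxE].
have rowr (x : R) (v : 'rV[R]_n) i :
    (row_mx (x%:M : 'M[R]_1) v : 'rV[R]_(n.+1)) ord0 (lift ord0 i) = v ord0 i.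
  have -> : lift ord0 i = rshift 1 i by exact/val_inj.
  exact: row_mxEr.
congr (_ _); apply/seteqP; split=> [[x v]/= Axv|[x v]/= [Ax Av] i].
  split=> [|i]; first by have := Axv ord0; rewrite rowl.
  by have := Axv (lift ord0 i); rewrite rowr.
by case: (unliftP ord0 i) => [j ->|->]; rewrite ?rowl ?rowr//; exact: Av.
Qed.

End lebesgue_rV.

Definition locally_finite (R : realType) n (mu : set 'rV[R]_n -> \bar R) :=
  forall B : set 'rV[R]_n, measurable B -> bounded_set B -> (mu B < +oo)%E.

Record lfmeasure (R : realType) (n : nat) := LFMeasure {
  lfmeasure_val :> {measure set 'rV[R]_n -> \bar R};
  lfmeasureP : locally_finite lfmeasure_val }.

Definition lfmeasure_display : measure_display. Proof. by constructor. Qed.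

Section lfmeasure_theory.
Context (R : realType) (n : nat).

Lemma locally_finite_mzero : locally_finite (@mzero _ 'rV[R]_n R).
Proof. by move=> B _ _; rewrite /mzero ltey. Qed.

HB.instance Definition _ := gen_eqMixin (lfmeasure R n).
HB.instance Definition _ := gen_choiceMixin (lfmeasure R n).
HB.instance Definition _ :=
  isPointed.Build (lfmeasure R n) (LFMeasure locally_finite_mzero).

Definition lfmeasure_evals : set (set (lfmeasure R n)) :=
  \bigcup_(B in (measurable : set (set 'rV[R]_n)))
    preimage_set_system setT (fun mu : lfmeasure R n => mu B) measurable.

HB.instance Definition _ := @isMeasurable.Build lfmeasure_display
  (lfmeasure R n) <<s lfmeasure_evals >> (@sigma_algebra0 _ setT _)
  (fun A mA => @sigma_algebraC _ _ A mA)
  (fun F mF => @sigma_algebra_bigcup _ setT _ F mF).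

Section shift.
Context (t : 'rV[R]_n) (mu : lfmeasure R n).

Definition mshift : set 'rV[R]_n -> \bar R :=
  fun B => mu [set s + t | s in B].

Let mshiftE : mshift = fun B => mu ((fun s => s - t) @^-1` B).
Proof.
apply/funext => B; congr (mu _); apply/seteqP; split=> [_ [s Bs <-]|s Bs] /=.
  by rewrite addrK.
by exists (s - t) => //; rewrite subrK.
Qed.

Let mpre (B : set 'rV[R]_n) :
  measurable B -> measurable ((fun s => s - t) @^-1` B).
Proof.
by move=> mB; rewrite -[X in measurable X]setTI; exact: measurable_mxD.
Qed.

Let mshift0 : mshift set0 = 0%E.
Proof. by rewrite mshiftE preimage_set0 measure0. Qed.

Let mshift_ge0 B : (0 <= mshift B)%E.
Proof. exact: measure_ge0. Qed.

Let mshift_sigma_additive : semi_sigma_additive mshift.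
Proof.
move=> F mF tF mUF; rewrite mshiftE preimage_bigcup.
apply: measure_semi_sigma_additive.
- by move=> i; exact: mpre.
- apply/trivIsetP => /= i j _ _ ij; rewrite -preimage_setI.
  by move/trivIsetP : tF => /(_ _ _ _ _ ij) ->//; rewrite preimage_set0.
- by rewrite -preimage_bigcup; exact: mpre.
Qed.

HB.instance Definition _ := isMeasure.Build _ _ _ mshift
  mshift0 mshift_ge0 mshift_sigma_additive.

Lemma mshift_locally_finite : locally_finite mshift.
Proof.
move=> B mB [M [Mr bM]]; rewrite mshiftE; apply: lfmeasureP; first exact: mpre.
exists (M + `|t|); split; first by rewrite num_real.
move=> x Mx s /= Bst; rewrite -[s](subrK t).
rewrite (le_trans (ler_normD _ _))// -lerBrDr.
by apply: (bM (x - `|t|)) => //; rewrite ltrBrDr.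
Qed.

Definition lfmeasure_shift : lfmeasure R n := LFMeasure mshift_locally_finite.

End shift.
End lfmeasure_theory.

Definition fun_shift (R : realType) n (t : 'rV[R]_n) (z : 'rV[R]_n -> R) :
  'rV[R]_n -> R := fun s => z (t + s).

(* A random field with values in [0, +oo[ is a random element of field_path H for
   some path space H, the sigma-algebra being generated by the evaluations. *)
Record path_space (R : realType) (n : nat) := PathSpace {
  paths : set ('rV[R]_n -> R);
  paths_nonempty : paths !=set0;
  paths_ge0 : forall z, paths z -> forall s, 0 <= z s;
  paths_shift : forall t z, paths z -> paths (fun_shift t z) }.

Record field_path (R : realType) (n : nat) (H : path_space R n) := FieldPath {
  field_val :> 'rV[R]_n -> R;
  field_pathP : paths H field_val }.

Definition field_display : measure_display. Proof. by constructor. Qed.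

Section field_theory.
Context (R : realType) (n : nat) (H : path_space R n).

HB.instance Definition _ := gen_eqMixin (field_path H).
HB.instance Definition _ := gen_choiceMixin (field_path H).
HB.instance Definition _ :=
  isPointed.Build (field_path H) (FieldPath (svalP (cid (paths_nonempty H)))).

Definition field_evals : set (set (field_path H)) :=
  \bigcup_(s in setT)
    preimage_set_system setT (fun z : field_path H => z s) (measurable : set (set R)).

HB.instance Definition _ := @isMeasurable.Build field_display
  (field_path H) <<s field_evals >> (@sigma_algebra0 _ setT _)
  (fun A mA => @sigma_algebraC _ _ A mA)
  (fun F mF => @sigma_algebra_bigcup _ setT _ F mF).

Definition field_shift (t : 'rV[R]_n) (z : field_path H) : field_path H :=
  FieldPath (paths_shift t (field_pathP z)).

End field_theory.

Section shifts.
Context (R : realType) (n : nat).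

Definition additive_action (G : Type) (theta : 'rV[R]_n -> G -> G) :=
  (forall w, theta 0 w = w) /\
  (forall s t w, theta (s + t) w = theta s (theta t w)).

Definition shift_measurable d (G : measurableType d)
    (theta : 'rV[R]_n -> G -> G) :=
  measurable_fun setT (fun p : 'rV[R]_n * G => theta p.1 p.2).

Definition pair_shift (G1 G2 : Type) (theta1 : 'rV[R]_n -> G1 -> G1)
    (theta2 : 'rV[R]_n -> G2 -> G2) (t : 'rV[R]_n) (w : G1 * G2) : G1 * G2 :=
  (theta1 t w.1, theta2 t w.2).

End shifts.

Section distributions.
Context (R : realType).

Definition eq_distr d d' (T : measurableType d) (S : measurableType d')
    (P : set T -> \bar R) (Y Y' : T -> S) :=
  forall A, measurable A -> pushforward P Y A = pushforward P Y' A.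

(* mu(B | A) when 0 < mu A < +oo; the value is 0 when mu A is 0 or +oo. *)
Definition cond_measure d (T : measurableType d) (mu : set T -> \bar R)
    (A B : set T) : \bar R := (mu (B `&` A) * ((fine (mu A))^-1)%:E)%E.

(* Under P, the conditional distribution of V given Y is kappa (Y, .); P need not
   be a probability. *)
Definition cond_distr d d1 d2 (T : measurableType d) (S1 : measurableType d1)
    (S2 : measurableType d2) (P : set T -> \bar R) (Y : T -> S1) (V : T -> S2)
    (kappa : S1 -> set S2 -> \bar R) :=
  forall A B, measurable A -> measurable B ->
    P (Y @^-1` A `&` V @^-1` B) = (\int[P]_(w in Y @^-1` A) kappa (Y w) B)%E.

Definition boundary (T : topologicalType) (A : set T) := closure A `\` A°.

Definition in_support n (s : 'rV[R]_n) (mu : set 'rV[R]_n -> \bar R) :=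
  forall A, open A -> A s -> (0 < mu A)%E.

End distributions.

Section mass_stationarity.
Context (R : realType) (n : nat).
Context d (Omega : measurableType d) (P : {measure set Omega -> \bar R}).

(* The randomization variables U and V live on an arbitrary extension
   (Omega', P') of (Omega, P), given by a measure preserving map
   p : Omega' -> Omega; the conditional distributions below determine the joint
   law of (W, xi, U, V), so the choice of the extension is immaterial. *)
Definition mass_stationary d' (G : measurableType d')
    (theta : 'rV[R]_n -> G -> G) (W : Omega -> G) (xi : Omega -> lfmeasure R n) :=
  {ae P, forall w, in_support 0 (xi w)} /\
  forall C : set 'rV[R]_n, measurable C -> bounded_set C ->
    (0 < lebesgue_rV R n C)%E -> lebesgue_rV R n (boundary C) = 0%E ->
  forall e (Omega' : measurableType e) (P' : {measure set Omega' -> \bar R})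
      (p : Omega' -> Omega) (U V : Omega' -> 'rV[R]_n),
    let Wxi w := (W (p w), xi (p w)) in
    measurable_fun setT p ->
    (forall A, measurable A -> P' (p @^-1` A) = P A) ->
    measurable_fun setT U -> measurable_fun setT V ->
    cond_distr P' Wxi U (fun _ => cond_measure (lebesgue_rV R n) C) ->
    cond_distr P' (fun w => (Wxi w, U w)) V
      (fun y => cond_measure y.1.2 [set c - y.2 | c in C]) ->
    eq_distr P'
      (fun w => (pair_shift theta (@lfmeasure_shift R n) (V w) (Wxi w),
                 V w + U w))
      (fun w => (Wxi w, U w)).

Context (H : path_space R n) (Z : Omega -> field_path H) (xi : Omega -> lfmeasure R n).

Definition density_field :=
  shift_measurable (@field_shift R n H) /\
  forall w B, measurable B ->
    xi w B = (\int[lebesgue_rV R n]_(s in B) (Z w s)%:E)%E.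

(* The allocation rule s |-> s + pi (theta_s Z) preserves each realization of xi. *)
Definition preserving_shift (pi : field_path H -> 'rV[R]_n) :=
  measurable_fun setT pi /\
  forall w B, measurable B ->
    xi w ((fun s => s + pi (field_shift s (Z w))) @^-1` B) = xi w B.

Definition invariant_under_preserving_shifts d' (E : measurableType d')
    (theta : 'rV[R]_n -> E -> E) (X : Omega -> E) :=
  forall pi, preserving_shift pi ->
    eq_distr P
      (fun w => pair_shift (pair_shift theta (@field_shift R n H))
                  (@lfmeasure_shift R n) (pi (Z w)) ((X w, Z w), xi w))
      (fun w => ((X w, Z w), xi w)).

End mass_stationarity.

(* Main.v *)
From HB Require Import structures.
Require Import Defs.
From mathcomp Require Import all_boot all_order all_algebra.
From mathcomp Require Import all_classical all_reals all_analysis.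
From mathcomp Require Import measurable_realfun lra ring.

Set Implicit Arguments.
Unset Strict Implicit.
Unset Printing Implicit Defensive.

Import Order.TTheory GRing.Theory Num.Theory.
Import numFieldNormedType.Exports.

Local Open Scope classical_set_scope.
Local Open Scope ring_scope.

(* Let Y = ((X, Z), xi).  Both properties are equivalent to stationarity of Y
   under the Palm-type measure Z_0^-1 dP, i.e. to the invariance of
   k |-> E[Z_0^-1 k(theta_t Y)] in t.

   Stationarity and Fubini make E[f(theta_pi Y)] a mass-transport integral, in
   which the allocation s |-> s + pi(theta_s Z) preserves Z_s ds; hence invariance
   under preserving shifts.  Conversely, moving along the lines in direction e
   until mass r has been swept is a preserving shift; integrating the invariance
   over r and returning to the time scale s by the change of variables
   dr = Z_(s e) ds gives E[Z_0^-1 k(theta_e Y)] = E[Z_0^-1 k(Y)].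

   Mass-stationarity for the window C says that
     1_C(u) 1_C(x) Z_(x - u) g(theta_(x - u) Y, x)  and  1_C(u) 1_C(x) Z_(x - u) g(Y, u)
   have the same integral with respect to dP du dx, where g(Y, u) = f(Y, u) / xi(C - u)
   is arbitrary.  Comparing C = A `|` B with C = A for disjoint A and B separates
   u from x, so that g(Y, u) may be replaced by h(Y, u, x), and g(theta_(x - u) Y, x)
   by h(theta_(x - u) Y, x, u), with u in B and x in A.  For
   h(Y, u, x) = k(Y) / (Z_0 Z_(x - u)) the average of E[Z_0^-1 k(theta_(x - u) Y)]
   over x in A and u in B is E[Z_0^-1 k(Y)], whatever A and B are;
   letting A be the unit ball at 0 (for k o theta_t) or at t (for k) gives
   stationarity. *)

(** * Measures with a density and image measures *)

Section measure_preserving.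
Local Open Scope ereal_scope.
Context (R : realType).

Lemma ge0_integral_comp d d' (T : measurableType d) (T' : measurableType d')
    (mu : {measure set T -> \bar R}) (nu : {measure set T' -> \bar R})
    (phi : T -> T') (f : T' -> \bar R) : measurable_fun setT phi ->
  (forall A, measurable A -> mu (phi @^-1` A) = nu A) ->
  measurable_fun setT f -> (forall y, 0 <= f y) ->
  \int[mu]_x f (phi x) = \int[nu]_y f y.
Proof.
move=> mphi munu mf f0.
rewrite -(ge0_integral_pushforward mphi mu measurableT mf)//.
by apply: eq_measure_integral => A mA _; exact: munu.
Qed.

Definition image_measure d d' (T : measurableType d) (T' : measurableType d')
    (mu : {measure set T -> \bar R}) (phi : T -> T')
    (mphi : measurable_fun setT phi) : {measure set T' -> \bar R} :=
  measure_function_pushforward__canonical__measure_function_Measure mu mphi.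

Lemma ge0_integral_image_measure d d' (T : measurableType d) (T' : measurableType d')
    (mu : {measure set T -> \bar R}) (phi : T -> T')
    (mphi : measurable_fun setT phi) (f : T' -> \bar R) :
  measurable_fun setT f -> (forall y, 0 <= f y) ->
  \int[image_measure mu mphi]_y f y = \int[mu]_x f (phi x).
Proof.
move=> mf f0; apply/esym.
exact: (@ge0_integral_comp _ _ _ _ mu (image_measure mu mphi) phi f mphi).
Qed.

End measure_preserving.

Section density.
Local Open Scope ereal_scope.
Context d (T : measurableType d) (R : realType).
Variables (mu : {measure set T -> \bar R}) (f : T -> R).
Hypotheses (mf : measurable_fun setT f) (f0 : forall x, (0 <= f x)%R).

Let mEf : measurable_fun setT (EFin \o f). Proof. exact/measurable_EFinP. Qed.

Definition mdensity (A : set T) : \bar R := \int[mu]_(x in A) (f x)%:E.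

Let mdensity0 : mdensity set0 = 0.
Proof. by rewrite /mdensity integral_set0. Qed.

Let mdensity_ge0 A : 0 <= mdensity A.
Proof. by apply: integral_ge0 => x _; rewrite lee_fin. Qed.

Let mdensity_sigma_additive : semi_sigma_additive mdensity.
Proof.
move=> F mF tF mUF; rewrite /mdensity ge0_integral_bigcup//; last 2 first.
- exact: measurable_funTS.
- by move=> x _; rewrite lee_fin.
by apply: is_cvg_nneseries => n _ _; apply: integral_ge0 => x _; rewrite lee_fin.
Qed.

HB.instance Definition _ := isMeasure.Build _ _ _ mdensity
  mdensity0 mdensity_ge0 mdensity_sigma_additive.

Definition density_measure : {measure set T -> \bar R} := mdensity.

Import HBNNSimple.

Lemma ge0_integral_density_measure (g : T -> \bar R) :
  measurable_fun setT g -> (forall x, 0 <= g x) ->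
  \int[density_measure]_x g x = \int[mu]_x ((f x)%:E * g x).
Proof.
move=> mg g0.
pose g_ := nnsfun_approx measurableT mg.
have gE x : limn (fun n => (g_ n x)%:E) = g x.
  by apply/cvg_lim => //; exact: cvg_nnsfun_approx.
transitivity (limn (fun n => \int[density_measure]_x (g_ n x)%:E)).
  rewrite -monotone_convergence//.
  - by apply: eq_integral => x _; rewrite gE.
  - by move=> n; exact/measurable_EFinP.
  - by move=> n x _; rewrite lee_fin.
  - by move=> x _ m n mn; rewrite lee_fin; exact/lefP/nd_nnsfun_approx.
rewrite [X in limn X](_ : _ = (fun n => \int[mu]_x ((f x)%:E * (g_ n x)%:E))); last first.
  apply/funext => n.
  under [LHS]eq_integral do rewrite fimfunE -fsumEFin//.
  rewrite ge0_integral_fsum//; last 2 first.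
  - by move=> y; exact/measurable_EFinP/measurable_funM.
  - by move=> y x _; rewrite nnfun_muleindic_ge0.
  under [RHS]eq_integral.
    move=> x _; rewrite fimfunE -fsumEFin// ge0_mule_fsumr; last first.
      by move=> y; rewrite nnfun_muleindic_ge0.
    over.
  rewrite ge0_integral_fsum//; last 2 first.
  - move=> y; apply: emeasurable_funM => //.
    by apply/measurable_EFinP/measurable_funM.
  - by move=> y x _; apply: mule_ge0; [rewrite lee_fin|exact: nnfun_muleindic_ge0].
  apply: eq_fsbigr => r _; rewrite integralZl_indic_nnsfun// integral_indic//= setIT.
  under [RHS]eq_integral do rewrite EFinM muleCA.
  have [r0|r0] := ltP r 0%R.
    rewrite preimage_nnfun0// measure0 mule0 integral0_eq// => x _.
    by rewrite indic0 mule0 mule0.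
  rewrite ge0_integralZl ?lee_fin//; last 2 first.
  - apply: emeasurable_funM => //.
    by apply/measurable_EFinP; exact: measurable_indic.
  - by move=> x _; rewrite mule_ge0 ?lee_fin// lee_fin.
  congr (_ * _); rewrite -[LHS]/(mdensity _) /mdensity integral_mkcond/=.
  apply: eq_integral => x _; rewrite patchE indicE.
  by case: ifPn => _; rewrite ?mule1 ?mule0.
rewrite -monotone_convergence//.
- apply: eq_integral => x _; rewrite -gE limeMl//.
    by apply: ereal_nondecreasing_is_cvgn => m n mn; rewrite lee_fin; exact/lefP/nd_nnsfun_approx.
- by move=> n; apply: emeasurable_funM => //; exact/measurable_EFinP.
- by move=> n x _; rewrite mule_ge0 ?lee_fin// lee_fin.
- move=> x _ m n mn; apply: lee_wpmul2l; rewrite lee_fin//.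
  exact/lefP/nd_nnsfun_approx.
Qed.

End density.

Section measure_uniqueness.
Local Open Scope ereal_scope.
Context d (T : measurableType d) (R : realType).

Lemma measure_eq_exhaustion (m1 m2 : {measure set T -> \bar R}) (F : nat -> set T)
    (A : set T) : (forall k, measurable (F k)) -> nondecreasing_seq F ->
  \bigcup_k F k = setT -> measurable A ->
  (forall k, m1 (A `&` F k) = m2 (A `&` F k)) -> m1 A = m2 A.
Proof.
move=> mF ndF FT mA m12.
have lim (m : {measure set T -> \bar R}) : m (A `&` F k) @[k --> \oo] --> m A.
  rewrite [X in _ --> m X](_ : A = \bigcup_k (A `&` F k)); last first.
    by rewrite -setI_bigcupr FT setIT.
  apply: nondecreasing_cvg_mu.
  - by move=> k; exact: measurableI.
  - by apply: bigcupT_measurable => k; exact: measurableI.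
  - by move=> i j ij; apply/subsetPset; apply: setIS; exact/subsetPset/ndF.
apply: (cvg_unique _ (lim m1)) => //.
have -> : (fun k => m1 (A `&` F k)) = (fun k => m2 (A `&` F k)) by apply/funext.
exact: lim.
Qed.

End measure_uniqueness.

Lemma prod_measure_eq (R : realType) d d' (T : measurableType d) (T' : measurableType d')
    (m1 m2 : {measure set (T * T')%type -> \bar R}) (F : nat -> set T) :
  (forall k, measurable (F k)) -> nondecreasing_seq F ->
  \bigcup_k F k = setT -> (forall k, m1 (F k `*` setT) < +oo)%E ->
  (forall k A B, measurable A -> measurable B ->
    m1 ((A `&` F k) `*` B) = m2 ((A `&` F k) `*` B)) ->
  forall D, measurable D -> m1 D = m2 D.
Proof.
move=> mF ndF FT finF m12 D mD.
apply: (measure_unique [set A `*` B | A in measurable & B in measurable]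
  (fun k => F k `*` setT)) => //.
- exact: measurable_prod_measurableType.
- move=> _ _ [A1 mA1 [B1 mB1 <-]] [A2 mA2 [B2 mB2 <-]].
  exists (A1 `&` A2); first exact: measurableI.
  by exists (B1 `&` B2); [exact: measurableI|rewrite setXI].
- by move=> k; exists (F k) => //; exists setT.
- apply/seteqP; split => // -[x y] _.
  have [k _ Fx] : (\bigcup_k F k) x by rewrite FT.
  by exists k.
move=> _ [A mA [B mB <-]].
apply: (@measure_eq_exhaustion _ _ _ _ _ (fun k => F k `*` setT)).
- by move=> k; exact: measurableX.
- by move=> i j ij; apply/subsetPset => -[x y] [/= Fx _]; split => //; move: x Fx; exact/subsetPset/ndF.
- apply/seteqP; split => // -[x y] _.
  have [k _ Fx] : (\bigcup_k F k) x by rewrite FT.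
  by exists k.
- exact: measurableX.
- by move=> k; rewrite -setXI setIT; exact: m12.
Qed.

(** * Lebesgue measure on R^n *)

Section lebesgue_translation.
Context (R : realType).
Local Notation leb := (@lebesgue_measure R).

Lemma lebesgue_measure_translation (t : R) (A : set R) : measurable A ->
  leb ((fun x => x + t) @^-1` A) = leb A.
Proof.
move=> mA; have mt : measurable_fun setT (fun x : measurableTypeR R => x + t).
  exact: measurable_funD.
apply/esym/(lebesgue_measure_unique (mu := pushforward leb _)) => //.
move=> _ [[a b] _ <-]; rewrite /pushforward.
rewrite [X in _ = leb X](_ : _ = `]a - t, b - t]%classic).
  by rewrite !lebesgue_measure_itv/= !lte_fin ltrD2r -!EFinB opprD addrACA addrN addr0.
by apply/seteqP; split => x /=; rewrite !in_itv/= ltrBlDr lerBrDr.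
Qed.

Lemma lebesgue_rV_translation n (t : 'rV[R]_n) (A : set 'rV[R]_n) :
  measurable A ->
  lebesgue_rV R n ((fun s => s + t) @^-1` A) = lebesgue_rV R n A.
Proof.
elim: n => [|n IHn] in t A *.
  move=> _; congr (lebesgue_rV R 0 _); apply/seteqP; split => s /=;
    by rewrite (_ : s + t = s)// [LHS]thinmx0 [RHS]thinmx0.
move=> mA; rewrite /= /lebesgue_cons /pushforward.
set c := (c in c @^-1` _).
pose u : R := (t : 'rV_(1 + n)) ord0 ord0.
pose v : 'rV[R]_n := rsubmx (t : 'rV_(1 + n)).
pose phi (p : measurableTypeR R * 'rV[R]_n) := (p.1 + u, p.2 + v) : measurableTypeR R * 'rV[R]_n.
have mphi : measurable_fun setT phi.
  apply: measurable_fun_pair => /=; first exact: measurable_funD.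
  by apply: (measurableT_comp (measurable_mxD _)).
have ct p : c p + t = c (phi p).
  case: p => x s; rewrite /c /phi/=.
  transitivity (row_mx (x%:M : 'M[R]_1) s + row_mx (lsubmx (t : 'rV_(1 + n))) v).
    by rewrite hsubmxK.
  rewrite add_row_mx; congr row_mx; apply/matrixP => i j.
  by rewrite !ord1 !mxE /= !mulr1n; congr (_ + t _ _); exact/val_inj.
have -> : c @^-1` ((fun s => s + t) @^-1` A) = phi @^-1` (c @^-1` A).
  by apply/seteqP; split => p /=; rewrite ct.
have mcA : measurable (c @^-1` A).
  by rewrite -[X in measurable X]setTI; apply: measurable_row_mx.
apply/esym/(@product_measure_unique _ _ _ _ _ leb (lebesgue_rV R n) (pushforward _ phi)) => //.
move=> B C mB mC.
transitivity (leb ((fun x : R => (x + u)%R) @^-1` B) *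
    lebesgue_rV R n ((fun s => (s + v)%R) @^-1` C))%E; last first.
  by rewrite IHn// lebesgue_measure_translation.
rewrite -product_measure1E//.
- by rewrite -[X in measurable X]setTI; apply: measurable_funD.
- by rewrite -[X in measurable X]setTI; apply: measurable_mxD.
Qed.

Lemma ge0_integral_lebesgue_translation (t : R) (f : R -> \bar R) :
  measurable_fun setT f -> (forall x, 0 <= f x)%E ->
  (\int[leb]_x f (x + t)%R = \int[leb]_x f x)%E.
Proof.
move=> mf f0.
apply: (@ge0_integral_comp _ _ _ _ _ leb leb (fun x => x + t)) => //.
  exact: measurable_funD.
by move=> A mA; exact: lebesgue_measure_translation.
Qed.

Lemma ge0_integral_lebesgueN (f : R -> \bar R) :
  measurable_fun setT f -> (forall x, 0 <= f x)%E ->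
  (\int[leb]_x f (- x)%R = \int[leb]_x f x)%E.
Proof.
move=> mf f0; apply: (@ge0_integral_comp _ _ _ _ _ leb leb -%R) => //.
by move=> A mA; exact: lebesgue_measureN.
Qed.

Lemma ge0_integral_lebesgue_rV_translation n (t : 'rV[R]_n) (f : 'rV[R]_n -> \bar R) :
  measurable_fun setT f -> (forall x, 0 <= f x)%E ->
  (\int[lebesgue_rV R n]_x f (x + t)%R = \int[lebesgue_rV R n]_x f x)%E.
Proof.
move=> mf f0.
apply: (@ge0_integral_comp _ _ _ _ _ (lebesgue_rV R n) (lebesgue_rV R n) (fun x => x + t)) => //.
  exact: measurable_mxD.
by move=> A mA; exact: lebesgue_rV_translation.
Qed.

End lebesgue_translation.

Section jordan.
Context (R : realType) (n : nat).
Local Notation V := 'rV[R]_n.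
Local Notation lam := (lebesgue_rV R n).

Lemma closed_measurable_mx (A : set V) : closed A -> measurable A.
Proof.
move=> cA; rewrite -[A]setCK; apply: measurableC.
by apply: open_measurable_mx; exact: closed_openC.
Qed.

Lemma boundaryI (T : topologicalType) (A B : set T) :
  boundary (A `&` B) `<=` boundary A `|` boundary B.
Proof.
move=> x [/closureI[cA cB]]; rewrite interiorI => /not_andP[iA|iB].
  by left.
by right.
Qed.

Lemma boundaryC (T : topologicalType) (A : set T) : boundary (~` A) = boundary A.
Proof. by rewrite /boundary closure_setC interiorC setDE setCK setIC -setDE. Qed.

Lemma boundaryT (T : topologicalType) : boundary [set: T] = set0.
Proof. by rewrite /boundary interiorT setDT. Qed.

Lemma measurable_boundary (A : set V) : measurable (boundary A).
Proof.
apply: measurableD; last first.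
  by apply: open_measurable_mx; exact: open_interior.
by apply: closed_measurable_mx; exact: closed_closure.
Qed.

Definition jordan : set (set V) :=
  [set B : set V | measurable B /\ lam (boundary B) = 0%E].

Lemma jordanI : setI_closed jordan.
Proof.
move=> A B [mA A0] [mB B0]; split; first exact: measurableI.
apply: (@subset_measure0 _ _ _ lam _ (boundary A `|` boundary B)).
- exact: measurable_boundary.
- by apply: measurableU; exact: measurable_boundary.
- exact: boundaryI.
- by apply: null_set_setU => //; exact: measurable_boundary.
Qed.

Lemma jordanC A : jordan A -> jordan (~` A).
Proof. by move=> [mA A0]; split; [exact: measurableC|rewrite boundaryC]. Qed.

Lemma jordanT : jordan setT.
Proof. by split => //; rewrite boundaryT measure0. Qed.

Lemma jordanU A B : jordan A -> jordan B -> jordan (A `|` B).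
Proof.
move=> jA jB; rewrite -[A `|` B]setCK setCU; apply: jordanC.
by apply: jordanI; exact: jordanC.
Qed.

Lemma ball_rVE (c : V) r : 0 < r ->
  ball c r = [set v : V | forall i, `]c ord0 i - r, c ord0 i + r[%classic (v ord0 i)].
Proof.
move=> r0; apply/seteqP; split => [v [_ h] i|v h].
  by have := h ord0 i; rewrite /= in_itv/= -ltr_distl distrC.
by split => // i j; have := h j; rewrite (ord1 i) /= in_itv/= -ltr_distl distrC.
Qed.

Lemma open_ball_rV (c : V) r : open (ball c r).
Proof. exact: ball_open. Qed.

Lemma measurable_ball_rV (c : V) r : measurable (ball c r).
Proof. by apply: open_measurable_mx; exact: open_ball_rV. Qed.

Lemma lebesgue_rV_ball (c : V) r : 0 < r -> lam (ball c r) = ((r *+ 2) ^+ n)%:E.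
Proof.
move=> r0; rewrite ball_rVE// (lebesgue_rV_box (A := fun i => `]c ord0 i - r, c ord0 i + r[%classic))//.
rewrite (eq_bigr (fun=> (r *+ 2)%:E)); last first.
  move=> i _; rewrite lebesgue_measure_itv/= lte_fin ltrD2l gtrN// -EFinB.
  by congr EFin; ring.
by rewrite prodEFin prodr_const card_ord.
Qed.

Lemma lebesgue_rV_hyperplane (i : 'I_n) (a : R) : lam [set v | v ord0 i = a] = 0%E.
Proof.
rewrite [X in lam X](_ : _ = [set v : V | forall j, (if j == i then [set a] else setT) (v ord0 j)]).
  rewrite (lebesgue_rV_box (A := fun j => if j == i then [set a] else setT)).
    by rewrite (bigD1 i)//= eqxx lebesgue_measure_set1 mul0e.
  by move=> j; case: ifPn.
apply/seteqP; split => [v /= vi j|v /= /(_ i)]; last by rewrite eqxx.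
by case: eqP => // ->.
Qed.

Lemma jordan_ball (c : V) r : 0 < r -> jordan (ball c r).
Proof.
move=> r0; split; first exact: measurable_ball_rV.
pose F i : set V := [set v | v ord0 i = c ord0 i - r] `|` [set v | v ord0 i = c ord0 i + r].
have mH i a : measurable [set v : V | v ord0 i = a].
  rewrite -[X in measurable X]setTI.
  exact: (@measurable_mx_coord R _ _ _ _ measurableT [set a]).
have mF i : measurable (F i) by apply: measurableU; exact: mH.
have [mU U0] : measurable (\big[setU/set0]_(i < n) F i) /\
    lam (\big[setU/set0]_(i < n) F i) = 0%E.
  apply: (big_ind (fun A => measurable A /\ lam A = 0%E)).
  - by rewrite measure0.
  - move=> A B [mA A0] [mB B0]; split; first exact: measurableU.
    exact: null_set_setU.
  - by move=> i _; split => //; apply: null_set_setU; try exact: mH;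
      exact: lebesgue_rV_hyperplane.
apply: (@subset_measure0 _ _ _ lam _ (\big[setU/set0]_(i < n) F i)) => //.
  exact: measurable_boundary.
move=> v [cv]; rewrite (_ : (ball c r)° = ball c r); last first.
  by apply/interior_id; exact: open_ball_rV.
have le i : `|v ord0 i - c ord0 i| <= r.
  rewrite leNgt; apply/negP => rv.
  have rv0 : 0 < `|v ord0 i - c ord0 i| - r by rewrite subr_gt0.
  have [w [[_ /(_ ord0 i) h1] [_ /(_ ord0 i) h2]]] := cv _ (nbhsx_ballx v _ rv0).
  move: h1 h2; rewrite /ball/= => h1 h2.
  have := ler_distD (w ord0 i) (v ord0 i) (c ord0 i).
  by rewrite [`|w _ _ - _|]distrC => h3; lra.
rewrite ball_rVE// => /existsNP[i] /= /negP; rewrite in_itv/= -ltr_distl -leNgt => ge.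
have vi : `|v ord0 i - c ord0 i| = r by apply/le_anti; rewrite le ge.
rewrite (bigD1 i)//=; left.
have [h|h] := leP 0 (v ord0 i - c ord0 i).
  by right => /=; rewrite -vi ger0_norm// addrC subrK.
by left => /=; rewrite -vi ltr0_norm// opprK addrC subrK.
Qed.

Lemma measurable_jordan : (measurable : set (set V)) = <<s jordan >>.
Proof.
apply/seteqP; split; last first.
  by apply: smallest_sub; [exact: sigma_algebra_measurable|move=> A []].
apply: smallest_sub; first exact: smallest_sigma_algebra.
move=> A oA.
pose box (p : 'rV[rat]_n * rat) : set V := ball (map_mx ratr p.1 : V) (ratr p.2).
have -> : A = \bigcup_p (if `[< box p `<=` A /\ 0 < p.2 >] then box p else set0).
  apply/seteqP; split=> [x Ax|x [p _]]; last first.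
    by case: asboolP => // -[pA _]; exact: pA.
  have /nbhs_ballP[e /= e0 eA] : nbhs x A by exact: open_nbhs_nbhs.
  have [r] : exists r : rat, (ratr r : R) \in `]0, e / 2[.
    by apply: rat_in_itvoo; rewrite divr_gt0.
  rewrite in_itv/= => /andP[r0 re].
  have q_ i j : {q : rat | ratr q \in `]x i j - ratr r, x i j + ratr r[}.
    by apply: cid; apply: rat_in_itvoo; rewrite ltrBlDr -addrA ltrDl addr_gt0.
  exists (\matrix_(i, j) sval (q_ i j), r) => //.
  have xq : ball (map_mx ratr (\matrix_(i, j) sval (q_ i j)) : V) (ratr r) x.
    split => // i j; rewrite !mxE /ball/=; case: (q_ i j) => q /=.
    by rewrite in_itv/= -ltr_distl distrC.
  rewrite asboolT//; split; last by rewrite -(ltr0q R).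
  move=> y xy; apply: eA; apply: (@le_ball _ _ _ (ratr r + ratr r)); first by lra.
  by apply: ball_triangle xy; exact: ball_sym.
apply: (@countable_bigcupT_measurable _ (g_sigma_algebraType jordan)).
  exact: countableP.
move=> p; case: asboolP => [[_ p0]|_]; last exact: measurable0.
by apply: sub_sigma_algebra; apply: jordan_ball; rewrite ltr0q.
Qed.

Lemma lebesgue_rV_bounded (B : set V) : measurable B -> bounded_set B ->
  (lam B < +oo)%E.
Proof.
move=> mB [M [Mr bM]].
have BM : B `<=` ball 0 (`|M| + 2).
  move=> x Bx; rewrite mx_norm_ball /ball_/= sub0r normrN.
  apply: (@le_lt_trans _ _ (`|M| + 1)); last by rewrite ltrD2l ltr1n.
  by apply: (bM (`|M| + 1)) => //; rewrite ltr_pwDr// ler_norm.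
apply: (@le_lt_trans _ _ (lam (ball 0 (`|M| + 2)))).
  by apply: le_measure; rewrite ?inE//; exact: measurable_ball_rV.
by rewrite lebesgue_rV_ball ?ltry// ltr_wpDl.
Qed.

Lemma bounded_ball (c : V) r : bounded_set (ball c r).
Proof.
exists (`|c| + r); split; first by rewrite num_real.
move=> M rM x; rewrite mx_norm_ball /ball_/= => cx.
by have := ler_normB c (c - x); rewrite opprB addrC subrK; lra.
Qed.

Lemma bounded_setU (A B : set V) : bounded_set A -> bounded_set B ->
  bounded_set (A `|` B).
Proof.
move=> [M [Mr bM]] [N [Nr bN]]; exists (Num.max M N); split.
  by rewrite max_real.
move=> K; rewrite gt_max => /andP[MK NK] x [Ax|Bx]; first exact: bM.
exact: bN.
Qed.

Lemma open_lebesgue_rV_gt0 (A : set V) : open A -> A !=set0 -> (0 < lam A)%E.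
Proof.
move=> oA [x Ax]; have /nbhs_ballP[e /= e0 eA] : nbhs x A by exact: open_nbhs_nbhs.
apply: (@lt_le_trans _ _ (lam (ball x e))).
  by rewrite lebesgue_rV_ball// lte_fin exprn_gt0// pmulrn_lgt0.
apply: le_measure; rewrite ?inE//; first exact: measurable_ball_rV.
exact: open_measurable_mx.
Qed.

End jordan.

Lemma measurable_preimage d d' (T : measurableType d) (T' : measurableType d')
    (f : T -> T') (A : set T') :
  measurable_fun setT f -> measurable A -> measurable (f @^-1` A).
Proof. by move=> mf mA; rewrite -[X in measurable X]setTI; exact: mf. Qed.

Lemma measurable_invr d (T : measurableType d) (R : realType) (f : T -> R) :
  measurable_fun setT f -> measurable_fun setT (fun x => (f x)^-1).
Proof.
move=> mf.
have -> : (fun x => (f x)^-1) = (fun x => f x * ((f x ^+ 2) `^ (-1))).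
  apply/funext => x; rewrite powR_inv1 ?sqr_ge0//.
  have [->|fx0] := eqVneq (f x) 0; first by rewrite invr0 mul0r.
  by rewrite expr2 invfM mulrA divff// mul1r.
apply: measurable_funM => //.
have mf2 : measurable_fun setT (fun x => f x ^+ 2).
  by under eq_fun do rewrite expr2; exact: measurable_funM.
exact: (measurableT_comp (measurable_powR (-1)) mf2).
Qed.

Section rV_measurability.
Context (R : realType) (n : nat) d (T : measurableType d).
Implicit Types f g : T -> 'rV[R]_n.

Let measurable_coord f i j : measurable_fun setT f ->
  measurable_fun setT (fun x => f x i j).
Proof. by move=> mf; exact: (measurableT_comp (@measurable_mx_coord R 1 n i j) mf). Qed.

Lemma measurable_rVD f g : measurable_fun setT f -> measurable_fun setT g ->
  measurable_fun setT (fun x => f x + g x).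
Proof.
move=> mf mg; apply: measurable_fun_mx => i j; under eq_fun do rewrite mxE.
by apply: measurable_funD; exact: measurable_coord.
Qed.

Lemma measurable_rVN f : measurable_fun setT f ->
  measurable_fun setT (fun x => - f x).
Proof.
move=> mf; apply: measurable_fun_mx => i j; under eq_fun do rewrite mxE.
exact: (measurableT_comp (@oppr_measurable R setT) (measurable_coord i j mf)).
Qed.

Lemma measurable_rVB f g : measurable_fun setT f -> measurable_fun setT g ->
  measurable_fun setT (fun x => f x - g x).
Proof. by move=> mf mg; apply: measurable_rVD => //; exact: measurable_rVN. Qed.

Lemma measurable_rVZ (h : T -> R) (e : 'rV[R]_n) : measurable_fun setT h ->
  measurable_fun setT (fun x => h x *: e).
Proof.
move=> mh; apply: measurable_fun_mx => i j; under eq_fun do rewrite mxE.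
exact: measurable_funM.
Qed.

End rV_measurability.

Section lfmeasure_shift_action.
Context (R : realType) (n : nat).
Local Notation V := 'rV[R]_n.
Local Notation M := (lfmeasure R n).

Lemma lfmeasure_eq (mu nu : M) : (mu = nu :> (set V -> \bar R)) -> mu = nu.
Proof.
case: mu nu => mu mulf [nu nulf]/= /eq_measure munu; subst nu.
by congr LFMeasure; exact: Prop_irrelevance.
Qed.

Lemma lfmeasure_shift_action : additive_action (@lfmeasure_shift R n).
Proof.
split=> [mu|s t mu]; apply: lfmeasure_eq; apply/funext => B /=; rewrite /mshift.
  congr (lfmeasure_val mu _); apply/seteqP; split => [_ [s Bs <-]|s Bs].
    by rewrite addr0.
  by exists s => //; rewrite addr0.
congr (lfmeasure_val mu _); apply/seteqP; split => [_ [x Bx <-]|_ [_ [x Bx <-] <-]].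
  by exists (x + s); [exists x|rewrite addrA].
by exists x => //; rewrite addrA.
Qed.

Let ker (p : V * M) : {measure set V -> \bar R} := lfmeasure_val p.2.

Let measurable_ker U : measurable U -> measurable_fun setT (ker ^~ U).
Proof.
move=> mU; apply: (measurableT_comp (f := fun mu : M => mu U)) => // _ A mA.
by apply: sub_sigma_algebra; exists U => //; exists A.
Qed.

HB.instance Definition _ := isKernel.Build _ _ _ _ R ker measurable_ker.

Lemma lfmeasure_shift_measurable : shift_measurable (@lfmeasure_shift R n).
Proof.
apply: (measurability (@lfmeasure_evals R n)) => // _ [_ [B mB [S mS <-]] <-].
rewrite !setTI.
suff : measurable_fun setT (fun p : V * M => mshift p.1 p.2 B).
  by move=> /measurable_preimage /(_ mS).
pose A : set ((V * M) * V) := [set q | B (q.2 - q.1.1)].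
have mA : measurable A.
  apply: (measurable_preimage (f := fun q : (V * M) * V => q.2 - q.1.1)) => //.
  by apply: measurable_rVB => //; exact: measurableT_comp.
have AE (p : V * M) : mshift p.1 p.2 B = ker p (xsection A p).
  congr (lfmeasure_val p.2 _); apply/seteqP; split => [_ [s Bs <-]|s /xsectionP Bs].
    by apply/xsectionP; rewrite /A/= addrK.
  by exists (s - p.1) => //; rewrite subrK.
pose D N : set V := ball 0 N%:R.
have mD N : measurable (D N) by exact: measurable_ball_rV.
apply: (emeasurable_fun_cvg (fun N p => mrestr (ker p) (mD N) (xsection A p))).
  move=> N.
  have [] // := @measurable_prod_subset_xsection_kernel _ _ _ _ R ker _ (mD N) _ A mA.
  move=> p; have [r [r0 kr]] : exists r : R, (0 <= r)%R /\ (ker p (D N) <= r%:E)%E.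
    exists (fine (ker p (D N))); split; first exact: fine_ge0.
    rewrite fineK// ge0_fin_numE//.
    by apply: lfmeasureP => //; exact: bounded_ball.
  exists (r + 1) => U mU; apply: (@le_lt_trans _ _ r%:E); last by rewrite lte_fin ltrDl.
  by apply: le_trans kr; apply: le_measure; rewrite ?inE//; exact: measurableI.
move=> p _; rewrite AE.
have mx : measurable (xsection A p) by exact: measurable_xsection.
rewrite [X in _ --> ker p X](_ : _ = \bigcup_N (xsection A p `&` D N)); last first.
  apply/seteqP; split => [s As|s [N _ []]//].
  exists (Num.bound `|s|) => //; split => //.
  rewrite /D mx_norm_ball /ball_/= sub0r normrN.
  exact: archi_boundP.
apply: nondecreasing_cvg_mu.
- by move=> N; exact: measurableI.
- by apply: bigcupT_measurable => N; exact: measurableI.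
- move=> N N' NN'; apply/subsetPset; apply: setIS; apply: le_ball.
  by rewrite ler_nat.
Qed.

End lfmeasure_shift_action.

(** * Mecke-type equations and stationarity *)

Section lebesgue_rV2.
Local Open Scope ereal_scope.
Context (R : realType) (n : nat).
Local Notation V := 'rV[R]_n.
Local Notation lam := (lebesgue_rV R n).

Definition lebesgue_rV2 : set (V * V) -> \bar R := lam \x lam.

HB.instance Definition _ := Measure.on lebesgue_rV2.

Let lebesgue_rV2_sigma_finite : sigma_finite setT lebesgue_rV2.
Proof.
pose D (k : nat) : set V := ball (0 : V)%R k.+1%:R%R.
have mD k : measurable (D k) by exact: measurable_ball_rV.
have DE x k : (`|x| < k%:R)%R -> D k x.
  move=> xk; rewrite /D mx_norm_ball /ball_/= sub0r normrN (lt_le_trans xk)//.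
  by rewrite ler_nat.
exists (fun k => D k `*` D k) => [|k].
  apply/seteqP; split => // -[x y] _.
  exists (Num.bound (Num.max `|x| `|y|)%R) => //=.
  have : (Num.max `|x| `|y| < (Num.bound (Num.max `|x| `|y|))%:R)%R.
    by apply: archi_boundP; rewrite le_max normr_ge0.
  by rewrite gt_max => /andP[xk yk]; split; exact: DE.
split; first exact: measurableX.
rewrite /lebesgue_rV2 product_measure1E//.
have fD : lam (D k) < +oo by apply: lebesgue_rV_bounded => //; exact: bounded_ball.
by apply: lte_mul_pinfty => //; rewrite ge0_fin_numE.
Qed.

HB.instance Definition _ := Measure_isSigmaFinite.Build _ _ _ lebesgue_rV2
  lebesgue_rV2_sigma_finite.

Local Notation lam2 := lebesgue_rV2.

Lemma ge0_integral_lam2_swap (f : V * V -> \bar R) :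
  measurable_fun setT f -> (forall p, 0 <= f p) ->
  \int[lam2]_p f (p.2, p.1) = \int[lam2]_p f p.
Proof.
move=> mf f0; rewrite (fubini_tonelli1 (fun p => f (p.2, p.1)))//.
  by rewrite (fubini_tonelli2 f).
by apply: measurableT_comp => //; exact: measurable_fun_pair.
Qed.

Lemma ge0_integral_lam2_shear (h : V -> V) (f : V * V -> \bar R) :
  measurable_fun setT h -> measurable_fun setT f -> (forall p, 0 <= f p) ->
  \int[lam2]_p f (p.1, (p.2 + h p.1)%R) = \int[lam2]_p f p.
Proof.
move=> mh mf f0; rewrite (fubini_tonelli1 (fun p : V * V => f (p.1, (p.2 + h p.1)%R)))//.
  rewrite (fubini_tonelli1 f mf f0).
  apply: eq_integral => x _.
  rewrite /fubini_F.
  apply: (@ge0_integral_lebesgue_rV_translation _ _ (h x) (fun y => f (x, y))) => //.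
  by apply: measurableT_comp => //; exact: measurable_fun_pair.
apply: measurableT_comp => //; apply: measurable_fun_pair => //.
by apply: measurable_rVD => //; exact: measurableT_comp.
Qed.

Definition bump (s : V) : R := ((2 ^+ n)^-1 * \1_(ball (0 : V) 1) s)%R.

Lemma bump_ge0 s : (0 <= bump s)%R.
Proof. by rewrite mulr_ge0// invr_ge0 exprn_ge0. Qed.

Lemma measurable_bump : measurable_fun setT bump.
Proof.
apply: measurable_funM => //; apply: measurable_indic.
exact: measurable_ball_rV.
Qed.

Lemma integral_bump : \int[lam]_s (bump s)%:E = 1.
Proof.
under eq_integral do rewrite EFinM.
rewrite ge0_integralZl//; last first.
  apply/measurable_EFinP; apply: measurable_indic; exact: measurable_ball_rV.
rewrite integral_indic//; last exact: measurable_ball_rV.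
rewrite setIT [X in _ * X](lebesgue_rV_ball 0 ltr01) -EFinM mulVf//.
Qed.

End lebesgue_rV2.

Section stationarity.
Local Open Scope ereal_scope.
Context (R : realType) (n : nat).
Local Notation V := 'rV[R]_n.
Local Notation lam := (lebesgue_rV R n).
Local Notation lam2 := (@lebesgue_rV2 R n).
Context dO (Omega : measurableType dO)
  (P : {sigma_finite_measure set Omega -> \bar R}).
Context dS (S : measurableType dS) (th : V -> S -> S).
Hypotheses (th_action : additive_action th) (mth : shift_measurable th).
Variable zeta : S -> R.
Hypotheses (mzeta : measurable_fun setT zeta) (zeta_ge0 : forall y, (0 <= zeta y)%R).
Variable Y : Omega -> S.
Hypotheses (mY : measurable_fun setT Y)
  (zetaY_gt0 : forall w s, (0 < zeta (th s (Y w)))%R).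

Definition palm (k : S -> \bar R) := \int[P]_w (((zeta (Y w))^-1)%:E * k (Y w)).

Definition stationary := forall t (k : S -> \bar R),
  measurable_fun setT k -> (forall y, 0 <= k y) -> palm (k \o th t) = palm k.

Definition field (y : S) (s : V) : R := zeta (th s y).

Lemma th0 y : th 0%R y = y. Proof. exact: th_action.1. Qed.
Lemma thD s t y : th s (th t y) = th (s + t)%R y.
Proof. by rewrite th_action.2. Qed.

Lemma field0 y : field y 0 = zeta y. Proof. by rewrite /field th0. Qed.
Lemma field_th t y s : field (th t y) s = field y (s + t).
Proof. by rewrite /field thD. Qed.
Lemma field_ge0 y s : (0 <= field y s)%R. Proof. exact: zeta_ge0. Qed.
Lemma zeta_gt0 w : (0 < zeta (Y w))%R.
Proof. by rewrite -field0; exact: zetaY_gt0. Qed.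

Section measurability.
Context d (T : measurableType d).

Lemma measurable_th (f : T -> V) (g : T -> S) : measurable_fun setT f ->
  measurable_fun setT g -> measurable_fun setT (fun x => th (f x) (g x)).
Proof.
move=> mf mg.
exact: (measurableT_comp mth (measurable_fun_pair mf mg)).
Qed.

Lemma measurable_field (f : T -> V) (g : T -> S) : measurable_fun setT f ->
  measurable_fun setT g -> measurable_fun setT (fun x => field (g x) (f x)).
Proof. by move=> mf mg; apply: measurableT_comp => //; exact: measurable_th. Qed.

End measurability.

Lemma palm_zeta k : palm (fun y => (zeta y)%:E * k y) = \int[P]_w k (Y w).
Proof.
apply: eq_integral => w _.
by rewrite muleA -EFinM mulVf ?gt_eqF ?zeta_gt0// mul1e.
Qed.

Lemma stationary_preserving (pi : S -> V) (f : S -> \bar R) :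
  stationary -> measurable_fun setT pi ->
  (forall w (g : V -> \bar R), measurable_fun setT g -> (forall s, 0 <= g s) ->
    \int[lam]_s ((field (Y w) s)%:E * g (s + pi (th s (Y w)))%R) =
    \int[lam]_s ((field (Y w) s)%:E * g s)) ->
  measurable_fun setT f -> (forall y, 0 <= f y) ->
  \int[P]_w f (th (pi (Y w)) (Y w)) = \int[P]_w f (Y w).
Proof.
move=> stat mpi pres mf f0.
have mb := @measurable_bump R n.
have mbE : measurable_fun setT (fun s : V => (bump s)%:E) by exact/measurable_EFinP.
have b0 s : 0 <= (@bump R n s)%:E by rewrite lee_fin bump_ge0.
have mfpi : measurable_fun setT (fun y => f (th (pi y) y)).
  by apply: measurableT_comp => //; exact: measurable_th.
pose K (s : V) y := (zeta y)%:E * ((bump (s + pi y)%R)%:E * f (th (pi y) y)).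
pose K' (s : V) y := (zeta y)%:E * ((bump s)%:E * f y).
have mEz : measurable_fun setT (fun y => (zeta y)%:E) by exact/measurable_EFinP.
have K0 s y : 0 <= K s y by rewrite !mule_ge0 ?lee_fin ?bump_ge0.
have K'0 s y : 0 <= K' s y by rewrite !mule_ge0 ?lee_fin ?bump_ge0.
have mK : measurable_fun setT (fun p => K p.1 p.2).
  apply: emeasurable_funM; first exact: measurableT_comp mEz _.
  apply: emeasurable_funM; last exact: measurableT_comp mfpi _.
  apply: (measurableT_comp mbE); apply: measurable_rVD => //.
  exact: measurableT_comp.
have mK' : measurable_fun setT (fun p => K' p.1 p.2).
  apply: emeasurable_funM; first exact: measurableT_comp mEz _.
  apply: emeasurable_funM; last exact: measurableT_comp mf _.
  exact: measurableT_comp mbE _.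
have mzE : measurable_fun setT (fun w => ((zeta (Y w))^-1)%:E).
  by apply/measurable_EFinP; apply: measurable_invr; exact: measurableT_comp.
have zE0 w : 0 <= ((zeta (Y w))^-1)%:E by rewrite lee_fin invr_ge0.
have tonelli (J : V -> S -> \bar R) : (forall s y, 0 <= J s y) ->
    measurable_fun setT (fun p => J p.1 p.2) ->
    \int[lam]_s palm (J s \o th s) =
    \int[P]_w (((zeta (Y w))^-1)%:E * \int[lam]_s J s (th s (Y w))).
  move=> J0 mJ.
  have mJ' : measurable_fun setT (fun p : V * Omega => J p.1 (th p.1 (Y p.2))).
    apply: (measurableT_comp mJ (f := fun p => J p.1 p.2)
      (g := fun p : V * Omega => (p.1, th p.1 (Y p.2)))).
    apply: measurable_fun_pair => //; apply: measurable_th => //.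
    exact: measurableT_comp.
  rewrite (fubini_tonelli (fun p : V * Omega =>
      ((zeta (Y p.2))^-1)%:E * J p.1 (th p.1 (Y p.2))))//=.
  - apply: eq_integral => w _; rewrite ge0_integralZl//.
    exact: measurableT_comp mJ' (measurable_fun_pair _ _).
  - by apply: emeasurable_funM => //; exact: measurableT_comp mzE _.
  - by move=> p; rewrite mule_ge0.
transitivity (\int[lam]_s palm (K s)).
  under [RHS]eq_integral do rewrite /K palm_zeta.
  rewrite (fubini_tonelli (fun p : V * Omega =>
      ((bump (p.1 + pi (Y p.2))%R)%:E * f (th (pi (Y p.2)) (Y p.2)))))//=.
  - apply: eq_integral => w _; rewrite ge0_integralZr//.
    + rewrite (@ge0_integral_lebesgue_rV_translation _ _ _ (fun s => (bump s)%:E))//.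
      by rewrite integral_bump mul1e.
    + apply: measurableT_comp mbE _; exact: measurable_mxD.
  - apply: emeasurable_funM.
      apply: measurableT_comp mbE _; apply: measurable_rVD => //.
      by apply: measurableT_comp => //; exact: measurableT_comp.
    by apply: measurableT_comp mfpi _; exact: measurableT_comp.
  - by move=> p; rewrite mule_ge0.
transitivity (\int[lam]_s palm (K' s)); last first.
  under eq_integral do rewrite /K' palm_zeta.
  rewrite (fubini_tonelli (fun p : V * Omega => (bump p.1)%:E * f (Y p.2)))//=.
  - apply: eq_integral => w _; rewrite ge0_integralZr//.
    by rewrite integral_bump mul1e.
  - apply: emeasurable_funM; first exact: measurableT_comp mbE _.
    by apply: measurableT_comp => //; exact: measurableT_comp.
  - by move=> p; rewrite mule_ge0.
transitivity (\int[lam]_s palm (K s \o th s)).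
  apply: eq_integral => s _; apply/esym; apply: (stat s (K s)) => [|y]; last exact: K0.
  exact: measurableT_comp mK (measurable_fun_pair _ _).
transitivity (\int[lam]_s palm (K' s \o th s)); last first.
  apply: eq_integral => s _; apply: (stat s (K' s)) => [|y]; last exact: K'0.
  exact: measurableT_comp mK' (measurable_fun_pair _ _).
rewrite (tonelli K K0 mK) (tonelli K' K'0 mK').
apply: eq_integral => w _; congr (_ * _).
rewrite -[RHS](pres w (fun s => (bump s)%:E * f (th s (Y w)))).
- by apply: eq_integral => s _; rewrite /K thD [(pi _ + s)%R]addrC.
- apply: emeasurable_funM => //; apply: measurableT_comp => //.
  exact: measurable_th.
- by move=> s; rewrite mule_ge0.
Qed.

Let PL : {measure set (Omega * (V * V))%type -> \bar R} := P \x lam2.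

Definition pair_density (q : Omega * (V * V)) : R :=
  field (Y q.1) (q.2.2 - q.2.1).

Definition moved (q : Omega * (V * V)) : (S * V) * V :=
  ((th (q.2.2 - q.2.1)%R (Y q.1), q.2.2), q.2.1).

Definition unmoved (q : Omega * (V * V)) : (S * V) * V :=
  ((Y q.1, q.2.1), q.2.2).

Lemma measurable_pair_diff d (T : measurableType d) :
  measurable_fun setT (fun q : T * (V * V) => (q.2.2 - q.2.1)%R).
Proof.
by apply: measurable_rVB; apply: measurableT_comp measurable_snd => //.
Qed.

Lemma measurable_pair_density : measurable_fun setT pair_density.
Proof.
apply: measurable_field; first exact: measurable_pair_diff.
exact: measurableT_comp.
Qed.

Lemma pair_density_ge0 q : (0 <= pair_density q)%R.
Proof. exact: field_ge0. Qed.

Lemma measurable_moved : measurable_fun setT moved.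
Proof.
apply: measurable_fun_pair; last exact: measurableT_comp.
apply: measurable_fun_pair; last exact: measurableT_comp.
by apply: measurable_th; [exact: measurable_pair_diff|exact: measurableT_comp].
Qed.

Lemma measurable_unmoved : measurable_fun setT unmoved.
Proof.
apply: measurable_fun_pair; last exact: measurableT_comp.
by apply: measurable_fun_pair; exact: measurableT_comp.
Qed.

Let dens := density_measure PL measurable_pair_density pair_density_ge0.

(* Mecke's equation says that these two measures agree. *)
Definition moved_measure := image_measure dens measurable_moved.
Definition unmoved_measure := image_measure dens measurable_unmoved.

Let integral_image (phi : Omega * (V * V) -> (S * V) * V)
    (mphi : measurable_fun setT phi) (g : (S * V) * V -> \bar R) :
  measurable_fun setT g -> (forall x, 0 <= g x) ->
  \int[image_measure dens mphi]_x g x = \int[P]_w \int[lam2]_p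
    ((field (Y w) (p.2 - p.1))%:E * g (phi (w, p))).
Proof.
move=> mg g0.
have mgphi : measurable_fun setT (fun q => g (phi q)) by exact: measurableT_comp.
rewrite ge0_integral_image_measure// ge0_integral_density_measure//.
rewrite (fubini_tonelli1 (fun q => (pair_density q)%:E * g (phi q)))//.
  apply: emeasurable_funM => //; apply/measurable_EFinP.
  exact: measurable_pair_density.
by move=> q; rewrite mule_ge0// lee_fin pair_density_ge0.
Qed.

Lemma integral_moved (g : (S * V) * V -> \bar R) :
  measurable_fun setT g -> (forall x, 0 <= g x) ->
  \int[moved_measure]_x g x = \int[P]_w \int[lam2]_p
    ((field (Y w) (p.2 - p.1))%:E * g ((th (p.2 - p.1)%R (Y w), p.2), p.1)).
Proof. exact: integral_image. Qed.

Lemma integral_unmoved (g : (S * V) * V -> \bar R) :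
  measurable_fun setT g -> (forall x, 0 <= g x) ->
  \int[unmoved_measure]_x g x = \int[P]_w \int[lam2]_p
    ((field (Y w) (p.2 - p.1))%:E * g ((Y w, p.1), p.2)).
Proof. exact: integral_image. Qed.

Lemma stationary_mecke (g : (S * V) * V -> \bar R) : stationary ->
  measurable_fun setT g -> (forall x, 0 <= g x) ->
  \int[moved_measure]_x g x = \int[unmoved_measure]_x g x.
Proof.
move=> stat mg g0; rewrite (integral_moved mg g0) (integral_unmoved mg g0).
pose K (p : V * V) y :=
  (zeta y)%:E * ((field y (p.2 - p.1))%:E * g ((th (p.2 - p.1)%R y, p.2), p.1)).
pose H (p : V * V) := \int[P]_w ((field (Y w) (p.2 - p.1))%:E * g ((Y w, p.1), p.2)).
have mF (phi : Omega * (V * V) -> (S * V) * V) : measurable_fun setT phi ->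
    measurable_fun setT (fun q : Omega * (V * V) => (field (Y q.1) (q.2.2 - q.2.1))%:E * g (phi q)).
  move=> mphi; apply: emeasurable_funM; last exact: measurableT_comp.
  apply/measurable_EFinP; exact: measurable_pair_density.
have mK p : measurable_fun setT (K p).
  apply: emeasurable_funM; first exact/measurable_EFinP.
  apply: emeasurable_funM.
    by apply/measurable_EFinP; apply: measurable_field.
  apply: measurableT_comp => //; apply: measurable_fun_pair => //.
  by apply: measurable_fun_pair => //; exact: measurable_th.
have m0 := mF _ measurable_unmoved.
have m1 := mF _ measurable_moved.
have p0 (phi : Omega * (V * V) -> (S * V) * V) q :
    0 <= (field (Y q.1) (q.2.2 - q.2.1))%:E * g (phi q).
  by rewrite mule_ge0// lee_fin field_ge0.
rewrite [LHS](fubini_tonelli _ m1 (p0 moved)).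
rewrite [RHS](fubini_tonelli _ m0 (p0 unmoved)).
transitivity (\int[lam2]_p H (p.2, p.1)); last first.
  apply: ge0_integral_lam2_swap.
    exact: (measurable_fun_fubini_tonelli_G _ m0 (p0 _)).
  by move=> p; apply: integral_ge0 => w _; exact: (p0 unmoved (w, p)).
apply: eq_integral => p _.
transitivity (palm (K p)); first by rewrite /K palm_zeta.
rewrite -(stat (p.1 - p.2)%R)//; last first.
  by move=> y; rewrite !mule_ge0 ?lee_fin ?field_ge0.
apply: eq_integral => w _; rewrite /K /=.
rewrite field_th addrA subrK subrr field0 thD addrA subrK subrr th0.
rewrite muleCA [X in _ * X]muleA -EFinM mulVf ?gt_eqF ?zeta_gt0// mul1e.
by rewrite /field.
Qed.

Implicit Types (C : set V) (w : Omega) (t u : V) (y : S).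

Hypothesis locally_integrable_field : forall w (B : set V), measurable B ->
  bounded_set B -> \int[lam]_(x in B) (field (Y w) x)%:E < +oo.

Definition window_mass (C : set V) (y : S) (u : V) : \bar R :=
  \int[lam]_x (\1_C x * field y (x - u))%:E.

Lemma window_mass_th C t y u : window_mass C (th t y) u = window_mass C y (u - t).
Proof. by apply: eq_integral => x _; rewrite field_th opprB addrA addrAC. Qed.

Lemma window_mass_ge0 C y u : 0 <= window_mass C y u.
Proof. by apply: integral_ge0 => x _; rewrite lee_fin mulr_ge0// field_ge0. Qed.

Lemma measurable_window_mass C : measurable C ->
  measurable_fun setT (fun q : S * V => window_mass C q.1 q.2).
Proof.
move=> mC; apply: (measurable_fun_fubini_tonelli_F
    (fun r : (S * V) * V => (\1_C r.2 * field r.1.1 (r.2 - r.1.2))%:E)).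
  apply/measurable_EFinP; apply: measurable_funM.
    by apply: measurableT_comp measurable_snd; exact: measurable_indic.
  apply: measurable_field; last exact: measurableT_comp.
  by apply: measurable_rVB => //; exact: measurableT_comp.
by move=> r; rewrite lee_fin mulr_ge0// field_ge0.
Qed.

Lemma window_massE C w u : measurable C ->
  window_mass C (Y w) u = \int[lam]_x (\1_C (x + u)%R * field (Y w) x)%:E.
Proof.
move=> mC; rewrite -(@ge0_integral_lebesgue_rV_translation _ _ (- u)%R
  (fun x => (\1_C (x + u)%R * field (Y w) x)%:E)).
- by apply: eq_integral => x _; rewrite subrK.
- apply/measurable_EFinP; apply: measurable_funM; last exact: measurable_field.
  apply: measurableT_comp (measurable_mxD u); exact: measurable_indic.
- by move=> x; rewrite lee_fin mulr_ge0// field_ge0.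
Qed.

Let integral_in_indic (w : Omega) (B : set V) : measurable B ->
  \int[lam]_(x in B) (field (Y w) x)%:E = \int[lam]_x (\1_B x * field (Y w) x)%:E.
Proof.
move=> mB; rewrite integral_mkcond; apply: eq_integral => x _.
by rewrite patchE indicE; case: ifPn; rewrite ?mul1r ?mul0r.
Qed.

Lemma window_mass_bound C w : measurable C -> bounded_set C ->
  exists r : R, forall u, C u -> window_mass C (Y w) u <= r%:E.
Proof.
move=> mC [N [Nr bN]]; pose D := ball (0%R : V) (2 * (`|N| + 2))%R.
have mD : measurable D by exact: measurable_ball_rV.
have DC x u : C u -> C (x + u)%R -> D x.
  move=> Cu Cxu; rewrite /D mx_norm_ball /ball_/= sub0r normrN.
  have lt1 : (N < `|N| + 1)%R by rewrite ltr_pwDr// ler_norm.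
  have := bN _ lt1 _ Cu; have := bN _ lt1 _ Cxu => /= h1 h2.
  have := ler_normB (x + u)%R u; rewrite addrK => h3; lra.
exists (fine (\int[lam]_(x in D) (field (Y w) x)%:E)) => u Cu.
have I0 : 0 <= \int[lam]_(x in D) (field (Y w) x)%:E.
  by apply: integral_ge0 => x _; rewrite lee_fin field_ge0.
rewrite fineK; last first.
  rewrite ge0_fin_numE//.
  by apply: locally_integrable_field => //; exact: bounded_ball.
rewrite window_massE// integral_in_indic//; apply: ge0_le_integral => //.
- by move=> x _; rewrite lee_fin mulr_ge0// field_ge0.
- apply/measurable_EFinP; apply: measurable_funM; last exact: measurable_field.
  apply: measurableT_comp (measurable_mxD u); exact: measurable_indic.
- apply/measurable_EFinP; apply: measurable_funM; last exact: measurable_field.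
  exact: measurable_indic.
move=> x _; rewrite lee_fin ler_wpM2r ?field_ge0// !indicE.
have [xuC|//] := boolP ((x + u)%R \in C).
by rewrite mem_set//; apply: DC Cu _; exact: set_mem.
Qed.

Lemma window_mass_gt0 C w u : measurable C -> 0 < lam C ->
  0 < window_mass C (Y w) u.
Proof.
move=> mC C0; rewrite lt0e window_mass_ge0 andbT; apply/eqP => m0.
have mf : measurable_fun setT (fun x => (\1_C x * field (Y w) (x - u))%:E).
  apply/measurable_EFinP; apply: measurable_funM; first exact: measurable_indic.
  by apply: measurable_field => //; exact: measurable_mxD.
have : \int[lam]_x `|(\1_C x * field (Y w) (x - u))%:E| = 0.
  rewrite -m0; apply: eq_integral => x _; rewrite gee0_abs//.
  by rewrite lee_fin mulr_ge0// field_ge0.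
move=> /(ae_eq_integral_abs lam measurableT mf)[N [mN N0 sub]].
suff : lam C = 0 by move=> C00; rewrite C00 ltxx in C0.
apply: (subset_measure0 mC mN _ N0) => x Cx; apply: sub => /= /(_ I).
rewrite indicE mem_set// mul1r => -[] /eqP.
by rewrite gt_eqF// zetaY_gt0.
Qed.

Definition window_weight (C : set V) (q : (S * V) * V) : R :=
  \1_C q.1.2 * \1_C q.2 * (fine (window_mass C q.1.1 q.1.2))^-1.

Definition window_mecke (C : set V) := forall f : S * V -> \bar R,
  measurable_fun setT f -> (forall q, 0 <= f q) ->
  \int[moved_measure]_q ((window_weight C q)%:E * f q.1) =
  \int[unmoved_measure]_q ((window_weight C q)%:E * f q.1).

Lemma window_weight_ge0 C q : (0 <= window_weight C q)%R.
Proof.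
by rewrite mulr_ge0// ?mulr_ge0// invr_ge0 fine_ge0// window_mass_ge0.
Qed.

Lemma measurable_window_weight C : measurable C -> measurable_fun setT (window_weight C).
Proof.
move=> mC; apply: measurable_funM.
  have m1 : measurable_fun setT (\1_C : V -> R) by exact: measurable_indic.
  apply: measurable_funM; last exact: measurableT_comp m1 measurable_snd.
  exact: measurableT_comp m1 (measurableT_comp measurable_snd measurable_fst).
apply: measurable_invr; apply: measurableT_comp; first exact: fine_measurable.
exact: measurableT_comp (measurable_window_mass mC) measurable_fst.
Qed.

Lemma stationary_window_mecke C : stationary -> measurable C -> window_mecke C.
Proof.
move=> stat mC f mf f0; apply: stationary_mecke => //.
  apply: emeasurable_funM; last exact: measurableT_comp mf _.
  by apply/measurable_EFinP; exact: measurable_window_weight.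
by move=> q; rewrite mule_ge0// lee_fin window_weight_ge0.
Qed.

Lemma window_mecke_measure C (G : set (S * V)) : measurable C -> bounded_set C ->
  0 < lam C -> window_mecke C -> measurable G ->
  moved_measure [set q | G q.1 /\ C q.1.2 /\ C q.2] =
  unmoved_measure [set q | G q.1 /\ C q.1.2 /\ C q.2].
Proof.
move=> mC bC C0 mecke mG.
pose E : set ((S * V) * V) := [set q | G q.1 /\ C q.1.2 /\ C q.2].
have mE : measurable E.
  apply: measurableI; first exact: (measurable_preimage measurable_fst mG).
  apply: measurableI; last exact: (measurable_preimage measurable_snd mC).
  exact: (measurable_preimage (measurableT_comp measurable_snd measurable_fst) mC).
pose f (r : S * V) : \bar R := (\1_G r * fine (window_mass C r.1 r.2))%:E.
have f0 r : 0 <= f r by rewrite lee_fin mulr_ge0// fine_ge0// window_mass_ge0.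
have mf : measurable_fun setT f.
  apply/measurable_EFinP; apply: measurable_funM; first exact: measurable_indic.
  apply: measurableT_comp; first exact: fine_measurable.
  exact: measurable_window_mass.
have m1 : measurable_fun setT (fun q : (S * V) * V => (\1_E q : R)%:E).
  by apply/measurable_EFinP; exact: measurable_indic.
have m2 : measurable_fun setT (fun q : (S * V) * V => (window_weight C q)%:E * f q.1).
  apply: emeasurable_funM; last exact: measurableT_comp mf _.
  by apply/measurable_EFinP; exact: measurable_window_weight.
have i0 (q : (S * V) * V) : 0 <= (\1_E q : R)%:E by rewrite lee_fin.
have w0 q : 0 <= (window_weight C q)%:E * f q.1.
  by rewrite mule_ge0// lee_fin window_weight_ge0.
have indicE' (q : (S * V) * V) : (C q.1.2 -> C q.2 ->
    0 < window_mass C q.1.1 q.1.2 < +oo) ->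
    (\1_E q : R)%:E = (window_weight C q)%:E * f q.1.
  move=> m0; rewrite -EFinM /window_weight; congr EFin.
  have [Cq|Cq] := pselect (C q.1.2); last first.
    rewrite !indicE (memNset (A := C) Cq) !mul0r memNset//.
    by move=> [_ []].
  have [Cq'|Cq'] := pselect (C q.2); last first.
    rewrite !indicE (memNset (A := C) Cq') mulr0 !mul0r memNset//.
    by move=> [_ []].
  have /gt_eqF/negbT fm0 : (0 < fine (window_mass C q.1.1 q.1.2))%R.
    by rewrite fine_gt0// m0.
  transitivity (\1_C q.1.2 * \1_C q.2 * \1_G q.1 : R)%R; last by field.
  rewrite !indicE -!natrM !mulnb; congr ((nat_of_bool _)%:R).
  apply/idP/idP => [/set_mem[? [? ?]]|/andP[/andP[]]]; first by rewrite !mem_set.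
  by move=> /set_mem ? /set_mem ? /set_mem ?; exact: mem_set.
have mass w u : C u -> 0 < window_mass C (Y w) u < +oo.
  have [r hr] := window_mass_bound w mC bC.
  by move=> Cu; rewrite window_mass_gt0//= (le_lt_trans (hr _ Cu))// ltry.
transitivity (\int[moved_measure]_q (\1_E q : R)%:E).
  by rewrite integral_indic// setIT.
transitivity (\int[unmoved_measure]_q (\1_E q : R)%:E); last first.
  by rewrite integral_indic// setIT.
rewrite (integral_moved m1 i0) (integral_unmoved m1 i0).
transitivity (\int[moved_measure]_q ((window_weight C q)%:E * f q.1)).
  rewrite (integral_moved m2 w0); apply: eq_integral => w _.
  apply: eq_integral => p _; rewrite indicE'//= => _ Cp.
  by rewrite window_mass_th opprB addrCA subrr addr0; exact: mass.
rewrite mecke// (integral_unmoved m2 w0); apply: eq_integral => w _.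
by apply: eq_integral => p _; rewrite indicE'//= => Cp _; exact: mass.
Qed.

Lemma measurable_pair_rect (G : set (S * V)) (A B : set V) : measurable G ->
  measurable A -> measurable B ->
  measurable [set q : (S * V) * V | G q.1 /\ A q.1.2 /\ B q.2].
Proof.
move=> mG mA mB.
apply: measurableI; first exact: (measurable_preimage measurable_fst mG).
apply: measurableI; last exact: (measurable_preimage measurable_snd mB).
exact: (measurable_preimage (measurableT_comp measurable_snd measurable_fst) mA).
Qed.

Section window_mecke_stationary.
Variable F : nat -> set S.
Hypotheses (mF : forall k, measurable (F k)) (ndF : nondecreasing_seq F)
  (FT : \bigcup_k F k = setT) (finF : forall k, P (Y @^-1` F k) < +oo).

(* The truncation [J <= k] is only relevant on the range of Y, where J < +oo; the
   alternative [J = +oo] makes the sets E k cover the whole space. *)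
Lemma finite_exhaustion C : measurable C -> bounded_set C ->
  exists E : nat -> set S, [/\ forall k, measurable (E k), nondecreasing_seq E,
    \bigcup_k E k = setT &
    forall k, unmoved_measure [set q | E k q.1.1 /\ C q.1.2 /\ C q.2] < +oo].
Proof.
move=> mC bC.
pose h (y : S) (p : V * V) : R := (\1_C p.1 * (\1_C p.2 * field y (p.2 - p.1)))%R.
have h0 y p : (0 <= h y p)%R by rewrite !mulr_ge0// field_ge0.
have m1 : measurable_fun setT (\1_C : V -> R) by exact: measurable_indic.
have mh : measurable_fun setT (fun r : S * (V * V) => (h r.1 r.2)%:E).
  apply/measurable_EFinP; apply: measurable_funM.
    exact: measurableT_comp m1 (measurableT_comp measurable_fst measurable_snd).
  apply: measurable_funM.
    exact: measurableT_comp m1 (measurableT_comp measurable_snd measurable_snd).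
  by apply: measurable_field; first exact: measurable_pair_diff.
have mhy y : measurable_fun setT (fun p => (h y p)%:E).
  exact: measurableT_comp mh (measurable_fun_pair (measurable_cst y) (@measurable_id _ _ setT)).
pose J (y : S) := \int[lam2]_p (h y p)%:E.
have mJ : measurable_fun setT J.
  by apply: (measurable_fun_fubini_tonelli_F _ mh) => r; rewrite lee_fin.
have J0 y : 0 <= J y by apply: integral_ge0 => p _; rewrite lee_fin.
have Jfin w : J (Y w) < +oo.
  have [r hr] := window_mass_bound w mC bC.
  have hy0 p : 0 <= (h (Y w) p)%:E by rewrite lee_fin.
  rewrite /J [X in X < _](fubini_tonelli1 _ (mhy (Y w)) hy0) /fubini_F/=.
  apply: (@le_lt_trans _ _ (\int[lam]_u ((Num.max r 0)%:E * (\1_C u)%:E))).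
    apply: ge0_le_integral => //.
    - by move=> u _; apply: integral_ge0 => x _; rewrite lee_fin.
    - exact: (measurable_fun_fubini_tonelli_F _ (mhy (Y w)) hy0).
    - by apply: emeasurable_funM => //; apply/measurable_EFinP.
    move=> u _; have [Cu|Cu] := pselect (C u).
      rewrite /h/= indicE mem_set// mule1.
      under eq_integral do rewrite mul1r.
      by rewrite (le_trans (hr _ Cu))// lee_fin le_max lexx.
    rewrite /h/= indicE memNset// mule0.
    by under eq_integral do rewrite mul0r; rewrite integral0.
  rewrite ge0_integralZl//; last 2 first.
  - exact/measurable_EFinP.
  - by rewrite lee_fin le_max lexx orbT.
  rewrite integral_indic// setIT; apply: lte_mul_pinfty => //.
    by rewrite lee_fin le_max lexx orbT.
  exact: lebesgue_rV_bounded.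
pose E k := F k `&` ([set y | J y <= k%:R%:E] `|` [set y | J y = +oo]).
have mJk k : measurable [set y | J y <= k%:R%:E].
  by rewrite -[X in measurable X]setTI; exact: emeasurable_fun_infty_c.
have mE k : measurable (E k).
  apply: measurableI => //; apply: measurableU => //.
  by rewrite -[X in measurable X]setTI; exact: emeasurable_fun_eq.
exists E; split => //.
- move=> i j ij; apply/subsetPset; apply: setISS; first exact/subsetPset/ndF.
  apply: setSU => y /= /le_trans; apply; by rewrite lee_fin ler_nat.
- apply/seteqP; split => // y _; have [i _ Fy] : (\bigcup_k F k) y by rewrite FT.
  have [Jy|Jy] := ltP (J y) +oo; last first.
    by exists i => //; split => //; right; apply/eqP; rewrite -leye_eq.
  pose j := Num.bound (fine (J y)).
  exists (maxn i j) => //; split.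
    by have /subsetPset := ndF (leq_maxl i j); exact.
  left => /=; rewrite -[J y]fineK ?ge0_fin_numE// lee_fin.
  apply: (@le_trans _ _ j%:R); last by rewrite ler_nat leq_maxr.
  by apply/ltW/archi_boundP; rewrite fine_ge0.
move=> k; set D := [set q | _].
have mD : measurable D.
  apply: (@measurable_pair_rect [set r | E k r.1]) => //.
  exact: (measurable_preimage measurable_fst (mE k)).
have mi : measurable_fun setT (fun q : (S * V) * V => (\1_D q : R)%:E).
  by apply/measurable_EFinP; exact: measurable_indic.
have -> : unmoved_measure D = \int[unmoved_measure]_q (\1_D q : R)%:E.
  by rewrite integral_indic// setIT.
rewrite (integral_unmoved mi); last by move=> q; rewrite lee_fin.
apply: (@le_lt_trans _ _ (\int[P]_w (k%:R%:E * (\1_(Y @^-1` F k) w)%:E))).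
  apply: ge0_le_integral => //.
  - move=> w _; apply: integral_ge0 => p _.
    by rewrite mule_ge0// lee_fin// field_ge0.
  - apply: (measurable_fun_fubini_tonelli_F (fun r : Omega * (V * V) =>
      (field (Y r.1) (r.2.2 - r.2.1))%:E * (\1_D ((Y r.1, r.2.1), r.2.2))%:E)).
      apply: emeasurable_funM.
        by apply/measurable_EFinP; exact: measurable_pair_density.
      exact: measurableT_comp mi measurable_unmoved.
    by move=> r; rewrite mule_ge0// lee_fin// field_ge0.
  - apply: emeasurable_funM => //; apply/measurable_EFinP.
    by apply: measurable_indic; exact: measurable_preimage.
  move=> w _; have [Ew|Ew] := pselect (E k (Y w)); last first.
    rewrite integral0_eq ?mule_ge0 ?lee_fin// => p _.
    by rewrite indicE memNset ?mule0// => -[].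
  rewrite indicE mem_set ?mule1; last by case: Ew.
  apply: (@le_trans _ _ (J (Y w))); last first.
    by case: Ew => _ [//|/= Jw]; have := Jfin w; rewrite Jw.
  rewrite le_eqVlt; apply/orP; left; apply/eqP; apply: eq_integral => p _.
  rewrite -EFinM /h mulrA; congr EFin; rewrite [RHS]mulrC; congr (_ * _)%R.
  rewrite !indicE -natrM mulnb; congr ((nat_of_bool _)%:R).
  apply/idP/andP => [/set_mem[_ [? ?]]|[/set_mem ? /set_mem ?]].
    by split; exact: mem_set.
  exact: mem_set.
rewrite ge0_integralZl//; last first.
  apply/measurable_EFinP; apply: measurable_indic; exact: measurable_preimage.
rewrite integral_indic ?setIT//; last exact: measurable_preimage.
apply: lte_mul_pinfty => //; exact: finF.
Qed.

Lemma window_mecke_disjoint A B0 : bounded_set A -> bounded_set B0 ->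
  jordan A -> jordan B0 -> A `&` B0 = set0 -> 0 < lam A ->
  (forall C, bounded_set C -> jordan C -> 0 < lam C -> window_mecke C) ->
  forall D : set ((S * V) * V), measurable D ->
  moved_measure (D `&` [set q | A q.1.2 /\ B0 q.2]) =
  unmoved_measure (D `&` [set q | A q.1.2 /\ B0 q.2]).
Proof.
move=> bA bB jA jB AB A0 mecke D mD.
pose C0 := A `|` B0.
have jC0 : jordan C0 by exact: jordanU.
have [E [mE ndE ET finE]] := finite_exhaustion jC0.1 (bounded_setU bA bB).
set R0 := [set q | _].
have mR0 : measurable R0.
  rewrite (_ : R0 = [set q | setT q.1 /\ A q.1.2 /\ B0 q.2]).
    exact: (@measurable_pair_rect setT _ _ measurableT jA.1 jB.1).
  by apply/seteqP; split => [q [Aq Bq]|q [_ [Aq Bq]]].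
pose m1 : {measure set ((S * V) * V)%type -> \bar R} := mrestr moved_measure mR0.
pose m2 : {measure set ((S * V) * V)%type -> \bar R} := mrestr unmoved_measure mR0.
rewrite -[LHS]/(m1 D) -[RHS]/(m2 D).
have mE1 k : measurable [set r : S * V | E k r.1].
  exact: (measurable_preimage measurable_fst (mE k)).
have jordan_eq k (G : set (S * V)) B : measurable G -> jordan B ->
    m1 ((G `&` [set r | E k r.1]) `*` B) = m2 ((G `&` [set r | E k r.1]) `*` B).
  move=> mG jB'; pose B' := B `&` B0.
  have jB'' : jordan B' by exact: jordanI.
  pose G' := (G `&` [set r | E k r.1]) `&` [set r | A r.2].
  have mG' : measurable G'.
    apply: measurableI; first exact: measurableI.
    exact: (measurable_preimage measurable_snd jA.1).
  have AB' : A `&` B' = set0 by rewrite /B' setICA AB setI0.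
  pose C := A `|` B'.
  have jC : jordan C by exact: jordanU.
  have bB' : bounded_set B'.
    by have [M [Mr bM]] := bB; exists M; split => // x Mx v [_ /(bM _ Mx)].
  have bC : bounded_set C by exact: bounded_setU.
  have C0' : 0 < lam C.
    apply: (lt_le_trans A0); apply: le_measure; rewrite ?inE.
    - exact: jA.1.
    - exact: jC.1.
    - exact: subsetUl.
  have eC := window_mecke_measure jC.1 bC C0' (mecke _ bC jC C0') mG'.
  pose DA := [set q : (S * V) * V | G' q.1 /\ A q.1.2 /\ A q.2].
  pose DB := [set q : (S * V) * V | G' q.1 /\ A q.1.2 /\ B' q.2].
  have eA : moved_measure DA = unmoved_measure DA.
    exact: window_mecke_measure jA.1 bA A0 (mecke _ bA jA A0) mG'.
  have mDA : measurable DA by exact: measurable_pair_rect mG' jA.1 jA.1.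
  have mDB : measurable DB by exact: measurable_pair_rect mG' jA.1 jB''.1.
  have DC : [set q | G' q.1 /\ C q.1.2 /\ C q.2] = DA `|` DB.
    apply/seteqP; split => [q [Gq [_ [Aq|Bq]]]|q [] [Gq [Aq Bq]]].
    - by left; split => //; split => //; exact: Gq.2.
    - by right; split => //; split => //; exact: Gq.2.
    - by split => //; split; left.
    - by split => //; split; [left|right].
  have dis : DA `&` DB = set0.
    apply/seteqP; split => // q [[_ [_ Aq]] [_ [_ Bq]]].
    by have : (A `&` B') q.2 by []; rewrite AB'.
  have -> : m1 ((G `&` [set r | E k r.1]) `*` B) = moved_measure DB.
    congr (moved_measure _); apply/seteqP; split => [[r b]/= [[[? ?] ?] [? ?]]|[r b]/= [[[? ?] ?] [? [? ?]]]].
      by [].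
    by [].
  have -> : m2 ((G `&` [set r | E k r.1]) `*` B) = unmoved_measure DB.
    congr (unmoved_measure _); apply/seteqP; split => [[r b]/= [[[? ?] ?] [? ?]]|[r b]/= [[[? ?] ?] [? [? ?]]]].
      by [].
    by [].
  have finA : unmoved_measure DA \is a fin_num.
    rewrite ge0_fin_numE//; apply: le_lt_trans (finE k); apply: le_measure; rewrite ?inE.
    - exact: mDA.
    - exact: (measurable_pair_rect (mE1 k) jC0.1 jC0.1).
    - by move=> q [[[_ Eq] _] [Aq Aq']]; split => //; split; left.
  rewrite -[LHS](addeK _ finA) -[RHS](addeK _ finA).
  congr (_ - _); rewrite addeC [RHS]addeC.
  transitivity (moved_measure DA + moved_measure DB); first by congr (_ + _).
  transitivity (moved_measure (DA `|` DB)); first exact/esym/measureU.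
  by rewrite -DC eC DC; exact: measureU.
apply: (@prod_measure_eq _ _ _ _ _ m1 m2 (fun k => [set r | E k r.1])) => //.
- by move=> i j ij; apply/subsetPset => r /=; have /subsetPset := ndE _ _ ij; exact.
- apply/seteqP; split => // r _; have [k _ Ek] : (\bigcup_k E k) r.1 by rewrite ET.
  by exists k.
- move=> k; rewrite -[X in X `*` _]setTI jordan_eq//; last exact: jordanT.
  apply: le_lt_trans (finE k); apply: (@le_measure _ _ _ unmoved_measure).
  - apply/mem_set; apply: measurableI => //; apply: measurableX => //.
    exact: measurableI.
  - by apply/mem_set; exact: (measurable_pair_rect (mE1 k) jC0.1 jC0.1).
  - by move=> [r b] [[[_ Er] _] [Ar Br]]; split => //; split; [left|right].
move=> k G B mG mB.
pose GE := G `&` [set r | E k r.1].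
have mGE : measurable GE by exact: measurableI.
have mpair : measurable_fun setT (fun q : (S * V) * V => q.2) by exact: measurable_snd.
pose n1 := image_measure (mrestr m1 (measurable_preimage measurable_fst mGE)) mpair.
pose n2 := image_measure (mrestr m2 (measurable_preimage measurable_fst mGE)) mpair.
have n1E C : n1 C = m1 (GE `*` C).
  by congr (m1 _); apply/seteqP; split => [[r b]/= []|[r b]/= []].
have n2E C : n2 C = m2 (GE `*` C).
  by congr (m2 _); apply/seteqP; split => [[r b]/= []|[r b]/= []].
rewrite -/GE -n1E -n2E.
apply: (measure_unique (@jordan R n) (fun=> setT)) => //.
- exact: measurable_jordan.
- exact: jordanI.
- by move=> _; exact: jordanT.
- by apply/seteqP; split => // x _; exists 0%N.
- by move=> C jC; rewrite n1E n2E; exact: jordan_eq.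
- move=> _; rewrite n1E jordan_eq//; last exact: jordanT.
  apply: le_lt_trans (finE k); apply: (@le_measure _ _ _ unmoved_measure).
  - by apply/mem_set; apply: measurableI => //; exact: measurableX.
  - by apply/mem_set; exact: (measurable_pair_rect (mE1 k) jC0.1 jC0.1).
  - by move=> [r b] [[[_ Er] _] [Ar Br]]; split => //; split; [left|right].
Qed.

Lemma palm_average A B0 (k : S -> \bar R) : bounded_set A -> bounded_set B0 ->
  jordan A -> jordan B0 -> A `&` B0 = set0 -> 0 < lam A ->
  (forall C, bounded_set C -> jordan C -> 0 < lam C -> window_mecke C) ->
  measurable_fun setT k -> (forall y, 0 <= k y) ->
  \int[lam2]_p ((\1_A p.2 * \1_B0 p.1)%:E * palm (k \o th (p.2 - p.1)%R)) =
  lam A * lam B0 * palm k.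
Proof.
move=> bA bB jA jB AB A0 mecke mk k0.
pose g (q : (S * V) * V) : \bar R :=
  (\1_A q.1.2 * \1_B0 q.2 * ((zeta q.1.1)^-1 * (field q.1.1 (q.2 - q.1.2))^-1))%:E * k q.1.1.
have m1A : measurable_fun setT (\1_A : V -> R) by apply: measurable_indic; exact: jA.1.
have m1B : measurable_fun setT (\1_B0 : V -> R) by apply: measurable_indic; exact: jB.1.
have mq1 : measurable_fun setT (fun q : (S * V) * V => q.1.1) by exact: measurableT_comp.
have mq2 : measurable_fun setT (fun q : (S * V) * V => q.1.2) by exact: measurableT_comp.
have mg : measurable_fun setT g.
  apply: emeasurable_funM; last exact: measurableT_comp mk mq1.
  apply/measurable_EFinP; apply: measurable_funM; first apply: measurable_funM.
  - exact: measurableT_comp m1A mq2.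
  - exact: measurableT_comp m1B measurable_snd.
  apply: measurable_funM; apply: measurable_invr.
    exact: measurableT_comp mzeta mq1.
  by apply: measurable_field => //; exact: measurable_rVB.
have g0 q : 0 <= g q.
  by rewrite mule_ge0// lee_fin !mulr_ge0// invr_ge0// field_ge0.
have eqg : \int[moved_measure]_q g q = \int[unmoved_measure]_q g q.
  pose R0 := [set q : (S * V) * V | A q.1.2 /\ B0 q.2].
  have patch_g : g = g \_ R0.
    apply/funext => q; rewrite patchE; case: ifPn => // /negP qR.
    rewrite /g !indicE; have [Aq|_] := boolP (q.1.2 \in A); last first.
      by rewrite !mul0r mul0e.
    have [Bq|_] := boolP (q.2 \in B0); last first.
      by rewrite mulr0 mul0r mul0e.
    by exfalso; apply: qR; apply/mem_set; split; exact: set_mem.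
  rewrite patch_g -!integral_mkcond; apply: eq_measure_integral => D mD DR0.
  have := window_mecke_disjoint bA bB jA jB AB A0 mecke mD.
  by rewrite -/R0 (setIidl DR0).
have mpalm : measurable_fun setT (fun p : V * V => palm (k \o th (p.2 - p.1)%R)).
  apply: (measurable_fun_fubini_tonelli_G (fun r : Omega * (V * V) =>
      ((zeta (Y r.1))^-1)%:E * k (th (r.2.2 - r.2.1)%R (Y r.1)))).
    apply: emeasurable_funM.
      apply/measurable_EFinP; apply: measurable_invr.
      by apply: measurableT_comp => //; exact: measurableT_comp.
    apply: measurableT_comp => //; apply: measurable_th.
      exact: measurable_pair_diff.
    exact: measurableT_comp.
  by move=> r; rewrite mule_ge0// lee_fin invr_ge0.
have palm0 k' : (forall y, 0 <= k' y) -> 0 <= palm k'.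
  by move=> k'0; apply: integral_ge0 => w _; rewrite mule_ge0// lee_fin invr_ge0.
pose W (r : Omega * (V * V)) : \bar R := (\1_A r.2.2 * \1_B0 r.2.1 : R)%:E *
  (((zeta (Y r.1))^-1)%:E * k (th (r.2.2 - r.2.1)%R (Y r.1))).
have mW1 : measurable_fun setT (fun p : V * V => (\1_A p.2 * \1_B0 p.1 : R)%R).
  apply: measurable_funM; first exact: measurableT_comp m1A measurable_snd.
  exact: measurableT_comp m1B measurable_fst.
have mW : measurable_fun setT W.
  apply: emeasurable_funM.
    apply/measurable_EFinP; exact: measurableT_comp mW1 measurable_snd.
  apply: emeasurable_funM.
    apply/measurable_EFinP; apply: measurable_invr.
    by apply: measurableT_comp => //; exact: measurableT_comp.
  apply: measurableT_comp => //; apply: measurable_th.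
    exact: measurable_pair_diff.
  exact: measurableT_comp.
have W0 r : 0 <= W r by rewrite !mule_ge0// lee_fin ?mulr_ge0// invr_ge0.
transitivity (\int[moved_measure]_q g q).
  transitivity (\int[P]_w \int[lam2]_p W (w, p)).
    rewrite [RHS](fubini_tonelli _ mW W0); apply: eq_integral => p _.
    rewrite -ge0_integralZl//.
    - apply: emeasurable_funM.
        by apply/measurable_EFinP; apply: measurable_invr; exact: measurableT_comp.
      exact: (measurableT_comp mk (measurable_th (measurable_cst _) mY)).
    - by move=> w _; apply: mule_ge0; rewrite ?lee_fin ?invr_ge0//; exact: k0.
  rewrite (integral_moved mg g0); apply: eq_integral => w _.
  apply: eq_integral => p _; rewrite /W /g /=.
  rewrite field_th addrA subrK subrr field0 [zeta (th _ _)]/(field _ _).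
  rewrite !muleA -!EFinM; congr (_%:E * _).
  have := zetaY_gt0 w (p.2 - p.1)%R; rewrite -/(field _ _) => /gt_eqF/negbT f1.
  have /gt_eqF/negbT f2 := zeta_gt0 w.
  by field; rewrite f1 f2.
rewrite eqg (integral_unmoved mg g0).
pose W' (r : Omega * (V * V)) := (\1_A r.2.1 * \1_B0 r.2.2)%:E *
  (((zeta (Y r.1))^-1)%:E * k (Y r.1)).
transitivity (\int[P]_w (lam A * lam B0 * (((zeta (Y w))^-1)%:E * k (Y w)))).
  apply: eq_integral => w _.
  have c0 : 0 <= ((zeta (Y w))^-1)%:E * k (Y w) by rewrite mule_ge0// lee_fin invr_ge0.
  transitivity (\int[lam2]_p ((\1_A p.1 * \1_B0 p.2)%:E * (((zeta (Y w))^-1)%:E * k (Y w)))).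
    apply: eq_integral => p _; rewrite /g /=.
    rewrite !muleA -!EFinM; congr (_%:E * _).
    have := zetaY_gt0 w (p.2 - p.1)%R; rewrite -/(field _ _) => /gt_eqF/negbT f1.
    have /gt_eqF/negbT f2 := zeta_gt0 w.
    by field; rewrite f1 f2.
  have m2 : measurable_fun setT (fun p : V * V => (\1_A p.1 * \1_B0 p.2 : R)%:E).
    apply/measurable_EFinP; apply: measurable_funM.
      exact: measurableT_comp m1A measurable_fst.
    exact: measurableT_comp m1B measurable_snd.
  rewrite ge0_integralZr//; congr (_ * _).
  rewrite [LHS](fubini_tonelli1 _ m2) => [|p]; last by rewrite lee_fin.
  rewrite /fubini_F/=.
  have i1 (C : set V) : measurable C -> \int[lam]_x (\1_C x)%:E = lam C.
    by move=> mC; rewrite integral_indic// setIT.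
  have mE (C : set V) : measurable C -> measurable_fun setT (fun x => (\1_C x : R)%:E).
    by move=> mC; apply/measurable_EFinP; exact: measurable_indic.
  transitivity (\int[lam]_x ((\1_A x)%:E * lam B0)).
    apply: eq_integral => x _; under eq_integral do rewrite EFinM.
    by rewrite ge0_integralZl ?i1 ?lee_fin//; [exact: jB.1|apply: mE; exact: jB.1].
  by rewrite ge0_integralZr ?i1//; [exact: jA.1|apply: mE; exact: jA.1].
rewrite ge0_integralZl//.
- apply: emeasurable_funM.
    by apply/measurable_EFinP; apply: measurable_invr; exact: measurableT_comp.
  exact: measurableT_comp.
- by move=> w _; rewrite mule_ge0// lee_fin invr_ge0.
- by rewrite mule_ge0.
Qed.

Lemma window_mecke_implies_stationary : (0 < n)%N ->
  (forall C, bounded_set C -> jordan C -> 0 < lam C -> window_mecke C) ->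
  stationary.
Proof.
move=> n0 mecke t k mk k0.
pose i0 : 'I_n := Ordinal n0.
pose b : V := const_mx (`|t| + 3)%R.
have bi : b ord0 i0 = (`|t| + 3)%R by rewrite mxE.
have coord_le (v : V) : (`|v ord0 i0| <= `|v|)%R.
  by rewrite -[leRHS]/(mx_norm v) mx_normrE (le_bigmax _ (fun ij => `|v ij.1 ij.2|%R) (ord0, i0)).
have far (c : V) : (`|c| <= `|t|)%R -> ball c 1%R `&` ball b 1%R = set0.
  move=> ct; apply/seteqP; split => // v [[_ /(_ ord0 i0)] + [_ /(_ ord0 i0)]].
  rewrite /ball/= bi !ltr_norml; have := coord_le c.
  by rewrite ler_norml => /andP[h1 h2] /andP[h3 h4] /andP[h5 h6]; lra.
have B1 (c : V) : 0 < lam (ball c 1%R).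
  by rewrite [X in _ < X]lebesgue_rV_ball// lte_fin exprn_gt0.
have jB (c : V) : jordan (ball c 1%R) by exact: jordan_ball.
have bB (c : V) : bounded_set (ball c 1%R) by exact: bounded_ball.
have t0 : (`|0 : V| <= `|t|)%R by rewrite normr0.
have kt0 y : 0 <= (k \o th t) y by exact: k0.
have mkt : measurable_fun setT (k \o th t).
  by apply: measurableT_comp => //; exact: measurable_th.
have := palm_average (bB 0%R) (bB b) (jB 0%R) (jB b) (far 0%R t0) (B1 0%R) mecke mkt kt0.
have := palm_average (bB t) (bB b) (jB t) (jB b) (far t (lexx _)) (B1 t) mecke mk k0.
pose G (p : V * V) : \bar R :=
  (\1_(ball t 1%R) p.2 * \1_(ball b 1%R) p.1 : R)%:E * palm (k \o th (p.2 - p.1)%R).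
have G0 p : 0 <= G p.
  rewrite mule_ge0 ?lee_fin//; apply: integral_ge0 => w _.
  by rewrite mule_ge0 ?lee_fin ?invr_ge0//; exact: k0.
have mG : measurable_fun setT G.
  apply: emeasurable_funM.
    apply/measurable_EFinP; apply: measurable_funM.
      apply: measurableT_comp measurable_snd; apply: measurable_indic.
      exact: measurable_ball_rV.
    apply: measurableT_comp measurable_fst; apply: measurable_indic.
    exact: measurable_ball_rV.
  apply: (measurable_fun_fubini_tonelli_G (fun r : Omega * (V * V) =>
      ((zeta (Y r.1))^-1)%:E * k (th (r.2.2 - r.2.1)%R (Y r.1)))).
    apply: emeasurable_funM.
      apply/measurable_EFinP; apply: measurable_invr.
      by apply: measurableT_comp => //; exact: measurableT_comp.
    apply: measurableT_comp => //; apply: measurable_th.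
      exact: measurable_pair_diff.
    exact: measurableT_comp.
  by move=> r; rewrite mule_ge0// lee_fin invr_ge0.
rewrite -(@ge0_integral_lam2_shear _ _ (fun=> t) G (measurable_cst _) mG G0).
have -> : \int[lam2]_p G (p.1, (p.2 + t)%R) = \int[lam2]_p
    ((\1_(ball (0%R : V) 1%R) p.2 * \1_(ball b 1%R) p.1)%:E * palm ((k \o th t) \o th (p.2 - p.1)%R)).
  apply: eq_integral => p _; rewrite /G/=; congr (_%:E * _).
    congr (_ * _)%R; rewrite !indicE; congr ((nat_of_bool _)%:R).
    apply/idP/idP => /set_mem h; apply/mem_set; move: h;
      by rewrite !mx_norm_ball /ball_/= ?opprD ?addrA ?sub0r [(t - _)%R]addrC ?addrK ?normrN// addrAC subrr sub0r normrN.
  by congr (palm _); apply/funext => y /=; rewrite thD addrA [(t + _)%R]addrC.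
move=> -> /esym.
have -> : lam (ball (0%R : V) 1%R) = lam (ball t 1%R) by rewrite [LHS]lebesgue_rV_ball// [RHS]lebesgue_rV_ball.
set c := lam _ * lam _ => h.
have c0 : c \is a fin_num by rewrite fin_numM// ge0_fin_numE//; exact: lebesgue_rV_bounded (measurable_ball_rV _ _) (bB _).
have c1 : 0 < c by rewrite mule_gt0.
move: h; rewrite -(fineK c0) => h.
have cK x : (fine c)^-1%:E * ((fine c)%:E * x) = x.
  by rewrite muleA -EFinM mulVf ?mul1e// gt_eqF// fine_gt0// c1 -ge0_fin_numE// ltW.
by rewrite -[LHS]cK h cK.
Qed.

End window_mecke_stationary.

Section window_measure.
Variable C : set V.
Hypotheses (mC : measurable C) (bC : bounded_set C) (C0 : 0 < lam C).

Let lamC_fin : lam C \is a fin_num.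
Proof. by rewrite ge0_fin_numE//; exact: lebesgue_rV_bounded. Qed.

Let lamC_gt0 : (0 < fine (lam C))%R.
Proof. by rewrite fine_gt0// C0 -ge0_fin_numE// ltW. Qed.

Let window_massY w u : C u -> 0 < window_mass C (Y w) u < +oo.
Proof.
have [r hr] := window_mass_bound w mC bC.
by move=> Cu; rewrite window_mass_gt0//= (le_lt_trans (hr _ Cu))// ltry.
Qed.

Let window_massYK w u : C u ->
  ((fine (window_mass C (Y w) u))^-1)%:E * window_mass C (Y w) u = 1.
Proof.
move=> Cu; have /andP[m0 moo] := window_massY w Cu.
have mfin : window_mass C (Y w) u \is a fin_num by rewrite ge0_fin_numE// ltW.
by rewrite -[X in _ * X](fineK mfin) -EFinM mulVf// gt_eqF// fine_gt0// m0.
Qed.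

Definition window_density (q : Omega * (V * V)) : R :=
  pair_density q * window_weight C (unmoved q) * (fine (lam C))^-1.

Lemma measurable_window_density : measurable_fun setT window_density.
Proof.
apply: measurable_funM => //; apply: measurable_funM.
  exact: measurable_pair_density.
exact: measurableT_comp (measurable_window_weight mC) measurable_unmoved.
Qed.

Lemma window_density_ge0 q : (0 <= window_density q)%R.
Proof.
apply: mulr_ge0; last by rewrite invr_ge0 fine_ge0.
by apply: mulr_ge0; [exact: pair_density_ge0|exact: window_weight_ge0].
Qed.

(* The joint law of the base point in Omega, of U = u and of U + V = x, where
   q = (w, (u, x)). *)
Definition window_measure : {measure set (Omega * (V * V))%type -> \bar R} :=
  density_measure PL measurable_window_density window_density_ge0.

Lemma integral_window_measure (g : Omega * (V * V) -> \bar R) :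
  measurable_fun setT g -> (forall q, 0 <= g q) ->
  \int[window_measure]_q g q =
  \int[P]_w \int[lam2]_p ((window_density (w, p))%:E * g (w, p)).
Proof.
move=> mg g0; rewrite (ge0_integral_density_measure PL _ _ mg g0).
have mdg : measurable_fun setT (fun q => (window_density q)%:E * g q).
  apply: emeasurable_funM => //; apply/measurable_EFinP.
  exact: measurable_window_density.
have dg0 q : 0 <= (window_density q)%:E * g q.
  by rewrite mule_ge0// lee_fin window_density_ge0.
exact: (fubini_tonelli1 _ mdg dg0).
Qed.

Lemma window_meckeP : window_mecke C <-> forall f : S * V -> \bar R,
  measurable_fun setT f -> (forall r, 0 <= f r) ->
  \int[window_measure]_q f (moved q).1 = \int[window_measure]_q f (unmoved q).1.
Proof.
have mW : measurable_fun setT (fun q => (window_weight C q)%:E).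
  by apply/measurable_EFinP; exact: measurable_window_weight.
have W0 q : 0 <= (window_weight C q)%:E by rewrite lee_fin window_weight_ge0.
pose l := (fine (lam C))^-1%R; have l0 : (0 <= l)%R by rewrite invr_ge0 fine_ge0.
have key (f : S * V -> \bar R) : measurable_fun setT f -> (forall r, 0 <= f r) ->
    \int[window_measure]_q f (moved q).1 =
      \int[moved_measure]_q ((window_weight C q)%:E * f q.1) * l%:E /\
    \int[window_measure]_q f (unmoved q).1 =
      \int[unmoved_measure]_q ((window_weight C q)%:E * f q.1) * l%:E.
  move=> mf f0.
  have mf1 (phi : Omega * (V * V) -> (S * V) * V) : measurable_fun setT phi ->
      measurable_fun setT (fun q => f (phi q).1).
    by move=> mphi; exact: (measurableT_comp mf (measurableT_comp measurable_fst mphi)).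
  have mWf : measurable_fun setT (fun q => (window_weight C q)%:E * f q.1 * l%:E).
    apply: emeasurable_funM => //; apply: emeasurable_funM => //.
    exact: measurableT_comp mf measurable_fst.
  have Wf0 q : 0 <= (window_weight C q)%:E * f q.1 * l%:E.
    by rewrite !mule_ge0 ?lee_fin// window_weight_ge0.
  have mWf' : measurable_fun setT (fun q => (window_weight C q)%:E * f q.1).
    by apply: emeasurable_funM => //; exact: measurableT_comp mf measurable_fst.
  have Wf0' q : 0 <= (window_weight C q)%:E * f q.1.
    by rewrite mule_ge0 ?lee_fin// window_weight_ge0.
  split.
    rewrite -ge0_integralZr// (integral_moved mWf Wf0).
    rewrite (integral_window_measure (mf1 _ measurable_moved)) => [|q]; last exact: f0.
    apply: eq_integral => w _; apply: eq_integral => p _ /=.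
    rewrite /window_density /window_weight /pair_density /= window_mass_th.
    rewrite opprB addrCA subrr addr0 [in RHS]muleAC !muleA -!EFinM.
    congr (_%:E * _); rewrite /l; ring.
  rewrite -ge0_integralZr// (integral_unmoved mWf Wf0).
  rewrite (integral_window_measure (mf1 _ measurable_unmoved)) => [|q]; last exact: f0.
  apply: eq_integral => w _; apply: eq_integral => p _ /=.
  rewrite /window_density /window_weight /pair_density /=.
  by rewrite [in RHS]muleAC !muleA -!EFinM; congr (_%:E * _); rewrite /l; ring.
have lK x : x * l%:E * (fine (lam C))%:E = x.
  by rewrite -muleA -EFinM mulVf ?mule1// gt_eqF.
split => h f mf f0; have [e1 e2] := key f mf f0; first by rewrite e1 e2 h.
by rewrite -[LHS]lK -[RHS]lK -e1 -e2 h.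
Qed.

(* The conditional probability that V belongs to B when U = u. *)
Definition window_kernel (B : set V) (y : S) (u : V) : \bar R :=
  (\int[lam]_x (\1_C x * \1_B (x - u) * field y (x - u))%:E) *
  ((fine (window_mass C y u))^-1)%:E.

Lemma window_kernel_ge0 B y u : 0 <= window_kernel B y u.
Proof.
apply: mule_ge0; last by rewrite lee_fin invr_ge0 fine_ge0// window_mass_ge0.
by apply: integral_ge0 => x _; rewrite lee_fin !mulr_ge0// field_ge0.
Qed.

Let measurable_kernel_integrand B : measurable B ->
  measurable_fun setT (fun r : (S * V) * V =>
    (\1_C r.2 * \1_B (r.2 - r.1.2) * field r.1.1 (r.2 - r.1.2))%:E).
Proof.
move=> mB.
have m1C : measurable_fun setT (\1_C : V -> R) by exact: measurable_indic.
have m1B : measurable_fun setT (\1_B : V -> R) by exact: measurable_indic.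
have md : measurable_fun setT (fun r : (S * V) * V => (r.2 - r.1.2)%R).
  by apply: measurable_rVB => //; exact: measurableT_comp measurable_snd measurable_fst.
apply/measurable_EFinP; apply: measurable_funM; first apply: measurable_funM.
- exact: measurableT_comp m1C measurable_snd.
- exact: measurableT_comp m1B md.
- by apply: measurable_field => //; exact: measurableT_comp measurable_fst measurable_fst.
Qed.

Lemma measurable_window_kernel B : measurable B ->
  measurable_fun setT (fun r : S * V => window_kernel B r.1 r.2).
Proof.
move=> mB; apply: emeasurable_funM.
  apply: (measurable_fun_fubini_tonelli_F _ (measurable_kernel_integrand mB)) => r.
  by rewrite lee_fin !mulr_ge0// field_ge0.
apply/measurable_EFinP; apply: measurable_invr.
have mf : measurable_fun setT (@fine R) by exact: fine_measurable.
exact: measurableT_comp mf (measurable_window_mass mC).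
Qed.

Let integral_window_snd (J : Omega * V -> \bar R) B : measurable B ->
  measurable_fun setT J -> (forall r, 0 <= J r) ->
  \int[window_measure]_q (J (q.1, q.2.1) * (\1_B (q.2.2 - q.2.1)%R)%:E) =
  \int[P]_w \int[lam]_u ((\1_C u * (fine (lam C))^-1)%:E *
    (J (w, u) * window_kernel B (Y w) u)).
Proof.
move=> mB mJ J0.
have m1B : measurable_fun setT (\1_B : V -> R) by exact: measurable_indic.
have mg : measurable_fun setT (fun q : Omega * (V * V) =>
    J (q.1, q.2.1) * (\1_B (q.2.2 - q.2.1)%R)%:E).
  apply: emeasurable_funM.
    apply: (measurableT_comp mJ (g := fun q : Omega * (V * V) => (q.1, q.2.1))).
    apply: measurable_fun_pair => //.
    exact: measurableT_comp measurable_fst measurable_snd.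
  apply/measurable_EFinP; exact: measurableT_comp m1B (@measurable_pair_diff _ _).
have g0 (q : Omega * (V * V)) : 0 <= J (q.1, q.2.1) * (\1_B (q.2.2 - q.2.1)%R)%:E.
  by rewrite mule_ge0// lee_fin.
rewrite (integral_window_measure mg g0); apply: eq_integral => w _.
have mwg : measurable_fun setT (fun p : V * V => (window_density (w, p))%:E *
    (J (w, p.1) * (\1_B (p.2 - p.1)%R)%:E)).
  have mwp := measurable_fun_pair (measurable_cst w) (@measurable_id _ (V * V)%type setT).
  apply: emeasurable_funM; last exact: (measurableT_comp mg mwp).
  apply/measurable_EFinP; exact: (measurableT_comp measurable_window_density mwp).
have wg0 (p : V * V) : 0 <= (window_density (w, p))%:E *
    (J (w, p.1) * (\1_B (p.2 - p.1)%R)%:E).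
  by apply: mule_ge0; [rewrite lee_fin window_density_ge0|exact: (g0 (w, p))].
rewrite [LHS](fubini_tonelli1 _ mwg wg0); apply: eq_integral => u _.
rewrite /fubini_F /=.
have mk : measurable_fun setT (fun x : V => (\1_C x * \1_B (x - u) * field (Y w) (x - u))%:E).
  exact: (measurableT_comp (measurable_kernel_integrand mB)
    (measurable_fun_pair (measurable_cst (Y w, u)) (@measurable_id _ _ setT))).
set m := (fine (window_mass C (Y w) u))^-1%R; set l := (fine (lam C))^-1%R.
have m0 : (0 <= m)%R by rewrite invr_ge0 fine_ge0// window_mass_ge0.
have l0 : (0 <= l)%R by rewrite invr_ge0 fine_ge0.
transitivity ((J (w, u) * (\1_C u * l * m)%:E) *
    \int[lam]_x (\1_C x * \1_B (x - u) * field (Y w) (x - u))%:E); last first.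
  rewrite /window_kernel -/m [X in _ * (_ * X)]muleC !muleA; congr (_ * _).
  by rewrite [X in _ = X * _]muleC -muleA -EFinM.
rewrite -ge0_integralZl//; last 2 first.
- by move=> x _; rewrite lee_fin !mulr_ge0// field_ge0.
- by apply: mule_ge0 => //; rewrite lee_fin !mulr_ge0.
apply: eq_integral => x _; rewrite muleCA -[RHS]muleA -!EFinM; congr (_ * _%:E).
rewrite /window_density /window_weight /pair_density /= -/m -/l; ring.
Qed.

Lemma integral_window_fst (J : Omega * V -> \bar R) :
  measurable_fun setT J -> (forall r, 0 <= J r) ->
  \int[window_measure]_q J (q.1, q.2.1) =
  \int[P]_w \int[lam]_u ((\1_C u * (fine (lam C))^-1)%:E * J (w, u)).
Proof.
move=> mJ J0; transitivity (\int[window_measure]_q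
    (J (q.1, q.2.1) * (\1_(setT : set V) (q.2.2 - q.2.1)%R)%:E)).
  by apply: eq_integral => q _; rewrite indicE in_setT mule1.
rewrite integral_window_snd//; apply: eq_integral => w _; apply: eq_integral => u _.
have [Cu|Cu] := pselect (C u); last by rewrite indicE memNset// mul0r !mul0e.
congr (_ * _); rewrite -[RHS]mule1; congr (_ * _).
rewrite -[RHS](window_massYK w Cu) muleC; congr (_ * _).
by apply: eq_integral => x _; rewrite indicT mulr1.
Qed.

Lemma integral_window_kernel (J : Omega * V -> \bar R) B : measurable B ->
  measurable_fun setT J -> (forall r, 0 <= J r) ->
  \int[window_measure]_q (J (q.1, q.2.1) * (\1_B (q.2.2 - q.2.1)%R)%:E) =
  \int[window_measure]_q (J (q.1, q.2.1) * window_kernel B (Y q.1) q.2.1).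
Proof.
move=> mB mJ J0; rewrite integral_window_snd//.
rewrite (integral_window_fst (J := fun r => J r * window_kernel B (Y r.1) r.2))//.
- apply: emeasurable_funM => //.
  apply: (measurableT_comp (measurable_window_kernel mB)
    (g := fun r : Omega * V => (Y r.1, r.2))).
  by apply: measurable_fun_pair => //; exact: measurableT_comp.
- by move=> r; rewrite mule_ge0// window_kernel_ge0.
Qed.

End window_measure.

End stationarity.

(** * Shifts along lines by a given mass *)

Lemma ge0_integral_gt0 d (T : measurableType d) (R : realType)
    (mu : {measure set T -> \bar R}) (D : set T) (f : T -> R) :
  measurable D -> measurable_fun D f -> (forall x, D x -> 0 < f x) ->
  (0 < mu D)%E -> (0 < \int[mu]_(x in D) (f x)%:E)%E.
Proof.
move=> mD mf f0 D0; rewrite lt0e integral_ge0 ?andbT; last first.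
  by move=> x Dx; rewrite lee_fin ltW// f0.
apply/eqP => I0.
have : (\int[mu]_(x in D) `|(f x)%:E| = 0)%E.
  rewrite -I0; apply: eq_integral => x /set_mem Dx; rewrite gee0_abs//.
  by rewrite lee_fin ltW// f0.
move=> /(ae_eq_integral_abs mu mD (proj2 (measurable_EFinP _ _) mf))[N [mN N0 sub]].
suff : mu D = 0%E by move=> D00; rewrite D00 ltxx in D0.
apply: (subset_measure0 mD mN _ N0) => x Dx; apply: sub => /= /(_ Dx) [].
by apply/eqP; rewrite gt_eqF// f0.
Qed.

Section cumul.
Local Open Scope ereal_scope.
Context (R : realType).
Local Notation leb := (@lebesgue_measure R).

Definition cumul (z : R -> R) (t : R) : R :=
  (fine (\int[leb]_(u in `[0%R, t]) (z u)%:E) -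
   fine (\int[leb]_(u in `[t, 0%R]) (z u)%:E))%R.

(* The inverse of [cumul z], as a difference of measures so that it is jointly
   measurable in z and r for all z. *)
Definition quantile (z : R -> R) (r : R) : R :=
  (fine (leb [set t | (0 <= t)%R /\ (cumul z t < r)%R]) -
   fine (leb [set t | (t <= 0)%R /\ (r < cumul z t)%R]))%R.

Section measurability.
Context d (T : measurableType d) (Z : T -> R -> R).
Hypothesis mZ : measurable_fun setT (fun q : T * R => Z q.1 q.2).
Hypothesis Z0 : forall x t, (0 <= Z x t)%R.

Let measurable_integral_itv (a b : T * R -> R) :
  measurable_fun setT a -> measurable_fun setT b ->
  measurable_fun setT (fun q => \int[leb]_(u in `[a q, b q]) (Z q.1 u)%:E).
Proof.
move=> ma mb.
pose D := [set r : (T * R) * R | (a r.1 <= r.2)%R /\ (r.2 <= b r.1)%R].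
have mD : measurable D.
  apply: measurableI.
    rewrite -[X in measurable X]setTI; apply: measurable_fun_le => //.
    exact: measurableT_comp ma measurable_fst.
  rewrite -[X in measurable X]setTI; apply: measurable_fun_le => //.
  exact: measurableT_comp mb measurable_fst.
rewrite (_ : (fun q => _) =
    (fun q => \int[leb]_u (\1_D (q, u) * Z q.1 u)%:E)); last first.
  apply/funext => q; rewrite integral_mkcond; apply: eq_integral => u _.
  rewrite patchE indicE; case: ifPn => [/set_mem|/negP h].
    by rewrite /= in_itv/= => /andP[h1 h2]; rewrite mem_set ?mul1r.
  rewrite memNset ?mul0r// => -[/= h1 h2]; apply: h; apply/mem_set.
  by rewrite /= in_itv/= h1 h2.
apply: (@measurable_fun_fubini_tonelli_F _ _ _ _ _ leb
    (fun r : (T * R) * R => (\1_D r * Z r.1.1 r.2)%:E)).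
  apply/measurable_EFinP; apply: measurable_funM; first exact: measurable_indic.
  apply: (measurableT_comp mZ (g := fun r : (T * R) * R => (r.1.1, r.2))).
  by apply: measurable_fun_pair => //; exact: measurableT_comp.
by move=> r; rewrite lee_fin mulr_ge0.
Qed.

Lemma measurable_cumul : measurable_fun setT (fun q : T * R => cumul (Z q.1) q.2).
Proof.
have mf : measurable_fun setT (@fine R) by exact: fine_measurable.
have m0 : measurable_fun setT (fun q : T * R => 0%R : R) by exact: measurable_cst.
have m2 : measurable_fun setT (fun q : T * R => q.2) by exact: measurable_snd.
apply: measurable_funB.
  exact: measurableT_comp mf (measurable_integral_itv m0 m2).
exact: measurableT_comp mf (measurable_integral_itv m2 m0).
Qed.

Lemma measurable_quantile :
  measurable_fun setT (fun q : T * R => quantile (Z q.1) q.2).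
Proof.
have mc : measurable_fun setT (fun r : (T * R) * R => cumul (Z r.1.1) r.2).
  apply: (measurableT_comp measurable_cumul (g := fun r : (T * R) * R => (r.1.1, r.2))).
  by apply: measurable_fun_pair => //; exact: measurableT_comp.
have m12 : measurable_fun setT (fun r : (T * R) * R => r.1.2) by exact: measurableT_comp.
pose A := [set r : (T * R) * R | (0 <= r.2)%R /\ (cumul (Z r.1.1) r.2 < r.1.2)%R].
pose B := [set r : (T * R) * R | (r.2 <= 0)%R /\ (r.1.2 < cumul (Z r.1.1) r.2)%R].
have m2 : measurable_fun setT (fun r : (T * R) * R => r.2) by exact: measurable_snd.
have m0 : measurable_fun setT (fun r : (T * R) * R => 0%R : R) by exact: measurable_cst.
have mtrue : measurable [set true] by [].
have mA : measurable A.
  apply: measurableI.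
    exact: (measurable_preimage (measurable_fun_ler m0 m2) mtrue).
  exact: (measurable_preimage (measurable_fun_ltr mc m12) mtrue).
have mB : measurable B.
  apply: measurableI.
    exact: (measurable_preimage (measurable_fun_ler m2 m0) mtrue).
  exact: (measurable_preimage (measurable_fun_ltr m12 mc) mtrue).
have mf : measurable_fun setT (@fine R) by exact: fine_measurable.
apply: measurable_funB; apply: (measurableT_comp mf).
  have := measurable_fun_xsection leb mA; congr measurable_fun.
  by apply/funext => q /=; congr (leb _); apply/seteqP; split => t; [move/xsectionP|move=> h; apply/xsectionP].
have := measurable_fun_xsection leb mB; congr measurable_fun.
by apply/funext => q /=; congr (leb _); apply/seteqP; split => t; [move/xsectionP|move=> h; apply/xsectionP].
Qed.

End measurability.

Definition proper_density (z : R -> R) := [/\ measurable_fun setT z,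
  forall t, (0 < z t)%R,
  forall a b, \int[leb]_(u in `[a, b]) (z u)%:E < +oo,
  \int[leb]_(u in `[0%R, +oo[) (z u)%:E = +oo &
  \int[leb]_(u in `]-oo, 0%R]) (z u)%:E = +oo].

Section proper.
Variable z : R -> R.
Hypothesis pz : proper_density z.

Let mz : measurable_fun setT z. Proof. by case: pz. Qed.
Let mzE (D : set R) : measurable_fun D (EFin \o z).
Proof. by apply/measurable_EFinP; exact: measurable_funTS. Qed.
Let z0 t : (0 <= z t)%R. Proof. by apply: ltW; case: pz. Qed.

Let J a b := \int[leb]_(u in `]a, b]) (z u)%:E.

Let J0 a b : 0 <= J a b.
Proof. by apply: integral_ge0 => u _; rewrite lee_fin. Qed.

Let Jcc a b : \int[leb]_(u in `[a, b]) (z u)%:E = J a b.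
Proof. by rewrite /J integral_itv_obnd_cbnd//; exact: mzE. Qed.

Let Jfin a b : J a b \is a fin_num.
Proof. by rewrite ge0_fin_numE// -Jcc; case: pz. Qed.

Let JD a b c : (a <= b)%R -> (b <= c)%R -> J a c = J a b + J b c.
Proof.
move=> ab bc; rewrite /J (@itv_bndbnd_setU _ _ _ (BRight b))//; rewrite ?bnd_simp//.
rewrite ge0_integral_setU//=.
- exact: mzE.
- by move=> x _; rewrite lee_fin.
apply/disj_setPS => x [] /=; rewrite !in_itv/= => /andP[_ xb] /andP[bx _].
by move: bx; rewrite ltNge xb.
Qed.

Let Jle a b : (b <= a)%R -> J a b = 0.
Proof. by move=> ba; rewrite /J set_itv_ge ?integral_set0// bnd_simp -leNgt. Qed.

Let cumulE t : cumul z t = (fine (J 0 t) - fine (J t 0))%R.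
Proof. by rewrite /cumul !Jcc. Qed.

Lemma cumulB a b : (a <= b)%R ->
  (cumul z b - cumul z a)%:E = \int[leb]_(u in `]a, b]) (z u)%:E.
Proof.
move=> ab; rewrite -/(J a b) -[RHS]fineK//; congr EFin; rewrite !cumulE.
have fD x y w : (x <= y)%R -> (y <= w)%R -> fine (J x w) = (fine (J x y) + fine (J y w))%R.
  by move=> xy yw; rewrite (JD xy yw) fineD.
have [a0|/ltW a0] := leP 0%R a.
  have b0 := le_trans a0 ab.
  by rewrite (Jle a0) (Jle b0) (fD _ _ _ a0 ab) /=; lra.
have [b0|/ltW b0] := leP 0%R b.
  by rewrite (Jle a0) (Jle b0) (fD _ _ _ a0 b0) /=; lra.
by rewrite (Jle a0) (Jle b0) (fD _ _ _ ab b0) /=; lra.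
Qed.

Lemma cumul0 : cumul z 0%R = 0%R.
Proof. by rewrite cumulE subrr. Qed.

Lemma cumul_lt a b : (a < b)%R -> (cumul z a < cumul z b)%R.
Proof.
move=> ab; rewrite -subr_gt0 -lte_fin cumulB ?(ltW ab)//.
apply: ge0_integral_gt0 => //.
- exact: measurable_funTS.
- by move=> x _; case: pz.
- rewrite [X in _ < X]lebesgue_measure_itv/= lte_fin ab -EFinB lte_fin subr_gt0//.
Qed.

Lemma cumul_le : {mono cumul z : a b / (a <= b)%R}.
Proof. by apply: le_mono => a b; exact: cumul_lt. Qed.

Let nu : {measure set (measurableTypeR R) -> \bar R} := density_measure leb mz z0.

Let bounded_mass (F : nat -> set R) (D : set R) (r : R) :
  (forall k, measurable (F k)) -> nondecreasing_seq F -> \bigcup_k F k = D ->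
  (forall k, nu (F k) <= r%:E) -> \int[leb]_(u in D) (z u)%:E <= r%:E.
Proof.
move=> mF ndF FD Fr.
have cv : nu (F k) @[k --> \oo] --> nu (\bigcup_k F k).
  apply: nondecreasing_cvg_mu => //; exact: bigcupT_measurable.
rewrite -[leLHS]/(nu D) -FD -(cvg_lim _ cv)//.
by apply: lime_le; [apply/cvg_ex; eexists; exact: cv|exact: nearW].
Qed.

Lemma cumul_unbounded_right r : exists2 t : R, (0 <= t)%R & (r < cumul z t)%R.
Proof.
apply/not_exists2P => h.
suff : \int[leb]_(u in `[0%R, +oo[) (z u)%:E <= r%:E.
  by case: pz => _ _ _ -> _; rewrite leye_eq.
apply: (@bounded_mass (fun k => `[0%R, k%:R]%classic)) => //.
- move=> i j ij; apply/subsetPset => x /=; rewrite !in_itv/= => /andP[-> /le_trans].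
  by apply; rewrite ler_nat.
- apply/seteqP; split => [x [k _] /=|x /=]; rewrite !in_itv/=.
    by move=> /andP[->].
  move=> /andP[x0 _]; exists (Num.bound x) => //=.
  by rewrite in_itv/= x0 ltW// archi_boundP.
move=> k; have k0 : (0 <= k%:R :> R)%R by [].
rewrite -[leLHS]/(\int[leb]_(u in _) _) Jcc /J -cumulB// cumul0 subr0 lee_fin.
by have [//|/negP] := h k%:R; rewrite -leNgt.
Qed.

Lemma cumul_unbounded_left r : exists2 t : R, (t <= 0)%R & (cumul z t < r)%R.
Proof.
apply/not_exists2P => h.
suff : \int[leb]_(u in `]-oo, 0%R]) (z u)%:E <= (- r)%R%:E.
  by case: pz => _ _ _ _ ->; rewrite leye_eq.
apply: (@bounded_mass (fun k => `[(- k%:R)%R, 0%R]%classic) _ (- r)%R) => //.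
- move=> i j ij; apply/subsetPset => x /=; rewrite !in_itv/= => /andP[ix ->].
  by rewrite andbT (le_trans _ ix)// lerN2 ler_nat.
- apply/seteqP; split => [x [k _] /=|x /=]; rewrite !in_itv/=.
    by move=> /andP[].
  move=> x0; exists (Num.bound (- x)) => //=.
  by rewrite in_itv/= x0 andbT lerNl ltW// archi_boundP// oppr_ge0.
move=> k; have k0 : (- k%:R <= 0 :> R)%R by rewrite oppr_le0.
rewrite -[leLHS]/(\int[leb]_(u in _) _) Jcc /J -cumulB// cumul0 sub0r lee_fin lerN2.
by have [//|/negP] := h (- k%:R)%R; rewrite -leNgt.
Qed.

Lemma cumul_surj r : exists t, cumul z t = r.
Proof.
have [b b0 rb] := cumul_unbounded_right r.
have [a a0 ar] := cumul_unbounded_left r.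
have ab : (a <= b)%R by exact: le_trans b0.
have inty : leb.-integrable `[a, b] (EFin \o z).
  apply/integrableP; split; first exact: mzE.
  apply: (@le_lt_trans _ _ (J a b)); last by rewrite -ge0_fin_numE.
  rewrite -Jcc le_eqVlt; apply/orP; left; apply/eqP; apply: eq_integral => u _.
  by rewrite gee0_abs// lee_fin.
have fE t : (a <= t)%R -> parameterized_integral leb a t z = (cumul z t - cumul z a)%R.
  move=> at_; rewrite /parameterized_integral /Rintegral Jcc /J -cumulB//.
have := @IVT R _ _ _ (r - cumul z a)%R ab (parameterized_integral_continuous ab inty).
rewrite !fE// subrr min_l ?max_r ?subr_ge0 ?cumul_le// => /(_ _)[].
  by rewrite ?subr_ge0 (ltW ar) ?lerD2r ltW.
move=> c; rewrite in_itv/= => /andP[ac _]; rewrite fE// => /addIr cr.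
by exists c.
Qed.

Lemma quantileK t : quantile z (cumul z t) = t.
Proof.
rewrite /quantile.
have lt_cumul x y : (cumul z x < cumul z y)%R = (x < y)%R.
  by rewrite (leW_mono cumul_le).
have -> : [set s | (0 <= s)%R /\ (cumul z s < cumul z t)%R] = `[0%R, t[%classic.
  apply/seteqP; split => s /=; rewrite in_itv/= lt_cumul; first by move=> [-> ->].
  by move=> /andP[].
have -> : [set s | (s <= 0)%R /\ (cumul z t < cumul z s)%R] = `]t, 0%R]%classic.
  apply/seteqP; split => s /=; rewrite in_itv/= lt_cumul; first by move=> [-> ->].
  by move=> /andP[].
rewrite !lebesgue_measure_itv/= !lte_fin.
by case: (ltgtP 0%R t) => [t0|t0|<-] /=; lra.
Qed.

Lemma cumulK r : cumul z (quantile z r) = r.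
Proof. by have [t <-] := cumul_surj r; rewrite quantileK. Qed.

Lemma measurable_cumul1 : measurable_fun setT (cumul z).
Proof.
have mZ : measurable_fun setT (fun q : unit * R => z q.2).
  exact: measurableT_comp mz measurable_snd.
exact: (measurableT_comp (measurable_cumul mZ (fun=> z0))
  (measurable_fun_pair (measurable_cst tt) (@measurable_id _ _ setT))).
Qed.

Lemma measurable_quantile1 : measurable_fun setT (quantile z).
Proof.
have mZ : measurable_fun setT (fun q : unit * R => z q.2).
  exact: measurableT_comp mz measurable_snd.
exact: (measurableT_comp (measurable_quantile mZ (fun=> z0))
  (measurable_fun_pair (measurable_cst tt) (@measurable_id _ _ setT))).
Qed.

Lemma ge0_integral_cumul (G : R -> \bar R) :
  measurable_fun setT G -> (forall r, 0 <= G r) ->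
  \int[leb]_s ((z s)%:E * G (cumul z s)) = \int[leb]_r G r.
Proof.
move=> mG G0; have mGc := measurableT_comp mG measurable_cumul1.
rewrite -(ge0_integral_density_measure leb mz z0 mGc); last by move=> x; exact: G0.
apply: (@ge0_integral_comp _ _ _ _ _ nu leb (cumul z)) => //.
  exact: measurable_cumul1.
move=> A mA; apply/esym.
have mc : measurable_fun setT (cumul z : measurableTypeR R -> measurableTypeR R).
  exact: measurable_cumul1.
have := @lebesgue_measure_unique R (image_measure nu mc) _ A mA; apply.
move=> _ [[a b] _ <-]; rewrite /image_measure /= /pushforward.
have E1 s : (quantile z a < s)%R = (a < cumul z s)%R.
  by rewrite -(leW_mono cumul_le) cumulK.
have E2 s : (s <= quantile z b)%R = (cumul z s <= b)%R by rewrite -cumul_le cumulK.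
have -> : cumul z @^-1` `]a, b] = `]quantile z a, quantile z b]%classic.
  apply/seteqP; split => s /=;
    by rewrite !in_itv/= E1 E2.
rewrite [X in X = _]lebesgue_measure_itv/= lte_fin; have [ab|ba] := ltP a b.
  rewrite -[RHS]cumulB ?cumulK ?EFinB// -cumul_le !cumulK; exact: ltW.
by rewrite set_itv_ge ?measure0// bnd_simp -leNgt -cumul_le !cumulK.
Qed.

Lemma ge0_integral_quantile (G : R -> \bar R) :
  measurable_fun setT G -> (forall r, 0 <= G r) ->
  \int[leb]_r G (quantile z r) = \int[leb]_s ((z s)%:E * G s).
Proof.
move=> mG G0.
rewrite -(ge0_integral_cumul (measurableT_comp mG measurable_quantile1)).
  by apply: eq_integral => s _ /=; rewrite quantileK.
by move=> r; exact: G0.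
Qed.

End proper.

Lemma cumul_shift (z : R -> R) (u t : R) : proper_density z ->
  proper_density (fun s => z (u + s)%R) ->
  cumul (fun s => z (u + s)%R) t = (cumul z (u + t) - cumul z u)%R.
Proof.
move=> pz pzu.
have [mz z0 _ _ _] := pz.
have shift (a b : R) : \int[leb]_(s in `]a, b]) (z (u + s)%R)%:E =
    \int[leb]_(s in `](u + a)%R, (u + b)%R]) (z s)%:E.
  pose f := (EFin \o z) \_ `](u + a)%R, (u + b)%R].
  rewrite [RHS]integral_mkcond -[RHS](ge0_integral_lebesgue_translation u (f := f)).
  - rewrite integral_mkcond; apply: eq_integral => s _; rewrite /f !patchE [(s + u)%R]addrC /=.
    congr (if _ then _ else _); apply/idP/idP => /set_mem h; apply/mem_set; move: h;
      by rewrite /= !in_itv/= ltrD2l lerD2l.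
  - apply/(measurable_restrictT _ _).1 => //; apply: measurable_funTS.
    exact/measurable_EFinP.
  - by move=> s; rewrite /f patchE; case: ifPn => // _; rewrite lee_fin ltW.
have c0 := cumul0 pzu.
have [t0|/ltW t0] := leP 0%R t.
  have ut : (u <= u + t)%R by rewrite lerDl.
  have := shift 0%R t; rewrite -(cumulB pzu t0) addr0 -(cumulB pz ut) => -[].
  by rewrite c0 subr0.
have ut : (u + t <= u)%R by rewrite gerDl.
have := shift t 0%R; rewrite -(cumulB pzu t0) addr0 -(cumulB pz ut) => -[].
by rewrite c0; lra.
Qed.

Lemma quantile_shift (z : R -> R) (u r : R) : proper_density z ->
  proper_density (fun s => z (u + s)%R) ->
  (u + quantile (fun s => z (u + s)%R) r)%R = quantile z (cumul z u + r).
Proof.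
move=> pz pzu; have [t tr] := cumul_surj pz (cumul z u + r)%R.
rewrite -tr (quantileK pz) -[in LHS](_ : cumul (fun s => z (u + s)%R) (t - u) = r).
  by rewrite (quantileK pzu) addrC subrK.
by rewrite (cumul_shift _ pz pzu) addrCA subrr addr0 tr addrC addKr.
Qed.

Lemma quantile_preserving (z : R -> R) (r : R) (h : R -> \bar R) :
  (forall u, proper_density (fun s => z (u + s)%R)) ->
  measurable_fun setT h -> (forall t, 0 <= h t) ->
  \int[leb]_s ((z s)%:E * h (s + quantile (fun t => z (s + t)%R) r)%R) =
  \int[leb]_s ((z s)%:E * h s).
Proof.
move=> pzu mh h0; have pz : proper_density z.
  by have := pzu 0%R; congr proper_density; apply/funext => s; rewrite add0r.
under eq_integral do rewrite quantile_shift//.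
have mhq := measurableT_comp mh (measurable_quantile1 pz).
rewrite (ge0_integral_cumul pz (G := fun x => h (quantile z (x + r)))).
- rewrite (ge0_integral_lebesgue_translation r mhq) => [|x]; last exact: h0.
  exact: ge0_integral_quantile.
- apply: (measurableT_comp mhq (g := fun x : R => (x + r)%R)).
  exact: measurable_funD.
- by move=> x; exact: h0.
Qed.

End cumul.

Section line_decomposition.
Local Open Scope ereal_scope.
Context (R : realType) (n : nat).
Local Notation V := 'rV[R]_n.
Local Notation lam := (lebesgue_rV R n).
Local Notation leb := (@lebesgue_measure R).

(* [c] is the coordinate along e, so restricting to c in [0, 1[ selects each line
   in direction e with total weight 1. *)
Lemma ge0_integral_lines (e : V) (i : 'I_n) (F : V -> \bar R) :
  e ord0 i != 0%R -> measurable_fun setT F -> (forall s, 0 <= F s) ->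
  let c (s : V) := (s ord0 i / e ord0 i)%R in
  \int[lam]_s ((\1_(`[0%R, 1%R[%classic : set R) (c s))%:E *
    \int[leb]_u F (s + u *: e)%R) = \int[lam]_s F s.
Proof.
move=> ei0 mF F0 c.
pose g : R -> R := \1_(`[0%R, 1%R[%classic).
have mg : measurable_fun setT g by exact: measurable_indic.
have mgE : measurable_fun setT (EFin \o g) by exact/measurable_EFinP.
have g0 x : 0 <= (g x)%:E by rewrite lee_fin.
have mc : measurable_fun setT c.
  by apply: measurable_funM => //; exact: measurable_mx_coord.
have muD : measurable_fun setT (fun q : V * R => (q.1 + q.2 *: e)%R).
  by apply: measurable_rVD => //; apply: measurable_rVZ.
have mgF : measurable_fun setT (fun q : V * R => (g (c q.1))%:E * F (q.1 + q.2 *: e)%R).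
  apply: emeasurable_funM.
    exact: measurableT_comp mgE (measurableT_comp mc measurable_fst).
  exact: measurableT_comp mF muD.
have mgF' : measurable_fun setT (fun q : V * R => (g (c q.1 - q.2)%R)%:E * F q.1).
  apply: emeasurable_funM.
    apply: (measurableT_comp mgE (g := fun q : V * R => (c q.1 - q.2)%R)).
    by apply: measurable_funB => //; exact: measurableT_comp mc measurable_fst.
  exact: measurableT_comp mF measurable_fst.
transitivity (\int[lam]_s \int[leb]_u ((g (c s))%:E * F (s + u *: e)%R)).
  apply: eq_integral => s _; rewrite ge0_integralZl//.
  exact: (measurableT_comp mF (measurableT_comp muD (measurable_fun_pair (measurable_cst s) (@measurable_id _ _ setT)))).
have gF0 (q : V * R) : 0 <= (g (c q.1))%:E * F (q.1 + q.2 *: e)%R by rewrite mule_ge0.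
rewrite [LHS](@fubini_tonelli _ _ _ _ _ lam leb _ mgF gF0).
transitivity (\int[leb]_u \int[lam]_s ((g (c s - u)%R)%:E * F s)).
  apply: eq_integral => u _.
  rewrite -(@ge0_integral_lebesgue_rV_translation _ _ (u *: e)
    (fun s => (g (c s - u)%R)%:E * F s)).
  - apply: eq_integral => s _; congr ((g _)%:E * _).
    by rewrite /c !mxE mulrDl mulfK// addrK.
  - exact: (measurableT_comp mgF' (measurable_fun_pair (@measurable_id _ _ setT) (measurable_cst u))).
  - by move=> s; rewrite mule_ge0.
have gF0' (q : V * R) : 0 <= (g (c q.1 - q.2)%R)%:E * F q.1 by rewrite mule_ge0.
rewrite -[LHS](@fubini_tonelli _ _ _ _ _ lam leb _ mgF' gF0').
apply: eq_integral => s _ /=.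
have mgc : measurable_fun setT (fun u : R => (g (c s - u)%R)%:E).
  apply: (measurableT_comp mgE (g := fun u : R => (c s - u)%R)).
  exact: measurable_funB.
rewrite ge0_integralZr//.
have -> : \int[leb]_u (g (c s - u)%R)%:E = 1; last by rewrite mul1e.
have mgc' : measurable_fun setT (fun u : R => (g (u + c s)%R)%:E).
  apply: (measurableT_comp mgE (g := fun u : R => (u + c s)%R)).
  exact: measurable_funD.
transitivity (\int[leb]_u (g (- u + c s)%R)%:E).
  by apply: eq_integral => u _; rewrite addrC.
rewrite (ge0_integral_lebesgueN (f := fun u => (g (u + c s)%R)%:E))//.
rewrite (ge0_integral_lebesgue_translation (c s) mgE)//.
by rewrite integral_indic// setIT [LHS]lebesgue_measure_itv/= lte_fin ltr01 sube0.
Qed.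

End line_decomposition.

Section directional_shift.
Local Open Scope ereal_scope.
Context (R : realType) (n : nat).
Local Notation V := 'rV[R]_n.
Local Notation lam := (lebesgue_rV R n).
Local Notation leb := (@lebesgue_measure R).
Context dO (Omega : measurableType dO)
  (P : {sigma_finite_measure set Omega -> \bar R}).
Context dS (S : measurableType dS) (th : V -> S -> S).
Hypotheses (th_action : additive_action th) (mth : shift_measurable th).
Variable zeta : S -> R.
Hypotheses (mzeta : measurable_fun setT zeta) (zeta_ge0 : forall y, (0 <= zeta y)%R).
Variable Y : Omega -> S.
Hypotheses (mY : measurable_fun setT Y)
  (zetaY_gt0 : forall w s, (0 < zeta (th s (Y w)))%R).

Local Notation field := (field th zeta).
Local Notation palm := (palm P zeta Y).

Variable e : V.
Hypothesis e0 : e != 0%R.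
Hypothesis lines : forall w x, proper_density (fun u => field (Y w) (x + u *: e)%R).

Let line (y : S) (u : R) : R := field y (u *: e)%R.

Definition directional_shift (r : R) (y : S) : V := (quantile (line y) r *: e)%R.

Let mline : measurable_fun setT (fun q : S * R => line q.1 q.2).
Proof. by apply: measurable_field => //; exact: measurable_rVZ. Qed.

Let line0 y u : (0 <= line y u)%R. Proof. exact: field_ge0. Qed.

Let line_th w s t : line (th s (Y w)) t = field (Y w) (s + t *: e)%R.
Proof. by rewrite /line field_th// addrC. Qed.

Let plines w s : proper_density (line (th s (Y w))).
Proof. by have := lines w s; congr proper_density; apply/funext => t; rewrite line_th. Qed.

Lemma measurable_directional_shift2 :
  measurable_fun setT (fun q : S * R => directional_shift q.2 q.1).
Proof. by apply: measurable_rVZ; exact: measurable_quantile. Qed.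

Lemma measurable_directional_shift r : measurable_fun setT (directional_shift r).
Proof.
exact: (measurableT_comp measurable_directional_shift2
  (measurable_fun_pair (@measurable_id _ _ setT) (measurable_cst r))).
Qed.

Lemma directional_shift_preserving r w (g : V -> \bar R) :
  measurable_fun setT g -> (forall s, 0 <= g s) ->
  \int[lam]_s ((field (Y w) s)%:E * g (s + directional_shift r (th s (Y w)))%R) =
  \int[lam]_s ((field (Y w) s)%:E * g s).
Proof.
move=> mg g0.
have /existsP[i ei0] : [exists i, e ord0 i != 0%R].
  apply: contraNT e0 => /existsPn h; apply/eqP/rowP => j.
  by rewrite mxE; apply/eqP; rewrite -[_ == _]negbK; exact: h.
have mf : measurable_fun setT (fun s => (field (Y w) s)%:E).
  apply/measurable_EFinP; exact: (measurableT_comp mzeta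
    (measurable_th mth (@measurable_id _ _ setT) (measurable_cst (Y w)))).
have mds : measurable_fun setT (fun s : V => directional_shift r (th s (Y w))).
  apply: (measurableT_comp (measurable_directional_shift r)).
  exact: measurable_th.
have f0 s : 0 <= (field (Y w) s)%:E by rewrite lee_fin field_ge0.
have mL : measurable_fun setT (fun s : V =>
    (field (Y w) s)%:E * g (s + directional_shift r (th s (Y w)))%R).
  by apply: emeasurable_funM => //; apply: measurableT_comp => //; exact: measurable_rVD.
have mR : measurable_fun setT (fun s : V => (field (Y w) s)%:E * g s).
  by apply: emeasurable_funM => //; exact: measurableT_comp.
rewrite -[LHS](ge0_integral_lines ei0 mL) => [|s]; last by rewrite mule_ge0.
rewrite -[RHS](ge0_integral_lines ei0 mR) => [|s]; last by rewrite mule_ge0.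
apply: eq_integral => s _; congr (_ * _).
pose z (u : R) := field (Y w) (s + u *: e)%R.
have zu u : (fun t => z (u + t)%R) = line (th (s + u *: e)%R (Y w)).
  by apply/funext => t; rewrite line_th /z scalerDl addrA.
have mse : measurable_fun setT (fun u : R => (s + u *: e)%R).
  by apply: measurable_rVD => //; exact: measurable_rVZ.
rewrite -[RHS](@quantile_preserving _ z r (fun t => g (s + t *: e)%R)).
- apply: eq_integral => u _; rewrite zu; congr (_ * g _).
  by rewrite /directional_shift [in RHS]scalerDl addrA.
- by move=> u; rewrite zu; exact: plines.
- exact: measurableT_comp mg mse.
- by [].
Qed.

Hypothesis invariant : forall r (f : S -> \bar R), measurable_fun setT f ->
  (forall y, 0 <= f y) ->
  \int[P]_w f (th (directional_shift r (Y w)) (Y w)) = \int[P]_w f (Y w).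

Let palm_average (B : set R) (k : S -> \bar R) : measurable B ->
  measurable_fun setT k -> (forall y, 0 <= k y) ->
  \int[leb]_s ((\1_B s)%:E * palm (k \o th (s *: e)%R)) = leb B * palm k.
Proof.
move=> mB mk k0.
pose G (s : R) (y : S) : \bar R :=
  (\1_B s * ((zeta y)^-1 * (field y (- s *: e))^-1))%:E * k y.
pose F (r : R) (y : S) := G (- quantile (line y) (- r))%R y.
have m1 : measurable_fun setT (\1_B : R -> R) by exact: measurable_indic.
have mG : measurable_fun setT (fun q : R * S => G q.1 q.2).
  apply: emeasurable_funM; last exact: measurableT_comp mk measurable_snd.
  apply/measurable_EFinP; apply: measurable_funM.
    exact: measurableT_comp m1 measurable_fst.
  apply: measurable_funM; apply: measurable_invr.
    exact: measurableT_comp mzeta measurable_snd.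
  apply: measurable_field => //; apply: measurable_rVZ.
  exact: (measurableT_comp (@oppr_measurable R setT) measurable_fst).
have G0 s y : 0 <= G s y.
  by rewrite mule_ge0// lee_fin !mulr_ge0// invr_ge0 ?field_ge0.
have mF : measurable_fun setT (fun q : R * S => F q.1 q.2).
  apply: (measurableT_comp mG (g := fun q : R * S => ((- quantile (line q.2) (- q.1))%R, q.2))).
  apply: measurable_fun_pair => //.
  apply: (measurableT_comp (@oppr_measurable R setT)).
  apply: (measurableT_comp (measurable_quantile mline line0) (g := fun q : R * S => (q.2, (- q.1)%R))).
  apply: measurable_fun_pair => //.
  exact: (measurableT_comp (@oppr_measurable R setT) measurable_fst).
have zG w s : (line (Y w) s)%:E * G s (th (s *: e)%R (Y w)) =
    (\1_B s)%:E * (((zeta (Y w))^-1)%:E * k (th (s *: e)%R (Y w))).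
  rewrite /G field_th// scaleNr addNr field0// !muleA -!EFinM; congr (_%:E * _).
  have := zetaY_gt0 w (s *: e)%R; rewrite -[zeta _]/(line (Y w) s) => /gt_eqF/negbT f1.
  have /gt_eqF/negbT f2 := zetaY_gt0 w 0%R; rewrite th0// in f2.
  by field; rewrite f1 f2.
have pY w : proper_density (line (Y w)) by rewrite -[Y w](th0 th_action); exact: plines.
have mzeY : measurable_fun setT (fun w => ((zeta (Y w))^-1)%:E).
  by apply/measurable_EFinP; apply: measurable_invr; exact: measurableT_comp.
have z0Y w : 0 <= ((zeta (Y w))^-1)%:E by rewrite lee_fin invr_ge0.
have mk' w : measurable_fun setT (fun s : R => k (th (s *: e)%R (Y w))).
  apply: (measurableT_comp mk); apply: (measurable_th mth) => //.
  exact: measurable_rVZ.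
have mGw w (f : R -> R) : measurable_fun setT f ->
    measurable_fun setT (fun s => G (f s) (Y w)).
  by move=> mf; exact: (measurableT_comp mG (measurable_fun_pair mf (measurable_cst (Y w)))).
have mN : measurable_fun setT (fun s : R => (- s)%R) by exact: oppr_measurable.
have leftE : \int[leb]_s ((\1_B s)%:E * palm (k \o th (s *: e)%R)) =
    \int[leb]_r \int[P]_w F r (th (directional_shift r (Y w)) (Y w)).
  pose K (q : R * Omega) : \bar R :=
    (\1_B q.1)%:E * (((zeta (Y q.2))^-1)%:E * k (th (q.1 *: e)%R (Y q.2))).
  have mY2 : measurable_fun setT (fun q : R * Omega => Y q.2).
    exact: measurableT_comp mY measurable_snd.
  have mK : measurable_fun setT K.
    apply: emeasurable_funM.
      apply/measurable_EFinP; exact: measurableT_comp m1 measurable_fst.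
    apply: emeasurable_funM; first exact: measurableT_comp mzeY measurable_snd.
    apply: (measurableT_comp mk); apply: (measurable_th mth) => //.
    by apply: measurable_rVZ.
  have K0 q : 0 <= K q.
    by apply: mule_ge0; [rewrite lee_fin|apply: mule_ge0 => //; exact: k0].
  pose L (q : R * Omega) := F q.1 (th (directional_shift q.1 (Y q.2)) (Y q.2)).
  have mL : measurable_fun setT L.
    apply: (measurableT_comp mF (g := fun q : R * Omega =>
      (q.1, th (directional_shift q.1 (Y q.2)) (Y q.2)))).
    apply: measurable_fun_pair => //; apply: (measurable_th mth) => //.
    apply: (measurableT_comp measurable_directional_shift2
      (g := fun q : R * Omega => (Y q.2, q.1))).
    exact: measurable_fun_pair.
  have L0 q : 0 <= L q by exact: G0.
  transitivity (\int[leb]_s \int[P]_w K (s, w)).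
    apply: eq_integral => s _; rewrite -ge0_integralZl// ?lee_fin//.
      apply: emeasurable_funM => //; apply: (measurableT_comp mk).
      exact: (measurable_th mth (measurable_cst _) mY).
    by move=> w _; apply: mule_ge0 => //; exact: k0.
  rewrite (@fubini_tonelli _ _ _ _ _ leb P K mK K0).
  rewrite [RHS](@fubini_tonelli _ _ _ _ _ leb P L mL L0).
  apply: eq_integral => w _.
  pose H s := F (cumul (line (Y w)) s) (th (s *: e)%R (Y w)).
  have HE s : H s = G s (th (s *: e)%R (Y w)).
    rewrite /H /F; congr (G _ _).
    have := quantile_shift (u := s) (- cumul (line (Y w)) s)%R (pY w).
    have -> : (fun t => line (Y w) (s + t)%R) = line (th (s *: e)%R (Y w)).
      by apply/funext => t; rewrite line_th /line scalerDl.
    move=> /(_ (plines _ _)); rewrite subrr -(cumul0 (pY w)) quantileK//.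
    by move=> /eqP; rewrite addr_eq0 => /eqP <-.
  have mH : measurable_fun setT H.
    apply: (measurableT_comp mF (g := fun s : R =>
      (cumul (line (Y w)) s, th (s *: e)%R (Y w)))).
    apply: measurable_fun_pair; first exact: (measurable_cumul1 (pY w)).
    by apply: (measurable_th mth) => //; exact: measurable_rVZ.
  transitivity (\int[leb]_s ((line (Y w) s)%:E * H s)).
    by apply: eq_integral => s _; rewrite HE zG.
  rewrite -(ge0_integral_quantile (pY w) mH) => [|s]; last exact: G0.
  by apply: eq_integral => r _; rewrite /H /L/= (cumulK (pY w)).
have rightE : \int[leb]_r \int[P]_w F r (Y w) = leb B * palm k.
  pose L (q : R * Omega) := F q.1 (Y q.2).
  have mL : measurable_fun setT L.
    apply: (measurableT_comp mF (g := fun q : R * Omega => (q.1, Y q.2))).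
    by apply: measurable_fun_pair => //; exact: measurableT_comp mY measurable_snd.
  rewrite (@fubini_tonelli _ _ _ _ _ leb P L mL (fun q => G0 _ _)).
  rewrite /palm -ge0_integralZl//; last 2 first.
  - by apply: emeasurable_funM => //; exact: measurableT_comp.
  - by move=> w _; rewrite mule_ge0.
  apply: eq_integral => w _.
  have mq := measurable_quantile1 (pY w).
  transitivity (\int[leb]_r G (- quantile (line (Y w)) r)%R (Y w)).
    apply: (@ge0_integral_lebesgueN R (fun r => G (- quantile (line (Y w)) r)%R (Y w))).
      by apply: mGw; exact: measurableT_comp mN mq.
    by move=> r; exact: G0.
  rewrite (@ge0_integral_quantile _ _ (pY w) (fun s => G (- s)%R (Y w))); last 2 first.
  - exact: mGw.
  - by move=> s; exact: G0.
  transitivity (\int[leb]_s ((line (Y w) (- s)%R)%:E * G s (Y w))).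
    rewrite -(@ge0_integral_lebesgueN R (fun s => (line (Y w) (- s)%R)%:E * G s (Y w))).
    - by apply: eq_integral => s _; rewrite opprK.
    - apply: emeasurable_funM; last exact: mGw.
      apply/measurable_EFinP; apply: (measurableT_comp mline (g := fun s : R => (Y w, (- s)%R))).
      exact: measurable_fun_pair.
    - by move=> s; rewrite mule_ge0 ?lee_fin// G0.
  transitivity (\int[leb]_s ((\1_B s)%:E * (((zeta (Y w))^-1)%:E * k (Y w)))).
    apply: eq_integral => s _; rewrite /G /line !muleA -!EFinM; congr (_%:E * _).
    have /gt_eqF/negbT f1 := zetaY_gt0 w (- s *: e)%R; rewrite -/(field _ _) in f1.
    have /gt_eqF/negbT f2 := zetaY_gt0 w 0%R; rewrite th0// in f2.
    by field; rewrite f1 f2.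
  rewrite ge0_integralZr//; last by rewrite mule_ge0.
    by rewrite integral_indic// setIT.
  exact/measurable_EFinP.
rewrite leftE -rightE; apply: eq_integral => r _; apply: invariant => [|y]; last exact: G0.
exact: (measurableT_comp mF (measurable_fun_pair (measurable_cst r) (@measurable_id _ _ setT))).
Qed.

Lemma palm_directional (t : R) (k : S -> \bar R) : measurable_fun setT k ->
  (forall y, 0 <= k y) -> palm (k \o th (t *: e)%R) = palm k.
Proof.
move=> mk k0.
have mkt : measurable_fun setT (k \o th (t *: e)%R).
  apply: (measurableT_comp mk).
  exact: (measurable_th mth (measurable_cst _) (@measurable_id _ _ setT)).
have leb1 (a : R) : leb `[a, (a + 1)%R[%classic = 1.
  by rewrite lebesgue_measure_itv/= lte_fin ltrDl ltr01 -EFinB addrAC subrr add0r.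
have mB (a : R) : measurable (`[a, (a + 1)%R[%classic : set R) by [].
have kt0 y : 0 <= (k \o th (t *: e)%R) y by exact: k0.
have e1 := palm_average (mB 0%R) mkt kt0.
have e2 := palm_average (mB t) mk k0.
rewrite !leb1 !mul1e in e1 e2; rewrite -e1 -e2.
pose J (s : R) : \bar R := (\1_(`[t, (t + 1)%R[%classic : set R) s)%:E * palm (k \o th (s *: e)%R).
rewrite -[RHS](@ge0_integral_lebesgue_translation R t J).
- apply: eq_integral => s _; rewrite /J; congr (_%:E * palm _).
    rewrite !indicE; congr ((nat_of_bool _)%:R).
    apply/idP/idP => /set_mem h; apply/mem_set; move: h;
      by rewrite /= !in_itv/= add0r lerDr [(s + t)%R]addrC ltrD2l.
  by apply/funext => y /=; rewrite thD// -scalerDl addrC.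
- apply: emeasurable_funM; first by apply/measurable_EFinP; exact: measurable_indic.
  apply: (@measurable_fun_fubini_tonelli_G _ _ _ _ _ P (fun q : Omega * R =>
    ((zeta (Y q.1))^-1)%:E * k (th (q.2 *: e)%R (Y q.1)))).
    have mY1 : measurable_fun setT (fun q : Omega * R => Y q.1).
      exact: measurableT_comp mY measurable_fst.
    apply: emeasurable_funM.
      by apply/measurable_EFinP; apply: measurable_invr; exact: measurableT_comp mzeta mY1.
    apply: (measurableT_comp mk); apply: (measurable_th mth) => //.
    exact: measurable_rVZ.
  by move=> q; rewrite mule_ge0// lee_fin invr_ge0.
- move=> s; rewrite mule_ge0 ?lee_fin//; apply: integral_ge0 => w _.
  by rewrite mule_ge0 ?lee_fin ?invr_ge0//; exact: k0.
Qed.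

End directional_shift.

(** * Processes with a density field *)

Lemma additive_action_pair (R : realType) n (G1 G2 : Type)
    (theta1 : 'rV[R]_n -> G1 -> G1) (theta2 : 'rV[R]_n -> G2 -> G2) :
  additive_action theta1 -> additive_action theta2 ->
  additive_action (pair_shift theta1 theta2).
Proof.
move=> [a0 aD] [b0 bD]; split => [[w1 w2]|s t [w1 w2]]; rewrite /pair_shift /=.
  by rewrite a0 b0.
by rewrite aD bD.
Qed.

Lemma shift_measurable_pair (R : realType) n d1 d2 (G1 : measurableType d1)
    (G2 : measurableType d2) (theta1 : 'rV[R]_n -> G1 -> G1)
    (theta2 : 'rV[R]_n -> G2 -> G2) :
  shift_measurable theta1 -> shift_measurable theta2 ->
  shift_measurable (pair_shift theta1 theta2).
Proof.
move=> m1 m2; apply: measurable_fun_pair.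
  apply: (measurableT_comp m1 (g := fun p : 'rV[R]_n * (G1 * G2) => (p.1, p.2.1))).
  by apply: measurable_fun_pair => //; exact: measurableT_comp measurable_fst measurable_snd.
apply: (measurableT_comp m2 (g := fun p : 'rV[R]_n * (G1 * G2) => (p.1, p.2.2))).
by apply: measurable_fun_pair => //; exact: measurableT_comp measurable_snd measurable_snd.
Qed.

Lemma field_shift_action (R : realType) n (H : path_space R n) :
  additive_action (@field_shift R n H).
Proof.
have ext (z1 z2 : field_path H) : field_val z1 = field_val z2 -> z1 = z2.
  case: z1 z2 => f1 p1 [f2 p2] /= f12; subst f2.
  by congr FieldPath; exact: Prop_irrelevance.
split => [z|s t z]; apply: ext; apply/funext => x /=; rewrite /fun_shift ?add0r//.
by rewrite addrA [(t + s)%R]addrC.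
Qed.

Lemma measurable_field_eval (R : realType) n (H : path_space R n) s :
  measurable_fun setT (fun z : field_path H => z s).
Proof. by move=> _ B mB; apply: sub_sigma_algebra; exists s => //; exists B. Qed.

Lemma eq_distrP (R : realType) d d' (T : measurableType d) (S : measurableType d')
    (P : {measure set T -> \bar R}) (Y1 Y2 : T -> S) :
  measurable_fun setT Y1 -> measurable_fun setT Y2 ->
  eq_distr P Y1 Y2 <-> forall f : S -> \bar R,
    measurable_fun setT f -> (forall y, 0 <= f y)%E ->
    (\int[P]_w f (Y1 w) = \int[P]_w f (Y2 w))%E.
Proof.
move=> mY1 mY2; split => [Y12 f mf f0|Y12 A mA].
  rewrite -!(ge0_integral_image_measure P _ mf f0).
  by apply: eq_measure_integral => A mA _; exact: Y12.
have i1 : measurable_fun setT (fun y : S => (\1_A y : R)%:E).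
  by apply/measurable_EFinP; exact: measurable_indic.
have := Y12 _ i1 (fun y => _); rewrite -!/(\1_(_ @^-1` A) _).
have iE (Y : T -> S) : measurable_fun setT Y ->
    (\int[P]_w (\1_A (Y w) : R)%:E = pushforward P Y A)%E.
  move=> mY; rewrite /pushforward -[in RHS](setIT (_ @^-1` _)) -integral_indic//.
  exact: measurable_preimage.
by rewrite !iE// => -> // y; rewrite lee_fin.
Qed.

Section path_process.
Context (R : realType) (n : nat) (d : measure_display) (Omega : measurableType d)
    (P : {sigma_finite_measure set Omega -> \bar R})
    (d' : measure_display) (E : measurableType d')
    (theta : 'rV[R]_n -> E -> E)
    (theta_action : additive_action theta)
    (theta_measurable : shift_measurable theta)
    (X : Omega -> E) (X_measurable : measurable_fun setT X)
    (H : path_space R n)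
    (Z : Omega -> field_path H) (Z_measurable : measurable_fun setT Z)
    (xi : Omega -> lfmeasure R n) (xi_measurable : measurable_fun setT xi)
    (xi_density : density_field Z xi)
    (Z_gt0 : forall w s, 0 < Z w s).
Local Open Scope ereal_scope.
Local Notation V := 'rV[R]_n.
Local Notation lam := (lebesgue_rV R n).
Local Notation S := ((E * field_path H) * lfmeasure R n)%type.

Let th : V -> S -> S :=
  pair_shift (pair_shift theta (@field_shift R n H)) (@lfmeasure_shift R n).
Let zeta (y : S) : R := y.1.2 0%R.
Let Y (w : Omega) : S := ((X w, Z w), xi w).

Let th_action : additive_action th.
Proof.
apply: additive_action_pair; last exact: lfmeasure_shift_action.
by apply: additive_action_pair => //; exact: field_shift_action.
Qed.

Let mth : shift_measurable th.
Proof.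
apply: shift_measurable_pair; last exact: lfmeasure_shift_measurable.
by apply: shift_measurable_pair => //; exact: xi_density.1.
Qed.

Let mzeta : measurable_fun setT zeta.
Proof.
exact: (measurableT_comp (measurable_field_eval 0%R)
  (measurableT_comp measurable_snd measurable_fst)).
Qed.

Let zeta_ge0 y : (0 <= zeta y)%R.
Proof. by apply: paths_ge0; exact: field_pathP. Qed.

Let mY : measurable_fun setT Y.
Proof. by apply: measurable_fun_pair => //; exact: measurable_fun_pair. Qed.

Let fieldE y s : field th zeta y s = y.1.2 s.
Proof. by rewrite /field /zeta /= /fun_shift addr0. Qed.

Let zetaY_gt0 w s : (0 < zeta (th s (Y w)))%R.
Proof. by rewrite -[zeta _]/(field th zeta (Y w) s) fieldE; exact: Z_gt0. Qed.

Let mfieldY w : measurable_fun setT (fun s => field th zeta (Y w) s).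
Proof.
exact: (measurableT_comp mzeta
  (measurable_th mth (@measurable_id _ _ setT) (measurable_cst (Y w)))).
Qed.

Let xiE w B : measurable B -> xi w B = \int[lam]_(s in B) (field th zeta (Y w) s)%:E.
Proof.
move=> mB; rewrite xi_density.2//; apply: eq_integral => s _.
by rewrite fieldE.
Qed.

Let integral_xi w (g : V -> \bar R) : measurable_fun setT g -> (forall s, 0 <= g s) ->
  \int[xi w]_s g s = \int[lam]_s ((field th zeta (Y w) s)%:E * g s).
Proof.
move=> mg g0; rewrite -(ge0_integral_density_measure lam (mfieldY w)
  (fun s => zeta_ge0 (th s (Y w))) mg g0).
by apply: eq_measure_integral => B mB _; exact: xiE.
Qed.

Let locally_integrable_field w (B : set V) : measurable B -> bounded_set B ->
  \int[lam]_(x in B) (field th zeta (Y w) x)%:E < +oo.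
Proof. by move=> mB bB; rewrite -xiE//; exact: lfmeasureP. Qed.

Let stationary := stationary P th zeta Y.

Let measurable_allocation (pi : field_path H -> V) w : measurable_fun setT pi ->
  measurable_fun setT (fun s : V => (s + pi (field_shift s (Z w)))%R).
Proof.
move=> mpi; apply: (measurable_rVD (@measurable_id _ _ setT)).
apply: (measurableT_comp mpi).
exact: (measurableT_comp xi_density.1
  (measurable_fun_pair (@measurable_id _ _ setT) (measurable_cst (Z w)))).
Qed.

Lemma stationary_invariant : stationary ->
  invariant_under_preserving_shifts P Z xi theta X.
Proof.
move=> stat pi [mpi pres].
pose pi' (y : S) := pi y.1.2.
have mpi' : measurable_fun setT pi'.
  exact: (measurableT_comp mpi (measurableT_comp measurable_snd measurable_fst)).
apply/eq_distrP => //.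
  exact: (measurable_th mth (measurableT_comp mpi Z_measurable) mY).
move=> f mf f0.
apply: (stationary_preserving th_action mth mzeta zeta_ge0 mY zetaY_gt0 (pi := pi')) => //.
move=> w g mg g0; have mtau := measurable_allocation w mpi.
rewrite -[LHS](@integral_xi w (fun s => g (s + pi (field_shift s (Z w)))%R)).
- rewrite -[RHS]integral_xi//.
  by apply: (ge0_integral_comp mtau) => // A mA; exact: pres.
- exact: measurableT_comp mg mtau.
- by move=> s; exact: g0.
Qed.

Hypothesis lines : forall w (x e : V), e != 0%R ->
  proper_density (fun u => Z w (x + u *: e)%R).

Lemma invariant_stationary : invariant_under_preserving_shifts P Z xi theta X ->
  stationary.
Proof.
move=> inv t k mk k0.
have [->|t0] := eqVneq t 0%R.
  by congr palm; apply/funext => y /=; rewrite (th0 th_action).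
have linesY w x : proper_density (fun u => field th zeta (Y w) (x + u *: t)%R).
  have := lines w x t0; congr proper_density; apply/funext => u.
  by rewrite fieldE.
have := @palm_directional R n d Omega P _ S th th_action mth zeta mzeta zeta_ge0 Y mY
  zetaY_gt0 t linesY _ 1%R k mk k0; rewrite scale1r; apply.
move=> r f mf f0.
pose pi (z : field_path H) : V := (quantile (fun u => z (u *: t)%R) r *: t)%R.
have piE w : directional_shift th zeta t r (Y w) = pi (Z w).
  congr (quantile _ r *: t)%R; apply/funext => u; exact: fieldE.
have piE' s w : directional_shift th zeta t r (th s (Y w)) = pi (field_shift s (Z w)).
  congr (quantile _ r *: t)%R; apply/funext => u; exact: fieldE.
have mZu : measurable_fun setT (fun q : field_path H * R => q.1 (q.2 *: t)%R).
  have m1 : measurable_fun setT (fun q : field_path H * R => field_shift (q.2 *: t)%R q.1).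
    apply: (measurableT_comp xi_density.1 (g := fun q : field_path H * R => ((q.2 *: t)%R, q.1))).
    by apply: measurable_fun_pair => //; exact: measurable_rVZ.
  have := measurableT_comp (measurable_field_eval 0%R) m1; congr measurable_fun.
  by apply/funext => q; rewrite /= /fun_shift addr0.
have mpi : measurable_fun setT pi.
  apply: measurable_rVZ.
  have zu0 (z : field_path H) u : (0 <= z (u *: t)%R)%R by apply: paths_ge0; exact: field_pathP.
  exact: (measurableT_comp (measurable_quantile mZu zu0)
    (measurable_fun_pair (@measurable_id _ _ setT) (measurable_cst r))).
have pres : preserving_shift Z xi pi.
  split => // w B mB.
  have mi : measurable_fun setT (fun s : V => (\1_B s : R)%:E).
    by apply/measurable_EFinP; exact: measurable_indic.
  have mtau := measurable_allocation w mpi.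
  have iE (f' : V -> V) : measurable_fun setT f' ->
      xi w (f' @^-1` B) = \int[xi w]_s (\1_B (f' s) : R)%:E.
    move=> mf'; rewrite -[in LHS](setIT (_ @^-1` _)) -integral_indic//.
    exact: measurable_preimage.
  rewrite (iE _ mtau) (iE id (@measurable_id _ _ setT)).
  rewrite (@integral_xi w _ (measurableT_comp mi mtau)) => [|s]; last by rewrite lee_fin.
  rewrite (@integral_xi w _ mi) => [|s]; last by rewrite lee_fin.
  rewrite -(directional_shift_preserving th_action mth mzeta zeta_ge0 t0 linesY r w mi) => [|s]; last first.
    by rewrite lee_fin.
  by apply: eq_integral => s _; rewrite /= piE'.
have mpiZ : measurable_fun setT (fun w => th (pi (Z w)) (Y w)).
  exact: (measurable_th mth (measurableT_comp mpi Z_measurable) mY).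
have /(eq_distrP P mpiZ mY) /(_ f mf f0) <- := inv _ pres.
by apply: eq_integral => w _; rewrite piE.
Qed.

Let cond_window w u (C B : set V) : measurable C -> measurable B ->
  cond_measure (xi w) [set (c - u)%R | c in C] B = window_kernel th zeta C B (Y w) u.
Proof.
move=> mC mB; rewrite /cond_measure /window_kernel.
have -> : [set (c - u)%R | c in C] = (fun v => (v + u)%R) @^-1` C.
  apply/seteqP; split => [_ [c Cc <-]|v Cv] /=; first by rewrite subrK.
  by exists (v + u)%R => //; rewrite addrK.
have mCu : measurable ((fun v : V => (v + u)%R) @^-1` C).
  exact: (measurable_preimage (measurable_mxD u) mC).
have xi_indic (D : set V) : measurable D ->
    xi w D = \int[lam]_x (\1_D x * field th zeta (Y w) x)%:E.
  move=> mD; rewrite xiE// integral_mkcond; apply: eq_integral => x _.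
  by rewrite patchE indicE; case: ifPn => _; rewrite ?mul1r ?mul0r.
congr (_ * (fine _)^-1%:E); last first.
  rewrite xi_indic// (window_massE mth mzeta zeta_ge0)//.
have mBC := measurableI _ _ mB mCu.
rewrite xi_indic// -(@ge0_integral_lebesgue_rV_translation _ _ (- u)%R
  (fun x => (\1_(B `&` (fun v => (v + u)%R) @^-1` C) x * field th zeta (Y w) x)%:E)).
- apply: eq_integral => x _; congr (_ * _)%:E.
  rewrite !indicE -natrM mulnb; congr ((nat_of_bool _)%:R).
  apply/idP/andP => [/set_mem[Bx /=]|[/set_mem Cx /set_mem Bx]].
    by rewrite subrK => Cx; split; exact: mem_set.
  by apply/mem_set; split => //=; rewrite subrK.
- apply/measurable_EFinP; apply: measurable_funM => //; exact: measurable_indic.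
- by move=> x; rewrite lee_fin mulr_ge0// zeta_ge0.
Qed.

Section window.
Variable C : set V.
Hypotheses (mC : measurable C) (bC : bounded_set C) (C0 : 0 < lam C).

Let wm := window_measure P mth mzeta zeta_ge0 mY mC.
Let base (q : Omega * (V * V)) : S * V := (Y q.1, q.2.1).
Let offset (q : Omega * (V * V)) : V := (q.2.2 - q.2.1)%R.

Let mbase : measurable_fun setT base.
Proof.
apply: measurable_fun_pair; first exact: measurableT_comp mY measurable_fst.
exact: measurableT_comp measurable_fst measurable_snd.
Qed.

Let moffset : measurable_fun setT offset.
Proof. exact: measurable_pair_diff. Qed.

Let mYV : measurable_fun setT (fun r : Omega * V => (Y r.1, r.2)).
Proof. by apply: measurable_fun_pair => //; exact: measurableT_comp mY measurable_fst. Qed.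

Let indic_measure d1 (T : measurableType d1) (mu : {measure set T -> \bar R})
    (A : set T) : measurable A -> mu A = \int[mu]_q (\1_A q : R)%:E.
Proof. by move=> mA; rewrite integral_indic// setIT. Qed.

Let m_indic d1 (T : measurableType d1) (A : set T) : measurable A ->
  measurable_fun setT (fun q => (\1_A q : R)%:E).
Proof. by move=> mA; apply/measurable_EFinP; exact: measurable_indic. Qed.

Let wm_rect (A : set S) (B : set V) : measurable A -> measurable B ->
  wm (base @^-1` (A `*` B)) = cond_measure lam C B * P (Y @^-1` A).
Proof.
move=> mA mB; have mAB := measurableX mA mB.
rewrite indic_measure; last exact: measurable_preimage.
pose J (r : Omega * V) : \bar R := (\1_(A `*` B) (Y r.1, r.2) : R)%:E.
have J0 r : 0 <= J r by rewrite lee_fin.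
rewrite -[X in X = _]/(\int[wm]_q J (q.1, q.2.1)).
rewrite (integral_window_fst P mth mzeta zeta_ge0 mY zetaY_gt0
  locally_integrable_field mC bC C0 (measurableT_comp (m_indic mAB) mYV) J0).
have mYA : measurable (Y @^-1` A) by exact: measurable_preimage.
rewrite [P _]indic_measure// -ge0_integralZl//; last 2 first.
- exact: m_indic.
- by rewrite /cond_measure mule_ge0// lee_fin invr_ge0 fine_ge0.
apply: eq_integral => w _.
rewrite /cond_measure muleAC -muleA; have mBC := measurableI _ _ mB mC.
rewrite [lam (B `&` C)](indic_measure lam mBC) -ge0_integralZr//; last 2 first.
- exact: m_indic.
- by rewrite mule_ge0// lee_fin invr_ge0 fine_ge0.
apply: eq_integral => u _; rewrite -!EFinM; congr (_%:E).
rewrite /J; have -> : (\1_(A `*` B) (Y w, u) = \1_(Y @^-1` A) w * \1_B u :> R)%R.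
  rewrite !indicE -natrM mulnb; congr ((nat_of_bool _)%:R).
  apply/idP/andP => [/set_mem[? ?]|[/set_mem ? /set_mem ?]].
    by split; exact: mem_set.
  exact: mem_set.
have -> : (\1_(B `&` C) u = \1_B u * \1_C u :> R)%R by rewrite indicI.
by ring.
Qed.

Let cond_setT : cond_measure lam C setT = 1.
Proof.
rewrite /cond_measure setTI.
have fC : lam C \is a fin_num by rewrite ge0_fin_numE//; exact: lebesgue_rV_bounded.
rewrite -[X in X * _](fineK fC) -EFinM mulfV// gt_eqF// fine_gt0// C0/=.
by rewrite -ge0_fin_numE// ltW.
Qed.

Let wm_kernel (A : set (S * V)) (B : set V) : measurable A -> measurable B ->
  wm (base @^-1` A `&` offset @^-1` B) =
  \int[wm]_(q in base @^-1` A) window_kernel th zeta C B (Y q.1) q.2.1.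
Proof.
move=> mA mB.
rewrite indic_measure; last by apply: measurableI; exact: measurable_preimage.
pose J (r : Omega * V) : \bar R := (\1_A (Y r.1, r.2) : R)%:E.
have J0 r : 0 <= J r by rewrite lee_fin.
have E1 := integral_window_kernel P mth mzeta zeta_ge0 mY zetaY_gt0
  locally_integrable_field mC bC C0 mB (measurableT_comp (m_indic mA) mYV) J0.
rewrite [RHS]integral_mkcond.
transitivity (\int[wm]_q (J (q.1, q.2.1) * (\1_B (q.2.2 - q.2.1)%R)%:E)).
  apply: eq_integral => q _; rewrite -EFinM; congr (_%:E).
  by rewrite indicI.
rewrite [LHS]E1; apply: eq_integral => q _; rewrite patchE /= indicE.
have -> : (q \in base @^-1` A) = ((Y q.1, q.2.1) \in A).
  by apply/idP/idP => /set_mem h; exact: mem_set.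
by case: ifPn => _; rewrite ?mul1e ?mul0e.
Qed.

Let integral_moved_offset (f : S * V -> \bar R) :
  \int[wm]_q f (moved th Y q).1 =
  \int[wm]_q f (th (offset q) (Y q.1), (offset q + q.2.1)%R).
Proof. by apply: eq_integral => q _; rewrite /moved /offset /= subrK. Qed.

Lemma mass_stationary_window_mecke :
  jordan C -> mass_stationary P (pair_shift theta (@field_shift R n H))
    (fun w => (X w, Z w)) xi -> window_mecke P mth mzeta zeta_ge0 mY C.
Proof.
move=> jC [_ ms].
apply/(window_meckeP P th_action mth mzeta zeta_ge0 mY mC bC C0) => f mf f0.
rewrite integral_moved_offset.
have mZ : measurable_fun setT (fun q : Omega * (V * V) => (th (offset q) (Y q.1), (offset q + q.2.1)%R)).
  apply: measurable_fun_pair.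
    exact: (measurable_th mth moffset (measurableT_comp mY measurable_fst)).
  exact: (measurable_rVD moffset (measurableT_comp measurable_fst measurable_snd)).
apply: (proj1 (eq_distrP wm mZ mbase)) => //.
apply: (ms C mC bC C0 jC.2 _ _ wm fst (fun q => q.2.1) offset) => //.
- move=> A mA; have mfA : measurable (fst @^-1` A : set (Omega * (V * V))).
    exact: (measurable_preimage measurable_fst mA).
  rewrite (indic_measure wm mfA) (indic_measure P mA).
  pose J (r : Omega * V) : \bar R := (\1_A r.1 : R)%:E.
  have mJ : measurable_fun setT J by exact: (measurableT_comp (m_indic mA) measurable_fst).
  have J0 r : 0 <= J r by rewrite lee_fin.
  rewrite -[X in X = _]/(\int[wm]_q J (q.1, q.2.1)).
  rewrite (integral_window_fst P mth mzeta zeta_ge0 mY zetaY_gt0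
    locally_integrable_field mC bC C0 mJ J0).
  apply: eq_integral => w _; rewrite /J /=.
  rewrite ge0_integralZr//; last 2 first.
  - apply/measurable_EFinP; apply: measurable_funM => //; exact: measurable_indic.
  - by move=> u _; rewrite lee_fin mulr_ge0// invr_ge0 fine_ge0.
  rewrite -[RHS]mul1e; congr (_ * _); rewrite -cond_setT /cond_measure setTI.
  set l := ((fine (lam C))^-1)%R.
  have l0 : (0 <= l)%R by rewrite invr_ge0 fine_ge0.
  rewrite (indic_measure lam mC) -ge0_integralZr//.
  exact: m_indic.
- exact: measurableT_comp measurable_fst measurable_snd.
- move=> A B mA mB.
  rewrite -[LHS]/(wm (base @^-1` (A `*` B))) wm_rect//.
  rewrite integral_cst; last exact: (measurable_preimage (measurableT_comp mY measurable_fst) mA).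
  congr (_ * _).
  transitivity (wm (base @^-1` (A `*` setT))); first by rewrite wm_rect// cond_setT mul1e.
  by congr (wm _); apply/seteqP; split => q //= [].
move=> A B mA mB; rewrite -[LHS]/(wm (base @^-1` A `&` offset @^-1` B)) wm_kernel//.
by apply: eq_integral => q _; rewrite -cond_window.
Qed.

Variable F : nat -> set S.
Hypotheses (mF : forall k, measurable (F k)) (ndF : nondecreasing_seq F)
  (FT : \bigcup_k F k = setT) (finF : forall k, P (Y @^-1` F k) < +oo).

Section joint_law.
Context e (Omega' : measurableType e) (P' : {measure set Omega' -> \bar R})
  (p : Omega' -> Omega) (U W : Omega' -> V).
Hypotheses (mp : measurable_fun setT p)
  (pP : forall A, measurable A -> P' (p @^-1` A) = P A)
  (mU : measurable_fun setT U) (mW : measurable_fun setT W).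
Hypothesis condU : cond_distr P' (Y \o p) U (fun _ => cond_measure lam C).
Hypothesis condW : cond_distr P' (fun w => (Y (p w), U w)) W
  (fun y => cond_measure y.1.2 [set (c - y.2)%R | c in C]).

Let base' (w : Omega') : S * V := (Y (p w), U w).

Let mbase' : measurable_fun setT base'.
Proof. by apply: measurable_fun_pair => //; exact: measurableT_comp. Qed.

Lemma law_base (D : set (S * V)) : measurable D ->
  P' (base' @^-1` D) = wm (base @^-1` D).
Proof.
move=> mD.
apply: (@prod_measure_eq _ _ _ _ _ (image_measure P' mbase') (image_measure wm mbase) F) => //.
- move=> k; rewrite -[X in X < _]/(P' (base' @^-1` (F k `*` setT))).
  rewrite (_ : base' @^-1` _ = p @^-1` (Y @^-1` F k)); last first.
    by apply/seteqP; split => w //= [].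
  by rewrite pP//; exact: measurable_preimage.
move=> k A B mA mB; have mAF : measurable (A `&` F k) by exact: measurableI.
rewrite -[LHS]/(P' (base' @^-1` ((A `&` F k) `*` B))).
rewrite -[RHS]/(wm (base @^-1` ((A `&` F k) `*` B))) wm_rect//.
have -> : base' @^-1` ((A `&` F k) `*` B) = (Y \o p) @^-1` (A `&` F k) `&` U @^-1` B.
  by apply/seteqP; split => w.
rewrite condU// integral_cst; last first.
  by apply: measurable_preimage => //; exact: measurableT_comp.
congr (_ * _); rewrite -[RHS]pP//; exact: measurable_preimage.
Qed.

Let mbaseW : measurable_fun setT (fun w => (base' w, W w)).
Proof. exact: measurable_fun_pair. Qed.

Let mbase_offset : measurable_fun setT (fun q => (base q, offset q)).
Proof. exact: measurable_fun_pair. Qed.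

Lemma law_base_offset (D : set ((S * V) * V)) : measurable D ->
  P' ((fun w => (base' w, W w)) @^-1` D) = wm ((fun q => (base q, offset q)) @^-1` D).
Proof.
move=> mD.
apply: (@prod_measure_eq _ _ _ _ _ (image_measure P' mbaseW) (image_measure wm mbase_offset)
  (fun k => F k `*` setT)) => //.
- by move=> k; exact: measurableX.
- move=> i j ij; apply/subsetPset => -[y u] [/= Fy _]; split => //.
  by have /subsetPset := ndF ij; exact.
- apply/seteqP; split => // -[y u] _; have [k _ Fy] : (\bigcup_k F k) y by rewrite FT.
  by exists k.
- move=> k; rewrite -[X in X < _]/(P' ((fun w => (base' w, W w)) @^-1` ((F k `*` setT) `*` setT))).
  rewrite (_ : _ @^-1` _ = p @^-1` (Y @^-1` F k)); last first.
    by apply/seteqP; split => w //= [[]].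
  by rewrite pP//; exact: measurable_preimage.
move=> k A B mA mB.
pose A' := A `&` (F k `*` setT).
have mA' : measurable A' by apply: measurableI => //; exact: measurableX.
rewrite -[LHS]/(P' (base' @^-1` A' `&` W @^-1` B)).
rewrite -[RHS]/(wm (base @^-1` A' `&` offset @^-1` B)) wm_kernel// condW//.
have mk : measurable_fun setT (fun r : S * V => window_kernel th zeta C B r.1 r.2).
  exact: measurable_window_kernel.
have k0 (r : S * V) : 0 <= window_kernel th zeta C B r.1 r.2.
  exact: window_kernel_ge0.
transitivity (\int[P']_(w in base' @^-1` A') window_kernel th zeta C B (base' w).1 (base' w).2).
  by apply: eq_integral => w _; rewrite -cond_window.
rewrite -[LHS](ge0_integral_pushforward mbase' P' mA' (f := fun r => window_kernel th zeta C B r.1 r.2)) => [||r _]; last exact: k0.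
- rewrite -[RHS](ge0_integral_pushforward mbase wm mA' (f := fun r => window_kernel th zeta C B r.1 r.2)) => [||r _]; last exact: k0.
  + by apply: eq_measure_integral => D' mD' _; exact: law_base.
  + exact: measurable_funTS.
- exact: measurable_funTS.
Qed.

Lemma window_mecke_eq_distr : window_mecke P mth mzeta zeta_ge0 mY C ->
  eq_distr P' (fun w => (th (W w) (Y (p w)), (W w + U w)%R)) base'.
Proof.
move=> /(window_meckeP P th_action mth mzeta zeta_ge0 mY mC bC C0) mecke A mA.
pose psi (r : (S * V) * V) : S * V := (th r.2 r.1.1, (r.2 + r.1.2)%R).
have mpsi : measurable_fun setT psi.
  apply: measurable_fun_pair.
    exact: (measurable_th mth measurable_snd (measurableT_comp measurable_fst measurable_fst)).
  exact: (measurable_rVD measurable_snd (measurableT_comp measurable_snd measurable_fst)).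
rewrite /pushforward law_base//.
rewrite -[LHS]/(P' ((fun w => (base' w, W w)) @^-1` (psi @^-1` A))).
rewrite law_base_offset; last exact: measurable_preimage.
have mpo : measurable_fun setT (fun q => psi (base q, offset q)) by exact: measurableT_comp.
rewrite -[LHS]/(wm ((fun q => psi (base q, offset q)) @^-1` A)).
rewrite (indic_measure wm (measurable_preimage mpo mA)).
rewrite (indic_measure wm (measurable_preimage mbase mA)).
have i0 (r : S * V) : 0 <= (\1_A r : R)%:E by rewrite lee_fin.
rewrite -[RHS](mecke _ (m_indic mA) i0).
by rewrite (integral_moved_offset (fun r => (\1_A r : R)%:E)).
Qed.

End joint_law.

End window.

Lemma in_support_xi w : in_support 0%R (xi w).
Proof.
move=> A oA A0; have mA := open_measurable_mx oA.
rewrite xiE//; apply: ge0_integral_gt0 => //.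
- exact: measurable_funTS.
- by move=> x _; exact: zetaY_gt0.
- by apply: open_lebesgue_rV_gt0 => //; exists 0%R.
Qed.

Lemma mass_stationaryP : (0 < n)%N ->
  sigma_finite setT (pushforward P (fun w => ((X w, Z w), xi w))) ->
  mass_stationary P (pair_shift theta (@field_shift R n H)) (fun w => (X w, Z w)) xi <->
  stationary.
Proof.
move=> n0 sfP.
have /sigma_finiteP[F [FT ndF mfF]] : sigma_finite setT (image_measure P mY) by exact: sfP.
have mF k : measurable (F k) by have [] := mfF k.
have finF k : P (Y @^-1` F k) < +oo by have [] := mfF k.
split => [ms|stat].
  apply: (window_mecke_implies_stationary th_action zetaY_gt0 locally_integrable_field
    mF ndF (esym FT) finF n0) => C bC jC C0.
  exact: (mass_stationary_window_mecke jC.1 bC C0 jC ms).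
split; first by apply: aeW => w; exact: in_support_xi.
move=> C mC bC C0 _ e Omega' P' p U W Wxi mp pP mU mW cU cW.
apply: (window_mecke_eq_distr mC bC C0 mF ndF (esym FT) finF mp pP mU mW cU cW).
exact: stationary_window_mecke.
Qed.

End path_process.

Lemma proper_density_line (R : realType) n (z : 'rV[R]_n -> R) (x e : 'rV[R]_n) :
  (forall s, 0 < z s) -> e != 0 ->
  (forall x e : 'rV[R]_n, e != 0 ->
    locally_integrable setT (fun t : R => z (x + t *: e))) ->
  (forall x e : 'rV[R]_n, e != 0 ->
    (\int[@lebesgue_measure R]_(t in `[0%R, +oo[) (z (x + t *: e))%:E = +oo)%E) ->
  proper_density (fun t => z (x + t *: e)).
Proof.
move=> z0 e0 zl zh; have [mz _ zK] := zl x e e0.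
split => // [a b||]; last 2 first.
- exact: zh.
- have eN0 : - e != 0 by rewrite oppr_eq0.
  have [mzN _ _] := zl x _ eN0; rewrite -(zh x _ eN0).
  rewrite (ge0_integration_by_substitution0 (f := fun t => (z (x + t *: - e))%:E)).
  + by apply: eq_integral => t _; rewrite scaleNr scalerN opprK.
  + exact/measurable_EFinP.
  + by move=> t; rewrite lee_fin ltW.
apply: le_lt_trans (zK `[a, b]%classic _ _) => //; last exact: segment_compact.
rewrite le_eqVlt; apply/orP; left; apply/eqP; apply: eq_integral => t _.
by rewrite ger0_norm// ltW.
Qed.

Lemma sigma_finite_pushforward (R : realType) d d' (T : measurableType d)
    (T' : measurableType d') (mu : {measure set T -> \bar R}) (f : T -> T') :
  measurable_fun setT f -> sigma_finite setT (pushforward mu f) ->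
  sigma_finite setT mu.
Proof.
move=> mf [F FT mF]; exists (fun k => f @^-1` F k); first by rewrite -preimage_bigcup -FT.
by move=> k; have [mFk] := mF k; split => //; exact: measurable_preimage.
Qed.

Lemma sigma_finite_measureE (R : realType) d (T : measurableType d)
    (mu : {measure set T -> \bar R}) : sigma_finite setT mu ->
  exists nu : {sigma_finite_measure set T -> \bar R}, nu = mu :> {measure set T -> \bar R}.
Proof.
case: mu => mu cmu sfmu.
pose mixin := Measure_isSigmaFinite.Build _ _ _ (Measure.Pack cmu) sfmu.
pose nu : {sigma_finite_measure set T -> \bar R} := HB.pack mu cmu mixin.
by exists nu; apply: eq_measure.
Qed.

Theorem theorem6 (R : realType) (n : nat) (n_gt0 : (0 < n)%N)
    (d : measure_display) (Omega : measurableType d)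
    (P : {measure set Omega -> \bar R})
    (d' : measure_display) (E : measurableType d')
    (theta : 'rV[R]_n -> E -> E)
    (theta_action : additive_action theta)
    (theta_measurable : shift_measurable theta)
    (X : Omega -> E) (X_measurable : measurable_fun setT X)
    (H : path_space R n)
    (Z : Omega -> field_path H) (Z_measurable : measurable_fun setT Z)
    (xi : Omega -> lfmeasure R n) (xi_measurable : measurable_fun setT xi)
    (xi_density : density_field Z xi)
    (sigma_finite_P :
       sigma_finite setT (pushforward P (fun w => ((X w, Z w), xi w))))
    (sigma_finite_invZ0P :
       sigma_finite setT
         (pushforward (fun A => \int[P]_(w in A) ((Z w 0)^-1)%:E)%E
            (fun w => ((X w, Z w), xi w))))
    (Z_gt0 : forall w s, 0 < Z w s)
    (Z_lines : forall w (x e : 'rV[R]_n), e != 0 ->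
       locally_integrable setT (fun t : R => Z w (x + t *: e)))
    (Z_half_lines : forall w (x e : 'rV[R]_n), e != 0 ->
       (\int[@lebesgue_measure R]_(t in `[0%R, +oo[) (Z w (x + t *: e))%:E
          = +oo)%E) :
  mass_stationary P (pair_shift theta (@field_shift R n H))
    (fun w => (X w, Z w)) xi <->
  invariant_under_preserving_shifts P Z xi theta X.
Proof.
have mY : measurable_fun setT (fun w => ((X w, Z w), xi w)).
  by apply: measurable_fun_pair => //; exact: measurable_fun_pair.
have [Q QP] := sigma_finite_measureE (sigma_finite_pushforward mY sigma_finite_P).
rewrite -QP in sigma_finite_P *.
have lines w (x e : 'rV[R]_n) : e != 0 -> proper_density (fun t => Z w (x + t *: e)).
  by move=> e0; exact (@proper_density_line R n (Z w) x e (Z_gt0 w) e0 (Z_lines w) (Z_half_lines w)).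
apply: (iff_trans (mass_stationaryP theta_action theta_measurable X_measurable Z_measurable
  xi_measurable xi_density Z_gt0 n_gt0 sigma_finite_P)).
split; first exact: stationary_invariant.
exact: (invariant_stationary theta_action theta_measurable X_measurable Z_measurable
  xi_measurable xi_density Z_gt0 lines).
Qed.
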